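(* Let $M$ be a closed surface and let $f\in\mathrm{End}^1(M)$ be a transitive endomorphism such that $\mathrm{int}(\mathrm{Cr}(f))$ is nonempty and $|\ker(Df^n)|=1$ for every $n\ge1$. Then either $f$ admits a dominated splitting, or $f$ can be approximated (in the $C^1$ topology) by endomorphisms having full-dimensional kernel.
   Context: A closed surface $M$ is a compact connected smooth 2-manifold without boundary, endowed with a Riemannian metric. $\mathrm{End}^1(M)$ is the space of all $C^1$ maps $M\to M$ with the $C^1$ topology; its elements are called endomorphisms. A map is transitive if some point has a forward orbit dense in $M$. $\mathrm{Cr}(f)=\{x\in M: Df_x\text{ is not an isomorphism}\}$ and $\mathrm{int}(\mathrm{Cr}(f))$ is its interior. $|\ker(Df^n)|=\max_{x\in M}\dim\ker(Df^n_x)$. An endomorphism $g$ has full-dimensional kernel if there exist $n\ge1$ and $x\in\mathrm{Cr}(g)$ with $\dim\ker(Dg^n_x)=\dim M=2$. A cone-field $\mathscr C$ on $M$ is a continuous family of closed cones $\mathscr C(x)\subset T_xM$, each of the form $\mathscr C(x)=\{u+w: u\in L(x),\ w\in L(x)^\perp,\ \|w\|\le \eta(x)\|u\|\}$ with $L(x)\subset T_xM$ a line and $0<\eta(x)<\infty$; its interior is $\mathrm{int}(\mathscr C(x))=\{u+w: \|w\|<\eta(x)\|u\|\}\cup\{0\}$. $\mathscr C$ is invariant for $f$ if for some $k\ge1$, $Df^k_x(\mathscr C(x))\subset \mathrm{int}(\mathscr C(f^k(x)))$ for all $x\in M$. $f$ admits a dominated splitting if it has an invariant cone-field $\mathscr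 C$ such that $\ker(Df^n_x)\cap\mathscr C(x)=\{0\}$ for all $x\in M$ and $n\ge1$. *)

(* Defs.v *)
From HB Require Import structures.
From mathcomp Require Import all_boot all_order all_algebra.
From mathcomp Require Import all_classical all_reals all_analysis.
Set Implicit Arguments.
Unset Strict Implicit.
Unset Printing Implicit Defensive.
Import Order.TTheory GRing.Theory Num.Theory.
Import numFieldNormedType.Exports.
Local Open Scope classical_set_scope.
Local Open Scope ring_scope.

(* Vectors are row vectors: a linear map with matrix [A] sends [v] to
   [v *m A], in accordance with the Jacobian ['J F p] of MathComp-Analysis,
   for which ['d F p v = v *m 'J F p]. *)

(* [F] is of class C^k on [U]; only meant for open [U]. *)
Fixpoint Ck (R : realType) (V : normedModType R) (k : nat)
    (U : set 'rV[R]_2) (F : 'rV[R]_2 -> V) : Prop :=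
  match k with
  | 0 => forall p, U p -> {for p, continuous F}
  | k'.+1 => (forall p, U p -> differentiable F p) /\
             forall v : 'rV[R]_2, Ck k' U (fun p => 'D_v F p)
  end.

(* A chart is a homeomorphism between an open set of [M] and an open set of
   the plane; the values of the two total functions outside of these open
   sets are irrelevant. *)
Record chart (R : realType) (M : topologicalType) := Chart {
  chart_dom : set M;
  chart_img : set 'rV[R]_2;
  chart_fun : M -> 'rV[R]_2;
  chart_inv : 'rV[R]_2 -> M;
  chart_dom_open : open chart_dom;
  chart_img_open : open chart_img;
  chart_funP : forall x, chart_dom x -> chart_img (chart_fun x);
  chart_invP : forall p, chart_img p -> chart_dom (chart_inv p);
  chart_funK : forall x, chart_dom x -> chart_inv (chart_fun x) = x;
  chart_invK : forall p, chart_img p -> chart_fun (chart_inv p) = p;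
  chart_fun_continuous :
    forall x, chart_dom x -> {for x, continuous chart_fun};
  chart_inv_continuous :
    forall p, chart_img p -> {for p, continuous chart_inv} }.

(* The expression of [f] in the charts [a] (source) and [b] (target), and the
   open set of the plane on which it is meaningful. *)
Definition in_charts (R : realType) (M : topologicalType) (a b : chart R M)
  (f : M -> M) : 'rV[R]_2 -> 'rV[R]_2 :=
  fun p => chart_fun b (f (chart_inv a p)).

Definition in_charts_dom (R : realType) (M : topologicalType)
  (a b : chart R M) (f : M -> M) : set 'rV[R]_2 :=
  [set p | chart_img a p /\ chart_dom b (f (chart_inv a p))].

(* Second countability is not required separately: it follows from
   compactness. The field [chart_at] selects a chart around each point, and
   only serves to represent tangent vectors by coordinates. *)
Record closed_surface (R : realType) := ClosedSurface {
  surface_space :> topologicalType;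
  surface_hausdorff : hausdorff_space surface_space;
  surface_compact : compact [set: surface_space];
  surface_connected : connected [set: surface_space];
  atlas : set (chart R surface_space);
  atlas_smooth : forall a b, atlas a -> atlas b ->
    forall k, Ck k (in_charts_dom a b id) (in_charts a b id);
  chart_at : surface_space -> chart R surface_space;
  chart_at_atlas : forall x, atlas (chart_at x);
  chart_at_dom : forall x, chart_dom (chart_at x) x }.

(* The tangent space T_xM is R^2: a tangent vector at [x] is given by its
   components in the chart [chart_at M x]. *)
Definition tangent (R : realType) (M : closed_surface R) (x : M) :=
  'rV[R]_2.

(* The derivative Df_x : T_xM -> T_{f(x)}M. *)
Definition tderiv (R : realType) (M : closed_surface R) (f : M -> M) (x : M) :
    'M[R]_2 :=
  'J (in_charts (chart_at x) (chart_at (f x)) f) (chart_fun (chart_at x) x).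

(* The coordinate frame of the chart [a] at [x]: the rows are the coordinate
   vectors d/dx_1 and d/dx_2 of [a], as elements of T_xM. Hence
   [v *m chart_frame a x] is the tangent vector with components [v] in [a]. *)
Definition chart_frame (R : realType) (M : closed_surface R) (a : chart R M)
    (x : M) : 'M[R]_2 :=
  'J (in_charts a (chart_at x) id) (chart_fun a x).

(* [metric x] is the Gram matrix of the scalar product of T_xM. *)
Record riemannian_metric (R : realType) (M : closed_surface R) :=
  RiemannianMetric {
  metric :> M -> 'M[R]_2;
  metric_sym : forall x, (metric x)^T = metric x;
  metric_pos : forall x (v : tangent x), v != 0 ->
    0 < (v *m metric x *m v^T) 0 0;
  metric_smooth : forall a, atlas a -> forall k,
    Ck k (chart_img a) (fun p =>
      chart_frame a (chart_inv a p) *m metric (chart_inv a p)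
        *m (chart_frame a (chart_inv a p))^T) }.

Section Geometry.
Context (R : realType) (M : closed_surface R).

Definition inner (g : riemannian_metric M) (x : M) (v w : tangent x) : R :=
  (v *m g x *m w^T) 0 0.

Definition tnorm (g : riemannian_metric M) (x : M) (v : tangent x) : R :=
  Num.sqrt (inner g v v).

Definition C1_map (f : M -> M) : Prop :=
  continuous f /\
  forall a b, atlas a -> atlas b ->
    Ck 1 (in_charts_dom a b f) (in_charts a b f).

Record End1 := MkEnd1 { endo :> M -> M; endoP : C1_map endo }.

HB.instance Definition _ := gen_eqMixin End1.
HB.instance Definition _ := gen_choiceMixin End1.

(* The C^1 topology is generated by the sets of maps that are C^1-close to a
   given map on a given compact subset of a chart domain. *)
Definition C1_subbasic : set (set End1) :=
  [set B | exists (f : End1) (a b : chart R M) (K : set M) (e : R),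
    [/\ atlas a /\ atlas b, compact K,
        K `<=` chart_dom a /\ f @` K `<=` chart_dom b, 0 < e &
        B = [set h : End1 | forall x, K x ->
          [/\ chart_dom b (h x),
              `|chart_fun b (h x) - chart_fun b (f x)| < e &
              `|'J (in_charts a b h) (chart_fun a x) -
                'J (in_charts a b f) (chart_fun a x)| < e]]]].

HB.instance Definition _ :=
  isSubBaseTopological.Build End1 C1_subbasic (fun B : set End1 => B).

Definition transitive_map (f : M -> M) : Prop :=
  exists x : M, dense [set iter n f x | n in [set: nat]].

Definition Cr (f : M -> M) : set M := [set x | tderiv f x \notin unitmx].

(* dim ker(Df^n_x), where f^n is the n-th iterate *)
Definition dim_ker (f : M -> M) (n : nat) (x : M) : nat :=
  \rank (kermx (tderiv (iter n f) x)).

(* |ker(Df^n)|, the largest value of [dim_ker f n]; all the values are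
   smaller than 3. *)
Definition max_dim_ker (f : M -> M) (n : nat) : nat :=
  \max_(d < 3 | `[< exists x : M, dim_ker f n x = d >]) d.

Definition full_dim_kernel (f : M -> M) : Prop :=
  exists n : nat, (1 <= n)%N /\ exists x : M, Cr f x /\ dim_ker f n x = 2%N.

(* A line field is continuous if it is locally spanned by continuous vector
   fields, i.e. vector fields with continuous components in a chart. *)
Definition continuous_line_field (L : forall x : M, {vspace 'rV[R]_2}) :=
  forall x : M, exists (a : chart R M) (u : M -> 'rV[R]_2),
    atlas a /\ \forall y \near x,
      [/\ chart_dom a y, {for y, continuous u} &
          L y = <[u y *m chart_frame a y]>%VS].

(* The axis and the aperture of a cone are determined by the cone, and the
   continuity of a family of cones is that of its axes and apertures. *)
Record cone_field := ConeField {
  cone_axis : forall x : M, {vspace 'rV[R]_2};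
  cone_aperture : M -> R;
  cone_axis_dim : forall x, \dim (cone_axis x) = 1%N;
  cone_aperture_pos : forall x, 0 < cone_aperture x;
  cone_axis_continuous : continuous_line_field cone_axis;
  cone_aperture_continuous : continuous cone_aperture }.

Definition orthogonal_to (g : riemannian_metric M) (x : M)
    (L : {vspace 'rV[R]_2}) (w : tangent x) : Prop :=
  forall u : tangent x, u \in L -> inner g u w = 0.

Definition cone (g : riemannian_metric M) (C : cone_field) (x : M) :
    set (tangent x) :=
  [set v | exists u w : tangent x,
    [/\ v = u + w, u \in cone_axis C x, orthogonal_to g (cone_axis C x) w &
        tnorm g w <= cone_aperture C x * tnorm g u]].

Definition cone_int (g : riemannian_metric M) (C : cone_field) (x : M) :
    set (tangent x) :=
  [set v | exists u w : tangent x,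
    [/\ v = u + w, u \in cone_axis C x, orthogonal_to g (cone_axis C x) w &
        tnorm g w < cone_aperture C x * tnorm g u]] `|` [set 0].

Arguments cone g C x _ : clear implicits.
Arguments cone_int g C x _ : clear implicits.

Definition invariant_cone_field (g : riemannian_metric M) (f : M -> M)
    (C : cone_field) : Prop :=
  exists k : nat, (1 <= k)%N /\
    forall x : M, [set v *m tderiv (iter k f) x | v in cone g C x]
      `<=` cone_int g C (iter k f x).

Definition dominated_splitting (g : riemannian_metric M) (f : M -> M) : Prop :=
  exists C : cone_field, invariant_cone_field g f C /\
    forall (x : M) (n : nat), (1 <= n)%N ->
      [set v : tangent x | v *m tderiv (iter n f) x = 0] `&` cone g C x
      = [set 0].

End Geometry.

(* Main.v *)
Require Import Defs.
From HB Require Import structures.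
From mathcomp Require Import all_boot all_order all_algebra.
From mathcomp Require Import all_classical all_reals all_analysis.
From mathcomp Require Import ring lra.
Set Implicit Arguments.
Unset Strict Implicit.
Unset Printing Implicit Defensive.
Import Order.TTheory GRing.Theory Num.Theory.
Import numFieldNormedType.Exports.
Local Open Scope classical_set_scope.
Local Open Scope ring_scope.

(** Suppose that no endomorphism near [f] has full-dimensional kernel. Since
    a surface has no isolated points, the tail of a dense orbit is dense and
    meets the interior of the critical set infinitely often
    ([transitive_orbit]). Start the orbit at a critical point [x_0] and let
    [A_j] be the derivative at [x_j] in orthonormal frames. The derivatives of
    the iterates never vanish, so that every product of the [A_j] with a
    singular factor has rank one: the image of [A_0] is a line, spanned by
    [w_0], and at every later point there is exactly one line [E_j] of vectors
    that the dynamics eventually kills.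

    By Franks' lemma ([franks]) there is a size [e] such that, on orbit segments
    of any length, every perturbation of the [A_j] of size [e] is the derivative
    of a map near [f] with the same orbit segment. If [w_0] could be sent into
    some [E_j] by such a perturbation, the perturbed map would have an iterate
    with vanishing derivative at [x_0]. So no perturbation of size [e] moves the
    forward images of [w_0] onto the killed lines, and this alone forces
    domination ([scalar_domination]). Indeed, measure directions by their
    slope, the component along [E_j] divided by the component across it. A
    shear moves the slope by a definite amount at each step, always in the
    direction that increases the total displacement; the displacement [u]
    satisfies [|u'| = |a/d| |u| + e/|d|], where [a] and [d] are the factors
    along and across [E_j], and it cannot exceed a bound depending on [e] and on
    the norms of the [A_j], since beyond it one more perturbation of size [e]
    would reach [E_j]. A quantity bounded above and below with this growth law
    makes the products of the [|a/d|] decay exponentially.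

    To pass from the orbit to [M], domination is restated without the lines
    [E_j], as closed conditions on [D f^N]: its two singular values are very
    different, and the vectors [v] for which [|D f^N v|^2] is at least [th]
    times [|v|^2] and the squared Hilbert-Schmidt norm of [D f^N] are mapped by
    [D f^k] to vectors with the same property for a larger [th], without
    getting much shorter ([dominated_sequence], [area_limit], [cone_limit]).
    These vectors form a cone around the most expanded direction of [D f^N],
    a simple eigenline of a continuous family of symmetric operators, so that
    this family of cones is a cone field as required
    ([dominated_splitting_from_cones]). *)

(** * Domination of triangular cocycles *)

Section ScalarCocycle.
Context {R : realType}.

(** The cocycle acts by [(y, z) |-> (d y, a z + b y)], the second axis being the
    killed line. The hypothesis says that after perturbations [beta] of [b] one
    more perturbation cannot annihilate [y]. Then [d] is bounded below, the
    slope [tau] of the unperturbed orbit and all the perturbed slopes are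
    bounded by [K = L / eps], and the difference [u] of two such slopes, made as
    large as possible by the choice of signs [bet], grows by [|a/d|] and an
    additive constant at each step; being bounded, it forces [|a/d|] to be at
    most [lam |u_{j+1}| / |u_j|], with [lam < 1]. *)
Lemma scalar_domination (a b d : nat -> R) (eps L y0 z0 : R) :
  0 < eps -> (forall j, `|d j| <= L) -> y0 != 0 ->
  (forall beta y z : nat -> R, (forall j, `|beta j| <= eps) ->
     y 0%N = y0 -> z 0%N = z0 -> (forall j, y j.+1 = d j * y j) ->
     (forall j, z j.+1 = a j * z j + (b j + beta j) * y j) ->
     forall m gamma delta, `|gamma| <= eps -> `|delta| <= eps ->
       (d m + delta) * y m + gamma * z m != 0) ->
  exists (tau : nat -> R) (K C lam : R),
    [/\ forall j, eps <= `|d j|,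
        forall j, d j * tau j.+1 = a j * tau j + b j,
        forall j, `|tau j| <= K,
        [/\ 0 <= K, 0 <= C, 0 < lam & lam < 1] &
        forall i n, (1 <= i)%N -> \prod_(i <= l < i + n) `|a l| <=
           C * lam ^+ n * \prod_(i <= l < i + n) `|d l|].
Proof.
move=> eps0 dL y00 H.
pose y := fix y n := if n is m.+1 then d m * y m else y0.
have yE j : y j.+1 = d j * y j by [].
pose zb (beta : nat -> R) := fix z n :=
  if n is m.+1 then a m * z m + (b m + beta m) * y m else z0.
have zE beta j : zb beta j.+1 = a j * zb beta j + (b j + beta j) * y j by [].
have H' beta : (forall j, `|beta j| <= eps) -> forall m gamma delta,
    `|gamma| <= eps -> `|delta| <= eps ->
    (d m + delta) * y m + gamma * zb beta m != 0.
  by move=> hb; exact: (H beta y (zb beta)).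
have e00 : `|(0:R)| <= eps by rewrite normr0 ltW.
have H0 := H' (fun=> 0) (fun=> e00).
have dge j : eps <= `|d j|.
  rewrite leNgt; apply/negP => dj.
  have := H0 j 0 (- d j) e00; rewrite normrN => /(_ (ltW dj)).
  by rewrite subrr !mul0r addr0 eqxx.
have d0 j : d j != 0 by rewrite -normr_gt0 (lt_le_trans eps0).
have yn0 j : y j != 0.
  by elim: j => //= j IH; rewrite mulf_neq0.
pose K := L / eps.
have L0 : 0 <= L by apply: le_trans (dL 0%N); rewrite normr_ge0.
have K0 : 0 <= K by rewrite divr_ge0 // ltW.
pose t beta j := zb beta j / y j.
have tE beta j : d j * t beta j.+1 = a j * t beta j + (b j + beta j).
  rewrite /t zE yE; field.
  by rewrite d0 yn0.
have tK beta : (forall j, `|beta j| <= eps) -> forall j, `|t beta j| <= K.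
  move=> hb m; rewrite leNgt; apply/negP => Kt.
  have t0 : 0 < `|t beta m| by apply: le_lt_trans Kt.
  have tn0 : t beta m != 0 by rewrite -normr_gt0.
  (* this perturbation would bring the vector onto the killed line *)
  have := H' beta hb m (- (d m / t beta m)) 0 _ e00.
  have -> : `|- (d m / t beta m)| <= eps.
    rewrite normrN normrM normfV ler_pdivrMr //.
    apply: le_trans (dL m) _; rewrite -ler_pdivrMl // mulrC.
    exact: ltW.
  have zt : zb beta m = t beta m * y m by rewrite /t divfK.
  rewrite addr0 zt mulNr mulrA divfK // subrr eqxx.
  by move=> /(_ isT).
pose u := fix u n := if n is m.+1 then
   (a m * u m + (if 0 <= a m * u m then eps else - eps)) / d m else 0.
pose bet j := if 0 <= a j * u j then eps else - eps.
(* the sign of [bet] makes the two terms of [u] add up in absolute value *)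
have hbet j : `|bet j| <= eps.
  by rewrite /bet; case: ifP; rewrite ?normrN gtr0_norm.
pose tau := t (fun=> 0).
have tauE j : d j * tau j.+1 = a j * tau j + b j by rewrite /tau tE addr0.
have tauK j : `|tau j| <= K by exact: (tK (fun=> 0) (fun=> e00)).
have uE j : t bet j = tau j + u j.
  elim: j => [|j IH]; first by rewrite /t /tau /= addr0.
  have hu : d j * u j.+1 = a j * u j + bet j by rewrite /= mulrC divfK.
  apply: (mulfI (d0 j)); rewrite [RHS]mulrDr tauE hu tE IH.
  ring.
have uK j : `|u j| <= 2 * K.
  have -> : u j = t bet j - tau j by rewrite uE; ring.
  apply: le_trans (ler_normB _ _) _.
  by have := tK _ hbet j; have := tauK j; lra.
have uS j : `|d j| * `|u j.+1| = `|a j| * `|u j| + eps.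
  rewrite -normrM /= -/(bet j) mulrC divfK // -normrM /bet.
  by case: (leP 0 (a j * u j)) => h; [rewrite !ger0_norm //; lra|rewrite !ltr0_norm //; lra].
have Lp : 0 < L by apply: lt_le_trans eps0 (le_trans (dge 0%N) (dL 0%N)).
have u1 j : (1 <= j)%N -> eps / L <= `|u j|.
  case: j => // j _; rewrite ler_pdivrMr // mulrC.
  apply: (@le_trans _ _ (`|d j| * `|u j.+1|)).
    by rewrite uS lerDr mulr_ge0.
  by rewrite ler_wpM2r.
have Kp : 0 < K by rewrite divr_gt0.
have del0 : 0 < eps / L by rewrite divr_gt0.
(* from index 1 on, [|u|] lies between [eps / L] and [2 K]; the additive term of its recurrence
   is therefore at least the fraction [q] of it *)
pose q := (eps / L) / (2 * K).
have q0 : 0 < q by rewrite divr_gt0 // mulr_gt0.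
have q1 : q <= 1.
  rewrite /q ler_pdivrMr; last by rewrite mulr_gt0.
  rewrite mul1r; exact: le_trans (u1 1%N isT) (uK 1%N).
pose lam := Num.max (1 - q) (1/2).
have lam0 : 0 < lam by rewrite lt_max; apply/orP; right; lra.
have lam1 : lam < 1 by rewrite gt_max; apply/andP; split; lra.
have lamq : 1 - q <= lam by rewrite le_max lexx.
have step j : `|a j| * `|u j| <= lam * (`|d j| * `|u j.+1|).
  apply: (@le_trans _ _ ((1 - q) * (`|d j| * `|u j.+1|))); last first.
    by rewrite ler_wpM2r // mulr_ge0.
  rewrite mulrBl mul1r {1}uS.
  have : q * (`|d j| * `|u j.+1|) <= eps.
    apply: (@le_trans _ _ (q * (L * (2 * K)))).
      by rewrite ler_wpM2l ?(ltW q0) // ler_pM.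
    have Kn0 : K != 0 by rewrite gt_eqF.
    have Ln0 : L != 0 by rewrite gt_eqF.
    have -> : q * (L * (2 * K)) = eps by rewrite /q; field; rewrite Kn0 Ln0.
    exact: lexx.
  lra.
pose C := 2 * K / (eps / L).
have produ i n : \prod_(i <= l < i + n) `|a l| * `|u i| <=
    lam ^+ n * \prod_(i <= l < i + n) `|d l| * `|u (i + n)%N|.
  elim: n => [|n IH]; first by rewrite addn0 !big_geq // expr0 !mul1r.
  rewrite addnS !big_nat_recr ?leq_addr //= exprS.
  set PA := \prod_(_ <= _ < _) _ in IH *.
  set PD := \prod_(_ <= _ < _) `|d _| in IH *.
  have PD0 : 0 <= PD by apply: prodr_ge0.
  have ln0 : 0 <= lam ^+ n by rewrite exprn_ge0 // ltW.
  have := ler_wpM2r (normr_ge0 (a (i + n)%N)) IH.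
  have := ler_wpM2l (mulr_ge0 ln0 PD0) (step (i + n)%N).
  lra.
exists tau, K, C, lam; split => //.
  by split => //; rewrite /C divr_ge0 ?ltW // mulr_gt0.
move=> i n i1.
have ui := u1 _ i1.
have ui0 : 0 < `|u i| by apply: lt_le_trans ui.
rewrite -(ler_pM2r ui0).
apply: le_trans (produ i n) _.
set PD := \prod_(_ <= _ < _) `|d _|.
have PD0 : 0 <= PD by apply: prodr_ge0.
have ln0 : 0 <= lam ^+ n by rewrite exprn_ge0 // ltW.
apply: (@le_trans _ _ (lam ^+ n * PD * (2 * K))).
  by rewrite ler_wpM2l // mulr_ge0.
have hC : 2 * K <= C * `|u i|.
  have -> : 2 * K = C * (eps / L) by rewrite /C divfK ?gt_eqF.
  by rewrite ler_wpM2l // /C divr_ge0 ?ltW // mulr_gt0.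
have := ler_wpM2l (mulr_ge0 ln0 PD0) hC; lra.
Qed.

End ScalarCocycle.

(** * Linear algebra of the plane *)

Section Plane.
Context {R : realType}.
Implicit Types (u v w e : 'rV[R]_2) (A B P : 'M[R]_2).

Lemma sum2 (F : 'I_2 -> R) : \sum_(i < 2) F i = F 0 + F 1.
Proof. by rewrite !big_ord_recl big_ord0 addr0; congr (_ + F _); apply/val_inj. Qed.

Lemma mulmx2E m n (A : 'M[R]_(m, 2)) (B : 'M[R]_(2, n)) i j :
  (A *m B) i j = A i 0 * B 0 j + A i 1 * B 1 j.
Proof. by rewrite mxE sum2. Qed.

Lemma ord2P (i : 'I_2) : i = 0 \/ i = 1.
Proof. by case: i => -[|[|//]] h; [left|right]; apply/val_inj. Qed.

Lemma rv2P u v : u 0 0 = v 0 0 -> u 0 1 = v 0 1 -> u = v.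
Proof. by move=> h0 h1; apply/rowP => i; case: (ord2P i) => ->. Qed.

Lemma mx2P A B : (forall i, A i 0 = B i 0) -> (forall i, A i 1 = B i 1) -> A = B.
Proof. by move=> h0 h1; apply/matrixP => i j; case: (ord2P j) => ->. Qed.

Lemma det2 A : \det A = A 0 0 * A 1 1 - A 0 1 * A 1 0.
Proof.
rewrite (expand_det_row _ 0) sum2 /cofactor !det_mx11 !mxE /= expr0 expr1 mul1r.
have -> : lift 0 0 = 1 :> 'I_2 by apply/val_inj.
have -> : lift 1 0 = 0 :> 'I_2 by apply/val_inj.
ring.
Qed.

Lemma trace2 A : \tr A = A 0 0 + A 1 1.
Proof. by rewrite /mxtrace sum2. Qed.

Definition dot u v : R := (u *m v^T) 0 0.

Lemma dotE u v : dot u v = u 0 0 * v 0 0 + u 0 1 * v 0 1.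
Proof. by rewrite /dot mulmx2E !mxE. Qed.

Definition rot v : 'rV[R]_2 := \row_j (if j == 0 then - v 0 1 else v 0 0).

Lemma rot0 v : rot v 0 0 = - v 0 1. Proof. by rewrite mxE. Qed.
Lemma rot1 v : rot v 0 1 = v 0 0. Proof. by rewrite mxE. Qed.

Definition frob P : R := \tr (P *m P^T).

Lemma frobE P : frob P = P 0 0 ^+ 2 + P 0 1 ^+ 2 + P 1 0 ^+ 2 + P 1 1 ^+ 2.
Proof. rewrite /frob trace2 !mulmx2E !mxE; ring. Qed.

Lemma dot_ge0 v : 0 <= dot v v.
Proof. by rewrite dotE -!expr2 addr_ge0 // sqr_ge0. Qed.

Lemma dot_gt0 v : v != 0 -> 0 < dot v v.
Proof.
move=> v0; rewrite lt_neqAle dot_ge0 andbT eq_sym; apply: contra v0.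
rewrite dotE -!expr2 paddr_eq0 ?sqr_ge0 // !sqrf_eq0 => /andP[/eqP h0 /eqP h1].
by apply/eqP/rv2P; rewrite ?h0 ?h1 mxE.
Qed.

Lemma orth_decomp e v : dot e e = 1 -> v = dot v (rot e) *: rot e + dot v e *: e.
Proof.
rewrite !dotE !rot0 !rot1 => h.
by apply/rv2P; rewrite !mxE /= -[LHS]mulr1 -h; ring.
Qed.

Lemma mx_entry_le m n (A : 'M[R]_(m, n)) i j : `|A i j| <= `|A|.
Proof.
rewrite {2}/Num.Def.normr/= mx_normrE.
exact: (le_bigmax _ (fun ij : 'I_m * 'I_n => `|A ij.1 ij.2|) (i, j)).
Qed.

Lemma mx_norm_le m n (A : 'M[R]_(m, n)) c : 0 <= c ->
  (forall i j, `|A i j| <= c) -> `|A| <= c.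
Proof.
move=> c0 h; rewrite /Num.Def.normr/= mx_normrE.
by apply/bigmax_leP; split => // ij _; exact: h.
Qed.

Fixpoint mprod (A : nat -> 'M[R]_2) (n l : nat) : 'M[R]_2 :=
  if l is l'.+1 then mprod A n l' *m A (n + l')%N else 1%:M.

Lemma mprodD (A : nat -> 'M[R]_2) n l m : mprod A n (l + m) = mprod A n l *m mprod A (n + l) m.
Proof.
elim: m => [|m IH]; first by rewrite addn0 /= mulmx1.
by rewrite addnS /= IH mulmxA addnA.
Qed.

Lemma mprodS (A : nat -> 'M[R]_2) n l : mprod A n l.+1 = A n *m mprod A n.+1 l.
Proof. by have := mprodD A n 1 l; rewrite add1n /= mul1mx addn0 addn1. Qed.

Lemma mprod_shift (A : nat -> 'M[R]_2) n l :
  mprod (fun j => A j.+1) n l = mprod A n.+1 l.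
Proof. by elim: l => //= l ->; rewrite addSn. Qed.

Lemma eq_mprod (A B : nat -> 'M[R]_2) n l : (forall j, (n <= j < n + l)%N -> A j = B j) ->
  mprod A n l = mprod B n l.
Proof.
elim: l => //= l IH h; rewrite IH ?h //; first by rewrite leq_addr addnS ltnS leqnn.
by move=> j /andP[h1 h2]; apply: h; rewrite h1 addnS ltnS ltnW.
Qed.

Lemma dotDl u v w : dot (u + v) w = dot u w + dot v w.
Proof. by rewrite !dotE !mxE; ring. Qed.

Lemma dotZl c u w : dot (c *: u) w = c * dot u w.
Proof. by rewrite !dotE !mxE; ring. Qed.

Lemma dotC u v : dot u v = dot v u.
Proof. by rewrite !dotE; ring. Qed.

Lemma dot_rotK u : dot u (rot u) = 0.
Proof. by rewrite !dotE rot0 rot1; ring. Qed.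

Lemma dot_rot u v : dot (rot u) (rot v) = dot u v.
Proof. by rewrite !dotE !rot0 !rot1; ring. Qed.

Lemma dot_orth e v : dot e e = 1 -> dot v v = dot v (rot e) ^+ 2 + dot v e ^+ 2.
Proof.
rewrite !dotE rot0 rot1 => h; rewrite -[LHS]mulr1 -h; ring.
Qed.

(** A block of the cocycle between two orthonormal frames [(rot e, e)] and
    [(rot e', e')]: [e] is sent to a multiple of [e'], and the vector of slope
    [ta] to a multiple of the vector of slope [ta']. *)
Section Block.
Variables (e e' : 'rV[R]_2) (P : 'M[R]_2) (al de ta ta' : R).
Hypotheses (e1 : dot e e = 1) (e1' : dot e' e' = 1).
Hypotheses (eP : e *m P = al *: e')
  (fP : (rot e + ta *: e) *m P = de *: (rot e' + ta' *: e')).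

Let rotP : rot e *m P = de *: rot e' + (de * ta' - al * ta) *: e'.
Proof.
move: fP; rewrite mulmxDl -scalemxAl eP => h.
have -> : rot e *m P = de *: (rot e' + ta' *: e') - ta *: (al *: e').
  by rewrite -h addrK.
by rewrite scalerDr !scalerA -addrA -scalerBl [ta * al]mulrC.
Qed.

Lemma block_vec v : v *m P = (de * dot v (rot e)) *: rot e' +
  (de * ta' * dot v (rot e) + al * (dot v e - ta * dot v (rot e))) *: e'.
Proof.
rewrite {1}(orth_decomp v e1) mulmxDl -!scalemxAl eP rotP.
by apply/rv2P; rewrite !mxE; ring.
Qed.

Lemma block_rot v : dot (v *m P) (rot e') = de * dot v (rot e).
Proof.
by rewrite block_vec dotDl !dotZl dot_rot e1' dot_rotK; ring.
Qed.

Lemma block_e v : dot (v *m P) e' =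
  de * ta' * dot v (rot e) + al * (dot v e - ta * dot v (rot e)).
Proof.
by rewrite block_vec dotDl !dotZl e1' [dot (rot _) _]dotC dot_rotK; ring.
Qed.

Let PE i j : P i j = e 0 i * (al * e' 0 j) +
  rot e 0 i * (de * rot e' 0 j + (de * ta' - al * ta) * e' 0 j).
Proof.
have := congr1 (fun w : 'rV_2 => w 0 j) eP; rewrite mulmx2E mxE => <-.
have := congr1 (fun w : 'rV_2 => w 0 j) rotP; rewrite mulmx2E !mxE => <-.
move: e1; rewrite dotE => h.
by case: (ord2P i) => -> /=; rewrite ?rot0 ?rot1 -[LHS]mul1r -h; ring.
Qed.

Lemma block_frob : frob P = al ^+ 2 + de ^+ 2 + (de * ta' - al * ta) ^+ 2.
Proof.
have -> : frob P = dot e e * dot e' e' *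
   (al ^+ 2 + de ^+ 2 + (de * ta' - al * ta) ^+ 2).
  by rewrite frobE !PE !dotE !rot0 !rot1; ring.
by rewrite e1 e1' !mul1r.
Qed.

Lemma block_det : \det P ^+ 2 = (al * de) ^+ 2.
Proof.
have -> : \det P = dot e e * dot e' e' * (al * de).
  by rewrite det2 !PE !dotE !rot0 !rot1; ring.
by rewrite e1 e1' !mul1r.
Qed.

(** A vector not too close to [e] is stretched in proportion to the norm of the
    block. Here [th] is exactly the constant lost in the comparison. *)
Lemma block_cone_in K th v : 0 <= K -> 2 * th * (2 + 4 * K ^+ 2) * (1 + (K + 1) ^+ 2) = 1 ->
  0 < th -> ta ^+ 2 <= K ^+ 2 -> ta' ^+ 2 <= K ^+ 2 -> al ^+ 2 <= de ^+ 2 ->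
  dot v e ^+ 2 <= (K + 1) ^+ 2 * dot v (rot e) ^+ 2 ->
  2 * th * frob P * dot v v <= dot (v *m P) (v *m P).
Proof.
move=> K0 hth th0 hta hta' had hv.
rewrite (dot_orth (v *m P) e1') block_rot block_frob (dot_orth v e1).
set y := dot v (rot e) in hv *; set z := dot v e in hv *.
apply: (@le_trans _ _ ((de * y) ^+ 2)); last by rewrite lerDl sqr_ge0.
have F1 : al ^+ 2 + de ^+ 2 + (de * ta' - al * ta) ^+ 2 <= de ^+ 2 * (2 + 4 * K ^+ 2).
  have h1 : (de * ta' - al * ta) ^+ 2 <= 2 * (de ^+ 2 * ta' ^+ 2) + 2 * (al ^+ 2 * ta ^+ 2).
    by have := sqr_ge0 (de * ta' + al * ta); rewrite !expr2; lra.
  have h2 : de ^+ 2 * ta' ^+ 2 <= de ^+ 2 * K ^+ 2 by rewrite ler_wpM2l ?sqr_ge0.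
  have h3 : al ^+ 2 * ta ^+ 2 <= de ^+ 2 * K ^+ 2 by rewrite ler_pM ?sqr_ge0.
  lra.
have V1 : y ^+ 2 + z ^+ 2 <= (1 + (K + 1) ^+ 2) * y ^+ 2 by lra.
have -> : (de * y) ^+ 2 = 2 * th * (de ^+ 2 * (2 + 4 * K ^+ 2)) * ((1 + (K + 1) ^+ 2) * y ^+ 2).
  by rewrite -[LHS]mul1r -{1}hth; ring.
have t0 : 0 <= 2 * th by lra.
have F0 : 0 <= al ^+ 2 + de ^+ 2 + (de * ta' - al * ta) ^+ 2.
  by rewrite !addr_ge0 ?sqr_ge0.
apply: ler_pM => //; [exact: mulr_ge0|by rewrite addr_ge0 ?sqr_ge0|].
by rewrite ler_wpM2l.
Qed.

(** Conversely, when [e] is contracted much more than the norm of the block, a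
    vector stretched in proportion to this norm cannot be close to [e]. *)
Lemma block_cone_out K th rho v : 0 < th -> de != 0 ->
  ta ^+ 2 <= K ^+ 2 -> ta' ^+ 2 <= K ^+ 2 -> al ^+ 2 <= rho * de ^+ 2 ->
  0 <= rho -> rho <= 1 -> 8 * rho <= th ->
  th / 2 * frob P * dot v v <= dot (v *m P) (v *m P) ->
  dot v e ^+ 2 <= 4 * (1 + 8 * K ^+ 2) / th * dot v (rot e) ^+ 2.
Proof.
move=> th0 de0 hta hta' had r0 r1 rth.
rewrite (dot_orth (v *m P) e1') block_rot block_e block_frob (dot_orth v e1).
set y := dot v (rot e); set z := dot v e => hv.
have d2 : 0 < de ^+ 2 by rewrite exprn_even_gt0.
have y2 := sqr_ge0 y; have z2 := sqr_ge0 z.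
have h1 : de ^+ 2 * (th / 2 * (y ^+ 2 + z ^+ 2)) <=
    (de * y) ^+ 2 + (de * ta' * y + al * (z - ta * y)) ^+ 2.
  apply: le_trans hv.
  rewrite [leLHS]mulrCA [leLHS]mulrA ler_wpM2r ?addr_ge0 //.
  apply: ler_wpM2l; first by lra.
  by have := sqr_ge0 al; have := sqr_ge0 (de * ta' - al * ta); lra.
have ha : al ^+ 2 <= de ^+ 2.
  by apply: le_trans had _; rewrite ler_piMl // ltW.
have K2 := sqr_ge0 K.
have h2 : (de * ta' * y + al * (z - ta * y)) ^+ 2 <=
    de ^+ 2 * (8 * K ^+ 2 * y ^+ 2 + 2 * rho * z ^+ 2).
  have q1 : de ^+ 2 * ta' ^+ 2 * y ^+ 2 <= de ^+ 2 * K ^+ 2 * y ^+ 2.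
    by rewrite ler_wpM2r // ler_wpM2l // ltW.
  have q2 : al ^+ 2 * ta ^+ 2 * y ^+ 2 <= de ^+ 2 * K ^+ 2 * y ^+ 2.
    by rewrite ler_wpM2r // ler_pM ?sqr_ge0.
  have q3 : al ^+ 2 * z ^+ 2 <= rho * de ^+ 2 * z ^+ 2 by rewrite ler_wpM2r.
  have := sqr_ge0 (de * ta' * y - al * ta * y - al * z).
  have := sqr_ge0 (de * ta' * y + al * ta * y).
  rewrite !expr2 in q1 q2 q3 *; lra.
have h3 : th / 2 * (y ^+ 2 + z ^+ 2) <= y ^+ 2 + 8 * K ^+ 2 * y ^+ 2 + 2 * rho * z ^+ 2.
  rewrite -(ler_pM2l d2); apply: le_trans h1 _.
  rewrite exprMn; lra.
have h4 : rho * z ^+ 2 <= th / 8 * z ^+ 2 by rewrite ler_wpM2r //; lra.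
rewrite mulrAC ler_pdivlMr //.
have := mulr_ge0 (ltW th0) y2.
lra.
Qed.

End Block.

End Plane.

(** * Sequences of matrices without vanishing perturbed products *)

Section Sequence.
Context {R : realType}.
Implicit Types (u v w : 'rV[R]_2).

Lemma mul_outer v u w : v *m (u^T *m w) = dot v u *: w.
Proof. by apply/rv2P; rewrite mulmxA [LHS]mxE big_ord1 [RHS]mxE. Qed.

Lemma unit_entry u i : dot u u = 1 -> `|u 0 i| <= 1.
Proof.
rewrite dotE => h; rewrite -(@ler_pXn2r _ 2%N) ?nnegrE // expr1n real_normK ?num_real //.
have := sqr_ge0 (u 0 0); have := sqr_ge0 (u 0 1).
by case: (ord2P i) => ->; rewrite !expr2; lra.
Qed.

Lemma outer_entry u w i j : dot u u = 1 -> dot w w = 1 ->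
  `|(u^T *m w) i j| <= 1.
Proof.
move=> hu hw; rewrite mxE big_ord1 mxE normrM.
by rewrite -[leRHS]mulr1 ler_pM ?normr_ge0 ?unit_entry.
Qed.

Lemma dot_mul_le u w (A : 'M[R]_2) : dot u u = 1 -> dot w w = 1 ->
  `|dot (u *m A) w| <= 4 * `|A|.
Proof.
move=> hu hw.
have h i j : `|u 0 i * A i j * w 0 j| <= `|A|.
  rewrite !normrM -[leRHS]mul1r -[leRHS]mulr1.
  by rewrite !ler_pM ?mulr_ge0 ?normr_ge0 ?unit_entry // mx_entry_le.
rewrite dotE !mulmx2E !mulrDl.
apply: le_trans (ler_normD _ _) _.
have := ler_normD (u 0 0 * A 0 0 * w 0 0) (u 0 1 * A 1 0 * w 0 0).
have := ler_normD (u 0 0 * A 0 1 * w 0 1) (u 0 1 * A 1 1 * w 0 1).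
have := h 0 0; have := h 0 1; have := h 1 0; have := h 1 1; lra.
Qed.

Lemma singular_kernel (A : 'M[R]_2) : A \notin unitmx ->
  exists2 e : 'rV[R]_2, dot e e = 1 & e *m A = 0.
Proof.
rewrite unitmxE unitfE negbK => /det0P[v v0 vA].
have vv := dot_gt0 v0.
exists ((Num.sqrt (dot v v))^-1 *: v); last by rewrite -scalemxAl vA scaler0.
rewrite dotZl dotC dotZl mulrA -expr2 exprVn sqr_sqrtr ?ltW //.
by rewrite mulVf // gt_eqF.
Qed.

Section Frames.
Variables (A : nat -> 'M[R]_2) (w0 : 'rV[R]_2) (eps L : R).
Hypotheses (eps0 : 0 < eps) (AL : forall j, `|A j| <= L).
Hypothesis Asing : forall n, exists j, (n <= j)%N /\ A j \notin unitmx.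
Hypothesis robust : forall B : nat -> 'M[R]_2, (forall j, `|B j - A j| <= eps) ->
  forall m, w0 *m mprod B 0 m != 0.

(** A product that contains a singular matrix has a kernel. *)
Lemma killed_directions : exists e : nat -> 'rV[R]_2,
  forall n, dot (e n) (e n) = 1 /\ exists l, e n *m mprod A n l = 0.
Proof.
suff /choice[e he] : forall n, exists e : 'rV[R]_2,
    dot e e = 1 /\ exists l, e *m mprod A n l = 0 by exists e.
move=> n; have [j [nj Aj]] := Asing n.
have hP : mprod A n (j - n).+1 \notin unitmx.
  apply: contra Aj => /=; rewrite subnKC // unitmx_mul; by case/andP.
have [e e1 eP] := singular_kernel hP.
by exists e; split => //; exists (j - n).+1.
Qed.

Lemma kill_mono (B : nat -> 'M[R]_2) v n l m : v *m mprod B n l = 0 ->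
  (l <= m)%N -> v *m mprod B n m = 0.
Proof. by move=> h lm; rewrite -(subnKC lm) mprodD mulmxA h mul0mx. Qed.

Lemma scale_kill (B : nat -> 'M[R]_2) c v n l : v *m mprod B n l = 0 ->
  c *: v *m mprod B n l = 0.
Proof. by move=> h; rewrite -scalemxAl h scaler0. Qed.

Lemma robust0 m : w0 *m mprod A 0 m != 0.
Proof.
by apply: robust => j; rewrite subrr normr0 ltW.
Qed.

Section WithE.
Variable e : nat -> 'rV[R]_2.
Hypothesis e1 : forall n, dot (e n) (e n) = 1.
Hypothesis ek : forall n, exists l, e n *m mprod A n l = 0.

(** Otherwise two independent vectors would be killed at time [n.+1], and the
    product of the matrices from [0] on would eventually send [w0] to [0]. *)
Lemma killed_invariant n : dot (e n *m A n) (rot (e n.+1)) = 0.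
Proof.
apply/eqP; apply: contraT => y0.
have [l1 h1] := ek n; have [l2 h2] := ek n.+1.
have h1' : (e n *m A n) *m mprod A n.+1 l1 = 0.
  have := kill_mono h1 (leqnSn l1).
  by rewrite mprodS mulmxA.
pose l := maxn l1 l2.
have k1 := kill_mono h1' (leq_maxl l1 l2).
have k2 := kill_mono h2 (leq_maxr l1 l2).
have k3 : rot (e n.+1) *m mprod A n.+1 l = 0.
  have := orth_decomp (e n *m A n) (e1 n.+1).
  set y := dot _ _ in y0 *; set z := dot _ (e n.+1) => h.
  have -> : rot (e n.+1) = y^-1 *: (e n *m A n - z *: e n.+1).
    by rewrite {1}h addrK scalerA mulVf // scale1r.
  by apply: scale_kill; rewrite mulmxBl k1 (scale_kill _ k2) subr0.
have /negP := robust0 (n.+1 + l); case.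
rewrite mprodD mulmxA add0n.
rewrite (orth_decomp (w0 *m mprod A 0 n.+1) (e1 n.+1)) mulmxDl.
by rewrite (scale_kill _ k2) (scale_kill _ k3) addr0.
Qed.

Let a n := dot (e n *m A n) (e n.+1).
Let b n := dot (rot (e n) *m A n) (e n.+1).
Let d n := dot (rot (e n) *m A n) (rot (e n.+1)).

Let eA n : e n *m A n = a n *: e n.+1.
Proof. by rewrite (orth_decomp (e n *m A n) (e1 n.+1)) killed_invariant scale0r add0r. Qed.

Let rA n : rot (e n) *m A n = d n *: rot (e n.+1) + b n *: e n.+1.
Proof. by rewrite (orth_decomp (rot (e n) *m A n) (e1 n.+1)). Qed.

Let r1 n : dot (rot (e n)) (rot (e n)) = 1. Proof. by rewrite dot_rot. Qed.

(** The perturbations used by [scalar_domination]: [be] shears towards [e],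
    [ga] and [de] change the component across [e]. *)
Let pert be ga de n : 'M[R]_2 := A n + be *: ((rot (e n))^T *m e n.+1) +
  ga *: ((e n)^T *m rot (e n.+1)) + de *: ((rot (e n))^T *m rot (e n.+1)).

Let pert_close be ga de n : `|be| <= eps / 3 -> `|ga| <= eps / 3 ->
  `|de| <= eps / 3 -> `|pert be ga de n - A n| <= eps.
Proof.
move=> hb hg hd; apply: mx_norm_le => [|i j]; first exact: ltW.
have -> : (pert be ga de n - A n) i j = be * ((rot (e n))^T *m e n.+1) i j +
  ga * ((e n)^T *m rot (e n.+1)) i j + de * ((rot (e n))^T *m rot (e n.+1)) i j.
  by rewrite [_ i j]mxE !mxE; ring.
have h c u w : `|c| <= eps / 3 -> dot u u = 1 -> dot w w = 1 ->
    `|c * (u^T *m w) i j| <= eps / 3.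
  move=> hc hu hw; rewrite normrM -[leRHS]mulr1.
  by rewrite ler_pM ?normr_ge0 // outer_entry.
have := h _ _ _ hb (r1 n) (e1 n.+1).
have := h _ _ _ hg (e1 n) (r1 n.+1).
have := h _ _ _ hd (r1 n) (r1 n.+1).
move=> q1 q2 q3.
apply: le_trans (ler_normD _ _) _.
have := ler_normD (be * ((rot (e n))^T *m e n.+1) i j) (ga * ((e n)^T *m rot (e n.+1)) i j).
lra.
Qed.

Let pertE be ga de n v : v *m pert be ga de n =
  ((d n + de) * dot v (rot (e n)) + ga * dot v (e n)) *: rot (e n.+1) +
  (a n * dot v (e n) + (b n + be) * dot v (rot (e n))) *: e n.+1.
Proof.
rewrite !mulmxDr -!scalemxAr !mul_outer {1}(orth_decomp v (e1 n)) mulmxDl -!scalemxAl.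
by rewrite eA rA; apply/rv2P; rewrite !mxE; ring.
Qed.

Let pert_y be ga de n v : dot (v *m pert be ga de n) (rot (e n.+1)) =
  (d n + de) * dot v (rot (e n)) + ga * dot v (e n).
Proof. by rewrite pertE dotDl !dotZl r1 dot_rotK; ring. Qed.

Let pert_z be ga de n v : dot (v *m pert be ga de n) (e n.+1) =
  a n * dot v (e n) + (b n + be) * dot v (rot (e n)).
Proof. by rewrite pertE dotDl !dotZl e1 [dot (rot _) _]dotC dot_rotK; ring. Qed.

(** If a perturbation annihilated the component of [w0] across the killed line,
    the unperturbed matrices that follow would kill the vector itself. *)
Lemma triangular_form : exists (al de' ta : nat -> R) (K C lam : R),
  [/\ forall n, e n *m A n = al n *: e n.+1,
      forall n, (rot (e n) + ta n *: e n) *m A n =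
        de' n *: (rot (e n.+1) + ta n.+1 *: e n.+1),
      (forall n, eps / 3 <= `|de' n|) /\ (forall n, `|ta n| <= K),
      [/\ 0 <= K, 0 <= C, 0 < lam & lam < 1] &
      forall i n, (1 <= i)%N -> \prod_(i <= l < i + n) `|al l| <=
           C * lam ^+ n * \prod_(i <= l < i + n) `|de' l| ].
Proof.
have eps3 : 0 < eps / 3 by rewrite divr_gt0.
have y0 : dot w0 (rot (e 0)) != 0.
  apply/negP => /eqP h; have [l hl] := ek 0%N.
  have /negP := robust0 l; case.
  by rewrite (orth_decomp w0 (e1 0%N)) h scale0r add0r (scale_kill _ hl).
have dL j : `|d j| <= 4 * L.
  by apply: le_trans (dot_mul_le _ (r1 j) (r1 j.+1)) _; rewrite ler_wpM2l.
have [|ta [K [C [lam [h1 h2 h3 h4 h5]]]]] := @scalar_domination _ a b d (eps / 3)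
   (4 * L) _ (dot w0 (e 0%N)) eps3 dL y0.
  move=> be y z hbe y00 z00 yS zS m ga de hga hde.
  pose B j := pert (if (j < m)%N then be j else 0) (if j == m then ga else 0)
    (if j == m then de else 0) j.
  have n0 : `|(0 : R)| <= eps / 3 by rewrite normr0 ltW.
  have HB := @robust B (fun j => _).
  have {}HB : forall l, w0 *m mprod B 0 l != 0.
    by apply: HB => j; apply: pert_close; case: ifP.
  have yz j : (j <= m)%N -> dot (w0 *m mprod B 0 j) (rot (e j)) = y j /\
      dot (w0 *m mprod B 0 j) (e j) = z j.
    elim: j => [|j IH] jm; first by rewrite mulmx1.
    have [IH1 IH2] := IH (ltnW jm).
    rewrite /= add0n mulmxA {1 3}/B pert_y pert_z IH1 IH2 jm ltn_eqF //.
    by rewrite yS zS mul0r !addr0.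
  have [ym zm] := yz m (leqnn m).
  apply/negP => /eqP h.
  have hm : w0 *m mprod B 0 m.+1 = dot (w0 *m mprod B 0 m.+1) (e m.+1) *: e m.+1.
    rewrite {1}(orth_decomp (w0 *m mprod B 0 m.+1) (e1 m.+1)).
    by rewrite /= add0n mulmxA {1}/B pert_y ym zm eqxx h scale0r add0r.
  have [l hl] := ek m.+1.
  have /negP := HB (m.+1 + l)%N; case.
  rewrite mprodD mulmxA hm add0n.
  have -> : mprod B m.+1 l = mprod A m.+1 l.
    apply: eq_mprod => j /andP[mj _]; rewrite /B /pert.
    by rewrite ltnNge (ltnW mj) /= gtn_eqF // !scale0r !addr0.
  by rewrite (scale_kill _ hl).
exists a, d, ta, K, C, lam; split => // n.
rewrite mulmxDl rA -scalemxAl eA scalerDr !scalerA h2 -addrA; congr (_ + _).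
by rewrite -scalerDl; congr (_ *: _); ring.
Qed.

End WithE.

(** Exponential domination, in a form that does not mention the killed lines:
    products of length [N] are nearly of rank one, and a vector stretched by
    such a product at least like [th / 2] is sent by [k] steps to a vector
    stretched at least like [2 * th]. The gap between the two constants leaves
    room for limits. [N] is chosen first, to make the stretched vectors avoid
    the killed line, and then [k], to bring them close to the image of [w0]. *)
Lemma dominated_sequence : exists (th c : R) (N k : nat),
  [/\ 0 < th <= 1/8, 0 < c, (1 <= k)%N, (1 <= N)%N & forall n, (1 <= n)%N ->
    \det (mprod A n N) ^+ 2 <= (th - th ^+ 2) / 2 * frob (mprod A n N) ^+ 2 /\
    forall v, th / 2 * frob (mprod A n N) * dot v v
        <= dot (v *m mprod A n N) (v *m mprod A n N) ->
      2 * th * frob (mprod A (n + k) N) * dot (v *m mprod A n k) (v *m mprod A n k)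
        <= dot (v *m mprod A n (k + N)) (v *m mprod A n (k + N)) /\
      c * dot v v <= dot (v *m mprod A n k) (v *m mprod A n k)].
Proof.
have [e he] := killed_directions.
have e1 n : dot (e n) (e n) = 1 by case: (he n).
have [al [de [ta [K [C [lam [h1 h2 [h3 h3'] [K0 C0 l0 l1] h5]]]]]]] :=
  triangular_form e1 (fun n => (he n).2).
have eps3 : 0 < eps / 3 by rewrite divr_gt0.
have blk i n : e i *m mprod A i n = (\prod_(i <= l < i + n) al l) *: e (i + n)%N /\
  (rot (e i) + ta i *: e i) *m mprod A i n =
   (\prod_(i <= l < i + n) de l) *: (rot (e (i + n)%N) + ta (i + n)%N *: e (i + n)%N).
  elim: n => [|n [IH1 IH2]]; first by rewrite !mulmx1 addn0 !big_geq // !scale1r.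
  rewrite addnS !big_nat_recr ?leq_addr //= !mulmxA IH1 IH2.
  by rewrite -!scalemxAl h1 h2 !scalerA.
have de_ge i n : (eps / 3) ^+ n <= `|\prod_(i <= l < i + n) de l|.
  elim: n => [|n IH]; first by rewrite addn0 big_geq // normr1.
  rewrite addnS big_nat_recr ?leq_addr //= normrM exprSr.
  by rewrite ler_pM // ?exprn_ge0 // ltW.
have al_le i n : (1 <= i)%N -> (\prod_(i <= l < i + n) al l) ^+ 2 <=
    (C * lam ^+ n) ^+ 2 * (\prod_(i <= l < i + n) de l) ^+ 2.
  move=> i1; have := h5 i n i1; rewrite -!normr_prod => h.
  rewrite -[leLHS]real_normK ?num_real // -[X in _ * X]real_normK ?num_real //.
  have ln0 : 0 <= lam ^+ n by rewrite exprn_ge0 // ltW.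
  by rewrite -exprMn ler_pXn2r ?nnegrE // !mulr_ge0.
have ta2 n : ta n ^+ 2 <= K ^+ 2.
  by rewrite -[leLHS]real_normK ?num_real // ler_pXn2r ?nnegrE.
have small (r : R) : 0 < r -> exists n, (1 <= n)%N /\ C * lam ^+ n <= r.
  move=> r0.
  have : (fun n => C * lam ^+ n) @ \oo --> (0 : R).
    rewrite -[X in _ --> X](mulr0 C); apply: cvgM; first exact: cvg_cst.
    by apply: cvg_expr; rewrite gtr0_norm.
  move=> /cvgr0Pnorm_lt /(_ r r0) [n _ /(_ n.+1 (leqnSn n)) h].
  by exists n.+1; split => //; apply: le_trans (ltW h); rewrite ler_norm.
pose D := (2 + 4 * K ^+ 2) * (1 + (K + 1) ^+ 2).
have K2 := sqr_ge0 K.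
have D4 : 4 <= D.
  have : 2 * 2 <= (2 + 4 * K ^+ 2) * (1 + (K + 1) ^+ 2).
    by apply: ler_pM => //; rewrite ?expr2; lra.
  by rewrite /D; lra.
have D0 : 0 < D by lra.
pose th := (2 * D)^-1.
have th0 : 0 < th by rewrite invr_gt0; lra.
have thD : 2 * th * (2 + 4 * K ^+ 2) * (1 + (K + 1) ^+ 2) = 1.
  have D0' : D != 0 by rewrite gt_eqF.
  rewrite -mulrA -/D /th; field; exact: D0'.
have th8 : th <= 1 / 8.
  by rewrite /th div1r lef_pV2 ?posrE; lra.
have [N [N1 hN]] := small (th / 8) ltac:(lra).
pose E := 4 * (1 + 8 * K ^+ 2) / th.
have E0 : 0 < E by rewrite divr_gt0 //; lra.
pose eta := 1 + E.
have [k [k1 hk]] := small ((eta + K)^-1) ltac:(rewrite invr_gt0 /eta; lra).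
pose c := (eps / 3) ^+ (2 * k) / (1 + E).
have c0 : 0 < c by rewrite divr_gt0 ?exprn_gt0 //; lra.
exists th, c, N, k; split => //; first by rewrite th0.
move=> n n1.
have CN0 : 0 <= C * lam ^+ N by rewrite mulr_ge0 // exprn_ge0 // ltW.
pose rho := (C * lam ^+ N) ^+ 2.
have rho_th : rho <= (th / 8) ^+ 2 by rewrite ler_pXn2r ?nnegrE //; lra.
have rho0 : 0 <= rho by rewrite sqr_ge0.
have rho1 : rho <= 1 by move: rho_th; rewrite expr2; nra.
have rho8 : 8 * rho <= th by move: rho_th; rewrite expr2; nra.
have neq0 i m : \prod_(i <= l < i + m) de l != 0.
  by rewrite -normr_gt0 (lt_le_trans _ (de_ge i m)) // exprn_gt0.
have [bN1 bN2] := blk n N.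
split.
  rewrite (block_det (e1 n) (e1 _) bN1 bN2) (block_frob (e1 n) (e1 _) bN1 bN2).
  set al' := \prod_(_ <= _ < _) al _; set de' := \prod_(_ <= _ < _) de _.
  set x := _ ^+ 2; set x3 := (_ - _) ^+ 2.
  have hal : al' ^+ 2 <= rho * de' ^+ 2 := al_le n N n1.
  have d2 := sqr_ge0 de'; have a2 := sqr_ge0 al'.
  have x30 : 0 <= x3 by rewrite sqr_ge0.
  apply: (@le_trans _ _ (rho * (de' ^+ 2) ^+ 2)).
    by rewrite /x exprMn [(_ ^+ 2) ^+ 2]expr2 mulrA ler_wpM2r.
  apply: ler_pM => //; first by rewrite sqr_ge0.
    by move: rho_th; rewrite !expr2; nra.
  by rewrite ler_pXn2r ?nnegrE ?addr_ge0 //; lra.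
move=> v hv.
set y := dot v (rot (e n)); set z := dot v (e n).
have hz : z ^+ 2 <= E * y ^+ 2.
  exact: (block_cone_out (e1 n) (e1 _) bN1 bN2 th0 (neq0 _ _) (ta2 _) (ta2 _)
    (al_le _ _ n1) rho0 rho1 rho8 hv).
have eta0 : 0 < eta by rewrite /eta; lra.
have hz' : `|z| <= eta * `|y|.
  rewrite -(@ler_pXn2r _ 2%N) ?nnegrE ?mulr_ge0 ?(ltW eta0) // exprMn !real_normK ?num_real //.
  apply: le_trans hz _; rewrite ler_wpM2r ?sqr_ge0 // /eta expr2; nra.
have [bk1 bk2] := blk n k.
have yk := block_rot (e1 n) (e1 _) bk1 bk2 v.
have zk := block_e (e1 n) (e1 _) bk1 bk2 v.
split; last first.
  rewrite (dot_orth (v *m mprod A n k) (e1 (n + k)%N)) yk -/y.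
  apply: (@le_trans _ _ ((\prod_(n <= l < n + k) de l * y) ^+ 2)); last first.
    by rewrite lerDl sqr_ge0.
  rewrite (dot_orth v (e1 n)) -/y -/z exprMn.
  apply: (@le_trans _ _ ((eps / 3) ^+ (2 * k) * y ^+ 2)).
    rewrite /c mulrAC ler_pdivrMr; last by lra.
    rewrite -mulrA ler_wpM2l ?exprn_ge0 ?(ltW eps3) //; lra.
  rewrite ler_wpM2r ?sqr_ge0 // mulnC exprM.
  by rewrite -[leRHS]real_normK ?num_real // ler_pXn2r ?nnegrE // exprn_ge0 // ltW.
rewrite mprodD mulmxA.
have [bM1 bM2] := blk (n + k)%N N.
apply: (block_cone_in (e1 _) (e1 _) bM1 bM2 K0 thD th0 (ta2 _) (ta2 _)).
  apply: le_trans (al_le (n + k)%N N (leq_trans n1 (leq_addr _ _))) _.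
  by rewrite ler_piMl ?sqr_ge0.
rewrite yk zk -/y -/z.
have := al_le n k n1.
set al' := \prod_(_ <= _ < _) al _; set de' := \prod_(_ <= _ < _) de _ => hal.
have Ck0 : 0 <= C * lam ^+ k by rewrite mulr_ge0 // exprn_ge0 // ltW.
have hal' : `|al'| <= C * lam ^+ k * `|de'|.
  have q0 : 0 <= C * lam ^+ k * `|de'| by rewrite mulr_ge0.
  rewrite -(@ler_pXn2r _ 2%N) ?nnegrE //.
  by rewrite [leRHS]exprMn !real_normK ?num_real.
have etaK : 0 < eta + K by lra.
have hal2 : `|al'| * (eta + K) <= `|de'|.
  rewrite -ler_pdivlMr //; apply: le_trans hal' _.
  by rewrite mulrC ler_wpM2l.
rewrite -exprMn -[leLHS]real_normK ?num_real // -[leRHS]real_normK ?num_real //.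
rewrite ler_pXn2r ?nnegrE //.
have tay i : `|ta i * y| <= K * `|y| by rewrite normrM ler_wpM2r.
have t1 : `|de' * ta (n + k)%N * y| <= `|de'| * (K * `|y|).
  by rewrite -mulrA normrM ler_wpM2l.
have t2 : `|al' * (z - ta n * y)| <= `|al'| * ((eta + K) * `|y|).
  rewrite normrM ler_wpM2l //; apply: le_trans (ler_normB _ _) _.
  by have := tay n; lra.
have t3 : `|al'| * ((eta + K) * `|y|) <= `|de'| * `|y|.
  by rewrite mulrA ler_wpM2r.
apply: le_trans (ler_normD _ _) _.
have -> : `|(K + 1) * (de' * y)| = (K + 1) * (`|de'| * `|y|).
  by rewrite !normrM [`|K + 1|]ger0_norm //; lra.
lra.
Qed.

End Frames.
End Sequence.

(** * Jacobian matrices *)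

Section Calculus.
Context {R : realType}.

Lemma cvg_mxP (T : Type) (F : set_system T) {FF : Filter F} m n
    (f : T -> 'M[R]_(m.+1, n.+1)) (A : 'M[R]_(m.+1, n.+1)) :
  (f @ F --> A) <-> (forall i j, (fun t => f t i j) @ F --> A i j).
Proof.
split=> [fA i j|h].
  apply: (@cvg_comp _ _ _ f (fun M : 'M[R]_(m.+1, n.+1) => M i j) F _ _ fA).
  exact: coord_continuous.
apply/cvgrPdist_le => e e0.
have : \forall t \near F, forall i j, `|A i j - f t i j| <= e.
  apply: filter_forall => i; apply: filter_forall => j.
  by move: (h i j) => /cvgrPdist_le; exact.
apply: filterS => t ht; apply: mx_norm_le; first exact: ltW.
by move=> i j; rewrite !mxE.
Qed.

Lemma cvg_near_eq (T : Type) (U : topologicalType) (F : set_system T)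
    {FF : Filter F} (f h : T -> U) (l : U) :
  (\forall t \near F, f t = h t) -> f @ F --> l -> h @ F --> l.
Proof.
move=> fh; apply: cvg_trans; apply: near_eq_cvg.
by apply: filterS fh => t ->.
Qed.

Section Cvg.
Context (T : Type) (F : set_system T) {FF : Filter F}.

Lemma cvg_mulmx m n (f : T -> 'M[R]_(m.+1, 2)) (g : T -> 'M[R]_(2, n.+1))
    (A : 'M[R]_(m.+1, 2)) (B : 'M[R]_(2, n.+1)) :
  f @ F --> A -> g @ F --> B -> (fun t => f t *m g t) @ F --> A *m B.
Proof.
move=> /cvg_mxP fA /cvg_mxP gB; apply/cvg_mxP => i j.
rewrite mulmx2E; under eq_fun do rewrite mulmx2E.
by apply: cvgD; apply: cvgM.
Qed.

Lemma cvg_trmx m n (f : T -> 'M[R]_(m.+1, n.+1)) (A : 'M[R]_(m.+1, n.+1)) :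
  f @ F --> A -> (fun t => (f t)^T) @ F --> A^T.
Proof.
move=> /cvg_mxP fA; apply/cvg_mxP => i j.
by rewrite mxE; under eq_fun do rewrite mxE; exact: fA.
Qed.

Lemma cvg_det2 (f : T -> 'M[R]_2) (A : 'M[R]_2) :
  f @ F --> A -> (fun t => \det (f t)) @ F --> \det A.
Proof.
move=> /cvg_mxP fA; rewrite det2; under eq_fun do rewrite det2.
by apply: cvgB; apply: cvgM.
Qed.

Lemma cvg_trace2 (f : T -> 'M[R]_2) (A : 'M[R]_2) :
  f @ F --> A -> (fun t => \tr (f t)) @ F --> \tr A.
Proof.
move=> /cvg_mxP fA; rewrite trace2; under eq_fun do rewrite trace2.
by apply: cvgD.
Qed.

Lemma cvg_invmx2 (f : T -> 'M[R]_2) (A : 'M[R]_2) :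
  (\forall t \near F, f t \in unitmx) -> A \in unitmx ->
  f @ F --> A -> (fun t => invmx (f t)) @ F --> invmx A.
Proof.
move=> fu Au fA.
have E (B : 'M[R]_2) : B \in unitmx -> invmx B = (\det B)^-1 *: \adj B.
  by rewrite /invmx => ->.
rewrite E //; apply: (@cvg_near_eq _ _ F _ (fun t => (\det (f t))^-1 *: \adj (f t))).
  by apply: filterS fu => t /E ->.
have d0 : \det A != 0 by move: Au; rewrite unitmxE unitfE.
apply: cvgZ; first by apply: cvgV => //; exact: cvg_det2.
apply/cvg_mxP => i j; rewrite mxE; under eq_fun do rewrite mxE.
apply: cvgM; first exact: cvg_cst.
have E2 (B : 'M[R]_2) : \det (row' j (col' i B)) = B (lift j 0) (lift i 0).
  by rewrite det_mx11 !mxE.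
rewrite E2; under eq_fun do rewrite E2.
by move/cvg_mxP: fA; exact.
Qed.

End Cvg.

Lemma mulmxr_cvg (A : 'M[R]_2) (x : 'rV[R]_2) : (mulmxr A) @ x --> x *m A.
Proof.
have h1 : (id : 'rV[R]_2 -> 'rV[R]_2) @ x --> x by exact: cvg_id.
have h2 : (cst A : 'rV[R]_2 -> 'M[R]_2) @ x --> A by exact: (@cvg_cst _ A _ (nbhs x) _).
exact: (cvg_mulmx h1 h2).
Qed.

Lemma diffJP (F : 'rV[R]_2 -> 'rV[R]_2) p (A : 'M[R]_2) :
  (forall e, 0 < e -> \forall h \near (0 : 'rV[R]_2), `|F (h + p) - F p - h *m A| <= e * `|h|) ->
  differentiable F p /\ 'J F p = A.
Proof.
move=> H.
have cA : continuous (mulmxr A : 'rV[R]_2 -> 'rV[R]_2).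
  exact: mulmxr_cvg.
have FA : F \o shift p = cst (F p) + (mulmxr A : 'rV[R]_2 -> 'rV[R]_2) +o_ (0 : 'rV[R]_2) id.
  apply/eqaddoP => e e0; apply: filterS (H e e0) => h /=.
  by rewrite [(_ - _) h]/= opprD addrA.
have dE := diff_unique cA FA.
split; first by apply/diff_locallyP; rewrite dE.
by apply/row_matrixP => i; rewrite !rowE /jacobian mul_rV_lin1 dE.
Qed.

Lemma diffJ (F : 'rV[R]_2 -> 'rV[R]_2) p : differentiable F p ->
  forall e, 0 < e -> \forall h \near (0 : 'rV[R]_2), `|F (h + p) - F p - h *m 'J F p| <= e * `|h|.
Proof.
move=> dF e e0; have [cF /eqaddoP /(_ e e0)] := (diff_locallyP p F).1 dF.
apply: filterS => h /=.
by rewrite [(_ - _) h]/= opprD addrA /jacobian mul_rV_lin1.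
Qed.

(** Derivatives depend on germs only. *)
Lemma diffJ_near (F G : 'rV[R]_2 -> 'rV[R]_2) p :
  (\forall q \near p, F q = G q) -> differentiable F p ->
  differentiable G p /\ 'J G p = 'J F p.
Proof.
move=> FG dF; apply: diffJP => e e0.
have Fp : F p = G p by exact: (nbhs_singleton FG).
have FG' : \forall h \near (0 : 'rV[R]_2), F (h + p) = G (h + p).
  move/nbhs0P: FG; apply: filterS => h; by rewrite addrC.
by apply: filterS2 FG' (diffJ dF e0) => h <-; rewrite Fp.
Qed.

Lemma J_comp (F G : 'rV[R]_2 -> 'rV[R]_2) p :
  differentiable F p -> differentiable G (F p) ->
  'J (G \o F) p = 'J F p *m 'J G (F p).
Proof.
move=> dF dG; apply/row_matrixP => i; rewrite !rowE mulmxA.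
have h (H : 'rV[R]_2 -> 'rV[R]_2) q (u : 'rV[R]_2) : u *m 'J H q = 'd H q u by exact: mul_rV_lin1.
apply: (etrans (h _ _ _)).
apply: (etrans (congr1 (fun k => k (delta_mx 0 i)) (diff_comp dF dG))).
apply: esym; apply: (etrans (h G (F p) _)).
exact: (congr1 ('d G (F p)) (h F p _)).
Qed.

Lemma J_id p : 'J (@id 'rV[R]_2) p = 1%:M.
Proof.
have [_ //] : differentiable (@id 'rV[R]_2) p /\ 'J (@id 'rV[R]_2) p = 1%:M.
apply: diffJP => e e0; near=> h.
by rewrite addrK mulmx1 subrr normr0 mulr_ge0 // ltW.
Unshelve. all: by end_near. Qed.

(** The entries of the Jacobian matrix are those of the directional derivatives
    along the basis vectors. *)
Lemma Ck1P (U : set 'rV[R]_2) (F : 'rV[R]_2 -> 'rV[R]_2) : open U ->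
  Ck 1 U F <-> (forall p, U p -> differentiable F p /\
    {for p, continuous (fun q => 'J F q)}).
Proof.
move=> Uo; split=> [[dF cF] p Up|H].
  split; first exact: dF.
  apply/(@cvg_mxP _ (nbhs p) _) => i j.
  have c := cF (delta_mx 0 i) p Up.
  have /(@cvg_mxP _ (nbhs p) _)/(_ 0 j) {}c := c.
  have E q : U q -> ('D_(delta_mx 0 i) F q) 0 j = 'J F q i j.
    move=> Uq; rewrite (deriveEjacobian _ (dF q Uq)) mulmx2E !mxE.
    by case: (ord2P i) => ->; rewrite /= ?mulr1n ?mulr0n; ring.
  rewrite E // in c; apply: (@cvg_near_eq _ _ (nbhs p) _ _ _ _ _ c).
  have := open_nbhs_nbhs (conj Uo Up); apply: filterS => q Uq.
  by rewrite E.
split=> [p /H[]//|v p Up].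
have c : {for p, continuous (fun q => v *m 'J F q)}.
  have h1 : (cst v : 'rV[R]_2 -> 'rV[R]_2) @ p --> v by exact: (@cvg_cst _ v _ (nbhs p) _).
  exact: (cvg_mulmx h1 (H p Up).2).
suff : (fun q => 'D_v F q) @ p --> 'D_v F p by [].
rewrite (deriveEjacobian _ (H p Up).1).
apply: (@cvg_near_eq _ _ (nbhs p) _ _ _ _ _ c).
have := open_nbhs_nbhs (conj Uo Up); apply: filterS => q Uq.
by rewrite deriveEjacobian //; case: (H q Uq).
Qed.

End Calculus.

(** * Derivatives in charts *)

(* Differentials are defined by choice; unfolding them makes unification
   diverge. *)
#[local] Opaque jacobian.
Section Charts.
Context {R : realType} {M : closed_surface R}.
Implicit Types (a b c : chart R M) (f h : M -> M) (x y : M).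

(** The Jacobian matrix of [f] at [x] in the charts [a] and [b]. *)
Definition Jc a b f x : 'M[R]_2 := 'J (in_charts a b f) (chart_fun a x).

Lemma C1_cont f : C1_map f -> continuous f. Proof. by case. Qed.

Lemma near_chart a x (P : M -> Prop) : chart_dom a x ->
  (\forall y \near x, P y) -> \forall p \near chart_fun a x, P (chart_inv a p).
Proof.
move=> ax Px.
have : chart_inv a @ chart_fun a x --> chart_inv a (chart_fun a x).
  exact: chart_inv_continuous (chart_funP ax).
by rewrite chart_funK // => /(_ P Px).
Qed.

Lemma near_img a x : chart_dom a x -> \forall p \near chart_fun a x, chart_img a p.
Proof.
move=> ax; apply: open_nbhs_nbhs; split; first exact: chart_img_open.
exact: chart_funP.
Qed.

Lemma near_dom a x : chart_dom a x -> \forall y \near x, chart_dom a y.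
Proof. by move=> ax; apply: open_nbhs_nbhs; split => //; exact: chart_dom_open. Qed.

Lemma in_charts_dom_open a b f : continuous f -> open (in_charts_dom a b f).
Proof.
move=> cf; rewrite openE => p [ap bp].
have := near_img (chart_invP ap); rewrite chart_invK // => h1.
have h2 : \forall y \near chart_inv a p, chart_dom b (f y).
  exact: (cf (chart_inv a p) _ (near_dom bp)).
have := near_chart (chart_invP ap) h2; rewrite chart_invK // => h3.
by apply: filterS2 h1 h3.
Qed.

Lemma C1_diff f a b x : C1_map f -> atlas a -> atlas b -> chart_dom a x ->
  chart_dom b (f x) ->
  differentiable (in_charts a b f) (chart_fun a x) /\
  {for chart_fun a x, continuous (fun p => 'J (in_charts a b f) p)}.
Proof.
move=> [cf Cf] aa ab ax bfx.
have /(_ (chart_fun a x)) := (Ck1P _ (@in_charts_dom_open a b f cf)).1 (Cf a b aa ab).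
apply; split; first exact: chart_funP.
by rewrite chart_funK.
Qed.

Lemma Jc_cont f a b x : C1_map f -> atlas a -> atlas b -> chart_dom a x ->
  chart_dom b (f x) -> (Jc a b f) @ x --> Jc a b f x.
Proof.
move=> Cf aa ab ax bfx; have [_ h] := C1_diff Cf aa ab ax bfx.
apply: (@cvg_comp _ _ _ (chart_fun a) (fun p => 'J (in_charts a b f) p) (nbhs x) _ _ _ h).
exact: chart_fun_continuous.
Qed.

(** Junk values outside of the charts confine this identity to a neighbourhood. *)
Lemma in_charts_comp a b c f h x : {for x, continuous f} -> chart_dom a x ->
  chart_dom b (f x) ->
  \forall p \near chart_fun a x,
    (in_charts b c h \o in_charts a b f) p = in_charts a c (h \o f) p.
Proof.
move=> cf ax bfx; have h2 : \forall y \near x, chart_dom b (f y).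
  exact: (cf _ (near_dom bfx)).
apply: filterS (near_chart ax h2) => p bp.
by rewrite /in_charts /= chart_funK.
Qed.

Lemma Jc_comp_diff a b c f h x : {for x, continuous f} -> chart_dom a x ->
  chart_dom b (f x) -> differentiable (in_charts a b f) (chart_fun a x) ->
  differentiable (in_charts b c h) (chart_fun b (f x)) ->
  differentiable (in_charts a c (h \o f)) (chart_fun a x) /\
  Jc a c (h \o f) x = Jc a b f x *m Jc b c h (f x).
Proof.
move=> cf ax bfx df dh.
have E : in_charts a b f (chart_fun a x) = chart_fun b (f x).
  by rewrite /in_charts chart_funK.
rewrite -E in dh.
have [d1 d2] := diffJ_near (in_charts_comp c h cf ax bfx) (differentiable_comp df dh).
split; first exact: d1.
apply: (etrans d2); apply: (etrans (J_comp df dh)).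
by rewrite /Jc -E.
Qed.

Lemma Jc_comp a b c f h x : C1_map f -> C1_map h -> atlas a -> atlas b -> atlas c ->
  chart_dom a x -> chart_dom b (f x) -> chart_dom c (h (f x)) ->
  Jc a c (h \o f) x = Jc a b f x *m Jc b c h (f x).
Proof.
move=> Cf Ch aa ab ac ax bfx chx.
have [df _] := C1_diff Cf aa ab ax bfx; have [dh _] := C1_diff Ch ab ac bfx chx.
have cf : {for x, continuous f} by exact: C1_cont.
by have [] := Jc_comp_diff cf ax bfx df dh.
Qed.

Lemma C1_id : C1_map (@id M).
Proof.
split=> [x|a b aa ab]; first exact: cvg_id.
exact: (atlas_smooth aa ab 1).
Qed.

(** A pointwise form of [C1_map] which asks for one pair of charts only; the
    smooth changes of charts give the others ([C1_from_local]). *)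
Definition C1_at f x := exists a b,
  [/\ atlas a /\ atlas b, chart_dom a x /\ chart_dom b (f x),
     \forall y \near x, differentiable (in_charts a b f) (chart_fun a y) &
     Jc a b f @ x --> Jc a b f x].

Lemma Jc_change f x a b a' b' : continuous f -> atlas a -> atlas b ->
  atlas a' -> atlas b' ->
  chart_dom a x -> chart_dom b (f x) -> chart_dom a' x -> chart_dom b' (f x) ->
  differentiable (in_charts a b f) (chart_fun a x) ->
  differentiable (in_charts a' b' f) (chart_fun a' x) /\
  Jc a' b' f x = Jc a' a id x *m Jc a b f x *m Jc b b' id (f x).
Proof.
move=> cf aa ab aa' ab' ax bx ax' bx' df.
have cid : {for x, continuous (@id M)} by exact: cvg_id.
have cfx : {for x, continuous f} by exact: cf.
have [d1 _] := C1_diff C1_id aa' aa ax' ax.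
have [d2 _] := C1_diff C1_id ab ab' bx bx'.
have [d3 E3] := Jc_comp_diff cfx ax bx df d2.
have [d4 E4] := Jc_comp_diff cid ax' ax d1 d3.
split; first exact: d4.
apply: (etrans E4); rewrite -mulmxA; congr (_ *m _); exact: E3.
Qed.

Lemma C1_from_local f : continuous f -> (forall x, C1_at f x) -> C1_map f.
Proof.
move=> cf hf; split; first exact: cf.
move=> a' b' aa' ab'.
apply/(Ck1P _ (@in_charts_dom_open a' b' f cf)) => p [ap bp].
set x := chart_inv a' p in bp.
have ax' : chart_dom a' x by exact: chart_invP.
have [a [b [[aa ab] [ax bx] df cJ]]] := hf x.
have hd : \forall y \near x, [/\ chart_dom a y, chart_dom b (f y), chart_dom a' y, chart_dom b' (f y) &
     differentiable (in_charts a b f) (chart_fun a y)].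
  have h1 := cf x _ (near_dom bx).
  have h2 := cf x _ (near_dom bp).
  near=> y; split; near: y => //; exact: near_dom.
have hx := nbhs_singleton hd.
have E (y : M) : [/\ chart_dom a y, chart_dom b (f y), chart_dom a' y, chart_dom b' (f y) &
     differentiable (in_charts a b f) (chart_fun a y)] ->
     differentiable (in_charts a' b' f) (chart_fun a' y) /\
     Jc a' b' f y = Jc a' a id y *m Jc a b f y *m Jc b b' id (f y).
  by case=> *; exact: Jc_change.
have px : chart_fun a' x = p by exact: chart_invK.
split; first by rewrite -px; case: (E x hx).
have cJ' : Jc a' b' f @ x --> Jc a' b' f x.
  rewrite (E x hx).2.
  apply: (@cvg_near_eq _ _ (nbhs x) _ (fun y => Jc a' a id y *m Jc a b f y *m Jc b b' id (f y))).
    by apply: filterS hd => y /E[_ ->].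
  have c1 : Jc a' a id @ x --> Jc a' a id x by exact: (Jc_cont C1_id).
  have c2 : Jc b b' id @ f x --> Jc b b' id (f x) by exact: (Jc_cont C1_id).
  have c3 := @cvg_comp _ _ _ f (Jc b b' id) (nbhs x) _ _ (cf x) c2.
  exact: (cvg_mulmx (cvg_mulmx c1 cJ) c3).
suff : (fun q => 'J (in_charts a' b' f) q) @ p --> 'J (in_charts a' b' f) p by [].
have -> : 'J (in_charts a' b' f) p = Jc a' b' f x by rewrite /Jc px.
apply: (@cvg_near_eq _ _ (nbhs p) _ (fun q => Jc a' b' f (chart_inv a' q))).
  rewrite -px; apply: filterS (near_img ax') => q aq.
  by rewrite /Jc chart_invK.
apply: (@cvg_comp _ _ _ (chart_inv a') (Jc a' b' f) (nbhs p) _ _ _ cJ').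
exact: (chart_inv_continuous ap).
Unshelve. all: by end_near. Qed.

Lemma C1_comp f h : C1_map f -> C1_map h -> C1_map (h \o f).
Proof.
move=> Cf Ch.
have cf := C1_cont Cf; have ch := C1_cont Ch.
apply: C1_from_local; first by move=> x; exact: (continuous_comp (cf x) (ch (f x))).
move=> x; pose a := chart_at x; pose b := chart_at (f x); pose c := chart_at (h (f x)).
have [aa ab ac] : [/\ atlas a, atlas b & atlas c] by split; exact: chart_at_atlas.
have [ax bx cx] : [/\ chart_dom a x, chart_dom b (f x) & chart_dom c (h (f x))].
  by split; exact: chart_at_dom.
have hd : \forall y \near x, [/\ chart_dom a y, chart_dom b (f y) & chart_dom c (h (f y))].
  have h1 := cf x _ (near_dom bx).
  have h2 := cf x _ (ch (f x) _ (near_dom cx)).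
  near=> y; split; near: y => //; exact: near_dom.
have E (y : M) : [/\ chart_dom a y, chart_dom b (f y) & chart_dom c (h (f y))] ->
   differentiable (in_charts a c (h \o f)) (chart_fun a y) /\
   Jc a c (h \o f) y = Jc a b f y *m Jc b c h (f y).
  case=> ay byy cy.
  have cfy : {for y, continuous f} by exact: cf.
  have [df _] := C1_diff Cf aa ab ay byy; have [dh _] := C1_diff Ch ab ac byy cy.
  exact: (Jc_comp_diff cfy ay byy df dh).
exists a, c; split => //.
  by apply: filterS hd => y /E[].
rewrite (E x _).2 //.
apply: (@cvg_near_eq _ _ (nbhs x) _ (fun y => Jc a b f y *m Jc b c h (f y))).
  by apply: filterS hd => y /E[_ ->].
have c1 : Jc a b f @ x --> Jc a b f x by exact: Jc_cont.
have c2 : Jc b c h @ f x --> Jc b c h (f x) by exact: Jc_cont.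
have c3 := @cvg_comp _ _ _ f (Jc b c h) (nbhs x) _ _ (cf x) c2.
exact: (cvg_mulmx c1 c3).
Unshelve. all: by end_near. Qed.

Lemma C1_iter f n : C1_map f -> C1_map (iter n f).
Proof.
move=> Cf; elim: n => [|n IH]; first exact: C1_id.
exact: (C1_comp IH Cf).
Qed.

Lemma Jc_id a x : atlas a -> chart_dom a x -> Jc a a id x = 1%:M.
Proof.
move=> aa ax.
have h : \forall p \near chart_fun a x, p = in_charts a a id p.
  by apply: filterS (near_img ax) => p ap; rewrite /in_charts chart_invK.
have dI : differentiable (@id 'rV[R]_2) (chart_fun a x) by [].
have [_ e] := diffJ_near h dI.
by apply: (etrans e); exact: J_id.
Qed.

Lemma frameE a x : chart_frame a x = Jc a (chart_at x) id x.
Proof. by []. Qed.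

Lemma tderivE f x : tderiv f x = Jc (chart_at x) (chart_at (f x)) f x.
Proof. by []. Qed.

Lemma frameK a x : atlas a -> chart_dom a x ->
  chart_frame a x *m Jc (chart_at x) a id x = 1%:M.
Proof.
move=> aa ax; rewrite frameE.
have ac := chart_at_atlas x; have cx := chart_at_dom x.
by apply: etrans (Jc_id aa ax); apply: esym; apply: (Jc_comp C1_id C1_id).
Qed.

Lemma frame_unit a x : atlas a -> chart_dom a x -> chart_frame a x \in unitmx.
Proof. by move=> aa ax; exact: (mulmx1_unit (frameK aa ax)).1. Qed.

(** The two sides are the derivative from the chart [a] to the chart selected at
    [f x]. *)
Lemma frame_tderiv a b f x : C1_map f -> atlas a -> atlas b -> chart_dom a x ->
  chart_dom b (f x) ->
  chart_frame a x *m tderiv f x = Jc a b f x *m chart_frame b (f x).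
Proof.
move=> Cf aa ab ax bx; rewrite !frameE tderivE.
have c1 := chart_at_atlas x; have c2 := chart_at_atlas (f x).
have d1 := chart_at_dom x; have d2 := chart_at_dom (f x).
have E1 := Jc_comp C1_id Cf aa c1 c2 ax d1 d2.
have E2 := Jc_comp Cf C1_id aa ab c2 ax bx d2.
exact: (etrans (esym E1) E2).
Qed.

Lemma tderiv_comp f h x : C1_map f -> C1_map h ->
  tderiv (h \o f) x = tderiv f x *m tderiv h (f x).
Proof.
move=> Cf Ch; rewrite !tderivE.
exact: (Jc_comp Cf Ch (chart_at_atlas _) (chart_at_atlas _) (chart_at_atlas _)
  (chart_at_dom _) (chart_at_dom _) (chart_at_dom _)).
Qed.

Lemma tderiv_id x : tderiv (@id M) x = 1%:M.
Proof. by apply: Jc_id; [exact: chart_at_atlas|exact: chart_at_dom]. Qed.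

Lemma tderiv_iterS f n x : C1_map f ->
  tderiv (iter n.+1 f) x = tderiv (iter n f) x *m tderiv f (iter n f x).
Proof. by move=> Cf; exact: (tderiv_comp x (C1_iter n Cf) Cf). Qed.

Lemma tderiv_iterD f m n x : C1_map f ->
  tderiv (iter (m + n) f) x = tderiv (iter m f) x *m tderiv (iter n f) (iter m f x).
Proof.
move=> Cf; elim: n => [|n IH]; first by rewrite addn0 tderiv_id mulmx1.
have E1 := tderiv_iterS (m + n) x Cf.
have E2 := tderiv_iterS n (iter m f x) Cf.
rewrite addnS; apply: (etrans E1); rewrite IH -mulmxA; congr (_ *m _).
have -> : iter (m + n) f x = iter n f (iter m f x) by rewrite addnC iterD.
exact: (esym E2).
Qed.

End Charts.

(** * Quadratic forms pulled back by the derivative *)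

Section Forms.
Context {R : realType}.

Definition qf (P : 'M[R]_2) (v : 'rV[R]_2) : R := (v *m P *m v^T) 0 0.

Lemma qfE P v : qf P v = dot (v *m P) v. Proof. by []. Qed.

Lemma qf_congr (X P : 'M[R]_2) v : qf (X *m P *m X^T) v = qf P (v *m X).
Proof. by rewrite /qf trmx_mul !mulmxA. Qed.

Lemma congr_transport (X S J Y G : 'M[R]_2) : X *m S = J *m Y ->
  X *m (S *m G *m S^T) *m X^T = J *m (Y *m G *m Y^T) *m J^T.
Proof.
move=> e.
have -> : X *m (S *m G *m S^T) *m X^T = (X *m S) *m G *m (X *m S)^T.
  by rewrite trmx_mul !mulmxA.
by rewrite e trmx_mul !mulmxA.
Qed.

Lemma trace_congr (X P G : 'M[R]_2) : X \in unitmx -> G \in unitmx ->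
  \tr (X *m P *m X^T *m invmx (X *m G *m X^T)) = \tr (P *m invmx G).
Proof.
move=> Xu Gu; have Xtu : X^T \in unitmx by rewrite unitmx_tr.
have u : (X *m G *m X^T) \in unitmx by rewrite !unitmx_mul Xu Gu Xtu.
have -> : invmx (X *m G *m X^T) = invmx X^T *m invmx G *m invmx X.
  apply: (can_inj (mulKmx u)); rewrite mulmxV // !mulmxA.
  by rewrite mulmxK // mulmxK // mulmxV.
by rewrite !mulmxA mulmxK // mxtrace_mulC !mulmxA mulVmx // mul1mx.
Qed.

Lemma det_congr (X P G : 'M[R]_2) : X \in unitmx -> G \in unitmx ->
  \det (X *m P *m X^T) / \det (X *m G *m X^T) = \det P / \det G.
Proof.
rewrite !unitmxE !unitfE => X0 G0; rewrite !det_mulmx det_tr.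
by field; rewrite X0 G0.
Qed.

Lemma qf_mulT (T : 'M[R]_2) v : qf (T *m T^T) v = dot (v *m T) (v *m T).
Proof. by rewrite /qf /dot trmx_mul !mulmxA. Qed.

Lemma qf0 P : qf P 0 = 0.
Proof. by rewrite /qf !mul0mx mxE. Qed.

Lemma near_ltr (T : Type) (F : set_system T) {FF : Filter F} (f h : T -> R) a b :
  f @ F --> a -> h @ F --> b -> a < b -> \forall t \near F, f t < h t.
Proof.
move=> fa hb ab; have ab0 : 0 < b - a by rewrite subr_gt0.
have : (fun t => h t - f t) @ F --> b - a by apply: cvgB.
by move=> /cvgr_gt /(_ 0 ab0); apply: filterS => t; rewrite subr_gt0.
Qed.

Lemma cvg_qf (T : Type) (F : set_system T) {FF : Filter F} (f : T -> 'M[R]_2) (A : 'M[R]_2) v :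
  f @ F --> A -> (fun t => qf (f t) v) @ F --> qf A v.
Proof.
move=> /cvg_mxP fA; rewrite qfE dotE !mulmx2E.
under eq_fun do rewrite qfE dotE !mulmx2E.
have cc (x : R) : (fun _ : T => x) @ F --> x by exact: (@cvg_cst _ x _ F _).
by apply: cvgD; apply: cvgM => //; apply: cvgD; apply: cvgM.
Qed.

(** Gram-Schmidt on the standard basis. *)
Lemma orthonormal_frame (G : 'M[R]_2) : G^T = G ->
  (forall v : 'rV[R]_2, v != 0 -> 0 < qf G v) -> exists O : 'M[R]_2, O *m G *m O^T = 1%:M.
Proof.
move=> Gs Gp.
have gs : G 1 0 = G 0 1 by rewrite -[in LHS]Gs mxE.
have p0 : 0 < G 0 0.
  have := Gp (delta_mx 0 0).
  rewrite qfE dotE !mulmx2E !mxE /= !mulr1n !mulr0n !mul1r !mul0r !mulr0 !mulr1 !addr0.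
  apply; apply/eqP => /matrixP/(_ 0 0); rewrite !mxE /= => /eqP.
  by rewrite oner_eq0.
have D0 : 0 < G 0 0 * G 1 1 - G 0 1 ^+ 2.
  have := Gp (\row_j (if j == 0 then - G 0 1 else G 0 0)).
  rewrite qfE dotE !mulmx2E !mxE /= gs.
  have -> : (- G 0 1 * G 0 0 + G 0 0 * G 0 1) * - G 0 1 +
     (- G 0 1 * G 0 1 + G 0 0 * G 1 1) * G 0 0 = G 0 0 * (G 0 0 * G 1 1 - G 0 1 ^+ 2) by ring.
  rewrite pmulr_rgt0 //; apply; apply/eqP => /matrixP/(_ 0 1).
  by rewrite !mxE /= => h; rewrite h ltxx in p0.
set D := _ - _ in D0.
pose s := Num.sqrt (G 0 0); pose t := Num.sqrt (G 0 0 * D).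
have s2 : s ^+ 2 = G 0 0 by rewrite sqr_sqrtr // ltW.
have t2 : t ^+ 2 = G 0 0 * D by rewrite sqr_sqrtr // mulr_ge0 // ltW.
have sn : s != 0 by rewrite gt_eqF // sqrtr_gt0.
have tn : t != 0 by rewrite gt_eqF // sqrtr_gt0 mulr_gt0.
exists (\matrix_(i, j) (if i == 0 then (if j == 0 then s^-1 else 0)
   else (if j == 0 then - G 0 1 / t else G 0 0 / t))).
apply/matrixP => i j; rewrite !mulmx2E !mxE.
case: (ord2P i) => ->; case: (ord2P j) => -> /=; rewrite ?gs.
- have -> : (s^-1 * G 0 0 + 0 * G 0 1) * s^-1 + (s^-1 * G 0 1 + 0 * G 1 1) * 0 = G 0 0 / s ^+ 2.
    by field.
  by rewrite s2 divff ?gt_eqF.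
- by field; rewrite sn tn.
- by field; rewrite sn tn.
- rewrite mulr1n.
  have -> : (- G 0 1 / t * G 0 0 + G 0 0 / t * G 0 1) * (- G 0 1 / t) +
     (- G 0 1 / t * G 0 1 + G 0 0 / t * G 1 1) * (G 0 0 / t) = (G 0 0 * D) / t ^+ 2.
    by rewrite /D; field.
  by rewrite t2 divff // mulf_neq0 // gt_eqF.
Qed.

End Forms.

Section Pull.
Context {R : realType} {M : closed_surface R} (g : riemannian_metric M).
Implicit Types (a b c : chart R M) (h : M -> M) (x y : M).

(** The Gram matrix of the quadratic form [|Dh_x v|^2]. *)
Definition pull h x : 'M[R]_2 := tderiv h x *m g (h x) *m (tderiv h x)^T.

(** The Gram matrix of [P] in the coordinates of [a]. Fields of forms are
    expressed in arbitrary charts selected point by point, hence they are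
    continuous only after this change of coordinates. *)
Definition in_frame a (P : M -> 'M[R]_2) y : 'M[R]_2 :=
  chart_frame a y *m P y *m (chart_frame a y)^T.

Lemma metric_qf_gt0 x (v : 'rV[R]_2) : v != 0 -> 0 < qf (g x) v.
Proof. by move=> v0; exact: (@metric_pos _ _ g x v v0). Qed.

Lemma metric_qf_ge0 x (v : 'rV[R]_2) : 0 <= qf (g x) v.
Proof. by case: (eqVneq v 0) => [->|/(metric_qf_gt0 x)/ltW //]; rewrite qf0. Qed.

Lemma metric_frame x : exists O : 'M[R]_2, O *m g x *m O^T = 1%:M.
Proof.
by apply: orthonormal_frame; [exact: Defs.metric_sym|exact: metric_qf_gt0].
Qed.

Lemma metric_unit x : (g x : 'M[R]_2) \in unitmx.
Proof.
have [Q h] := metric_frame x.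
have : (Q *m g x *m Q^T) \in unitmx by rewrite h unitmx1.
by rewrite !unitmx_mul => /andP[/andP[_ ->]].
Qed.

Lemma pull_id x : pull id x = g x.
Proof. by rewrite /pull tderiv_id trmx1 mul1mx mulmx1. Qed.

Lemma pull_qf h x v : qf (pull h x) v = qf (g (h x)) (v *m tderiv h x).
Proof. exact: qf_congr. Qed.

Lemma gram_cont a x : atlas a -> chart_dom a x ->
  in_frame a g @ x --> in_frame a g x.
Proof.
move=> aa ax.
have c := @metric_smooth _ _ g a aa 0%N _ (chart_funP ax).
have cx := chart_fun_continuous ax.
have {}c : (fun y => in_frame a g (chart_inv a (chart_fun a y))) @ x -->
    in_frame a g (chart_inv a (chart_fun a x)).
  exact: (@cvg_comp _ _ _ (chart_fun a) _ (nbhs x) _ _ cx c).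
rewrite (chart_funK ax) in c.
apply: (@cvg_near_eq _ _ (nbhs x) _ _ _ _ _ c).
by apply: filterS (near_dom ax) => y ay; rewrite (chart_funK ay).
Qed.

(** The frames at [h y] cancel: in two fixed charts the form is a product of the
    Jacobian matrix and of the Gram matrix of the metric. *)
Lemma pull_cont h a x : C1_map h -> atlas a -> chart_dom a x ->
  in_frame a (pull h) @ x --> in_frame a (pull h) x.
Proof.
move=> Ch aa ax; pose b := chart_at (h x).
have ab : atlas b by exact: chart_at_atlas.
have bx : chart_dom b (h x) by exact: chart_at_dom.
have E y : chart_dom a y -> chart_dom b (h y) ->
    in_frame a (pull h) y = Jc a b h y *m in_frame b g (h y) *m (Jc a b h y)^T.
  by move=> ay hy; exact: (congr_transport _ (frame_tderiv Ch aa ab ay hy)).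
have cx : h @ x --> h x by exact: (C1_cont Ch).
have hd := cx _ (near_dom bx).
rewrite (E x ax bx).
apply: (@cvg_near_eq _ _ (nbhs x) _
  (fun y => Jc a b h y *m in_frame b g (h y) *m (Jc a b h y)^T)).
  by apply: filterS2 (near_dom ax) hd => y ay hy; rewrite (E y ay hy).
have c1 := Jc_cont Ch aa ab ax bx.
have c2 := @cvg_comp _ _ _ h (in_frame b g) (nbhs x) _ _ cx (gram_cont ab bx).
exact: (cvg_mulmx (cvg_mulmx c1 c2) (cvg_trmx c1)).
Qed.

(** The squares of the Hilbert-Schmidt norm and of the determinant of [Dh_x],
    with respect to the metric; being invariants, they are continuous on [M]. *)
Definition expansion h x : R := \tr (pull h x *m invmx (g x)).
Definition area h x : R := \det (pull h x) / \det (g x).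

Lemma expansion_in_frame a h x : atlas a -> chart_dom a x ->
  expansion h x = \tr (in_frame a (pull h) x *m invmx (in_frame a g x)).
Proof.
move=> aa ax; have Xu := frame_unit aa ax; have gu := metric_unit x.
by rewrite trace_congr.
Qed.

Lemma area_in_frame a h x : atlas a -> chart_dom a x ->
  area h x = \det (in_frame a (pull h) x) / \det (in_frame a g x).
Proof.
by move=> aa ax; rewrite det_congr // ?frame_unit // metric_unit.
Qed.

Lemma in_frame_unit a x : atlas a -> chart_dom a x -> in_frame a g x \in unitmx.
Proof.
move=> aa ax; have Xu := frame_unit aa ax; have gu := metric_unit x.
by rewrite !unitmx_mul Xu gu unitmx_tr Xu.
Qed.

Lemma expansion_cont h : C1_map h -> continuous (expansion h).
Proof.
move=> Ch x; pose a := chart_at x.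
have aa : atlas a by exact: chart_at_atlas.
have ax : chart_dom a x by exact: chart_at_dom.
rewrite /continuous_at (expansion_in_frame h aa ax).
apply: (@cvg_near_eq _ _ (nbhs x) _
  (fun y => \tr (in_frame a (pull h) y *m invmx (in_frame a g y)))).
  by apply: filterS (near_dom ax) => y ay; rewrite (expansion_in_frame h aa ay).
apply: cvg_trace2; apply: cvg_mulmx; first exact: pull_cont.
apply: cvg_invmx2; [|exact: in_frame_unit|exact: gram_cont].
by apply: filterS (near_dom ax) => y ay; exact: in_frame_unit.
Qed.

Lemma area_cont h : C1_map h -> continuous (area h).
Proof.
move=> Ch x; pose a := chart_at x.
have aa : atlas a by exact: chart_at_atlas.
have ax : chart_dom a x by exact: chart_at_dom.
rewrite /continuous_at (area_in_frame h aa ax).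
apply: (@cvg_near_eq _ _ (nbhs x) _
  (fun y => \det (in_frame a (pull h) y) / \det (in_frame a g y))).
  by apply: filterS (near_dom ax) => y ay; rewrite (area_in_frame h aa ay).
have d0 : \det (in_frame a g x) != 0.
  by have := in_frame_unit aa ax; rewrite unitmxE unitfE.
apply: cvgM; first by apply: cvg_det2; exact: pull_cont.
by apply: cvgV => //; apply: cvg_det2; exact: gram_cont.
Qed.

End Pull.

(** * From a dense set of points to the whole surface *)

Section Limits.
Context {R : realType} {M : closed_surface R} (g : riemannian_metric M).
Implicit Types (a b c : chart R M) (h : M -> M) (x y : M).

Section InFrames.
Variables (h : M -> M) (x : M) (A B : 'M[R]_2).
Hypotheses (hA : A *m g x *m A^T = 1%:M) (hB : B *m g (h x) *m B^T = 1%:M).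

Lemma orth_unit (Q G : 'M[R]_2) : Q *m G *m Q^T = 1%:M -> Q \in unitmx.
Proof.
move=> e; have : (Q *m G *m Q^T) \in unitmx by rewrite e unitmx1.
by rewrite !unitmx_mul => /andP[/andP[->]].
Qed.

Lemma orth_inv (Q G : 'M[R]_2) : Q *m G *m Q^T = 1%:M -> G = invmx Q *m (invmx Q)^T.
Proof.
move=> e; have Qu := orth_unit e.
have Qtu : Q^T \in unitmx by rewrite unitmx_tr.
rewrite -[LHS](mulKmx Qu) -[Q *m G](mulmxK Qtu) e mul1mx -trmx_inv.
by [].
Qed.

Lemma pull_in_frames : A *m pull g h x *m A^T =
  (A *m tderiv h x *m invmx B) *m (A *m tderiv h x *m invmx B)^T.
Proof. by rewrite /pull (orth_inv hB) !trmx_mul !mulmxA. Qed.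

Lemma expansion_frob : expansion g h x = frob (A *m tderiv h x *m invmx B).
Proof.
rewrite /expansion -(trace_congr _ (orth_unit hA) (metric_unit g x)) hA invmx1 mulmx1.
by rewrite pull_in_frames.
Qed.

Lemma area_det : area g h x = \det (A *m tderiv h x *m invmx B) ^+ 2.
Proof.
rewrite /area -(det_congr _ (orth_unit hA) (metric_unit g x)) hA det1 divr1.
by rewrite pull_in_frames det_mulmx det_tr expr2.
Qed.

Lemma pull_qf_frames v : qf (pull g h x) v =
  dot (v *m invmx A *m (A *m tderiv h x *m invmx B))
      (v *m invmx A *m (A *m tderiv h x *m invmx B)).
Proof.
rewrite -qf_mulT -pull_in_frames qf_congr mulmxKV //.
exact: orth_unit hA.
Qed.

End InFrames.

Lemma frob_gt0 (P : 'M[R]_2) : P != 0 -> 0 < frob P.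
Proof.
move=> P0; rewrite lt_neqAle; apply/andP; split; last first.
  by rewrite frobE !addr_ge0 ?sqr_ge0.
rewrite eq_sym; apply: contra P0; rewrite frobE.
rewrite !paddr_eq0 ?addr_ge0 ?sqr_ge0 // !sqrf_eq0.
move=> /andP[/andP[/andP[/eqP p0 /eqP p1] /eqP p2] /eqP p3].
by apply/eqP/mx2P => i; case: (ord2P i) => ->; rewrite mxE.
Qed.

Lemma expansion_gt0 h x : tderiv h x != 0 -> 0 < expansion g h x.
Proof.
move=> T0; have [A hA] := metric_frame g x; have [B hB] := metric_frame g (h x).
rewrite (expansion_frob hA hB); apply: frob_gt0; apply: contra T0 => /eqP e.
have Au := orth_unit hA; have Bu := orth_unit hB.
have -> : tderiv h x = invmx A *m (A *m tderiv h x *m invmx B) *m B.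
  by rewrite !mulmxA mulVmx // mul1mx mulmxKV.
by rewrite e mulmx0 mul0mx.
Qed.

Lemma near_dense (D : set M) x (P : M -> Prop) : dense D ->
  (\forall y \near x, P y) -> exists2 y, D y & P y.
Proof.
move=> dD Px; have [y [yP yD]] : (P° `&` D) !=set0.
  by apply: dD; [exists x|exact: open_interior].
by exists y => //; exact: interior_subset.
Qed.

Variables (f : M -> M) (Cf : C1_map f) (D : set M) (dD : dense D).
Variables (N k : nat) (th c : R).
Hypotheses (th0 : 0 < th).
Let F := expansion g (iter N f).
Hypothesis F0 : forall x, 0 < F x.
Let q n x v := qf (pull g (iter n f) x) v.

Lemma q_cont n x (v : 'rV[R]_2) :
  (fun y => q n y (v *m chart_frame (chart_at x) y)) @ x --> q n x (v *m chart_frame (chart_at x) x).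
Proof.
have aa := chart_at_atlas x; have ax := chart_at_dom x.
have E y : qf (in_frame (chart_at x) (pull g (iter n f)) y) v =
    q n y (v *m chart_frame (chart_at x) y) by exact: qf_congr.
have cv := @cvg_qf _ _ (nbhs x) _ _ _ v (@pull_cont _ _ g _ _ _ (C1_iter n Cf) aa ax).
rewrite -(E x); under eq_fun do rewrite -E.
exact: cv.
Qed.

Lemma area_limit (C : R) : (forall y, D y -> area g (iter N f) y <= C * F y ^+ 2) ->
  forall x, area g (iter N f) x <= C * F x ^+ 2.
Proof.
move=> H x; rewrite leNgt; apply/negP => lt.
have cN := C1_iter N Cf.
have h1 : F @ x --> F x by exact: (expansion_cont cN).
have h2 : area g (iter N f) @ x --> area g (iter N f) x by exact: (area_cont cN).
have h3 : (fun y => C * F y ^+ 2) @ x --> C * F x ^+ 2.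
  under eq_fun do rewrite expr2.
  rewrite expr2.
  have cc : (cst C : M -> R) @ x --> C by exact: (@cvg_cst _ C _ (nbhs x) _).
  by apply: cvgM => //; apply: cvgM.
have [y Dy] := near_dense dD (near_ltr h3 h2 lt).
by rewrite ltNge H.
Qed.

(** If a vector at [x] satisfies the hypothesis with [th], then the vectors with
    the same coordinates at nearby points satisfy it with [th / 2]; the
    conclusion is closed. *)
Lemma cone_limit : (forall y, D y -> forall v,
    th / 2 * F y * q 0 y v <= q N y v ->
    2 * th * F (iter k f y) * q k y v <= q (k + N) y v /\ c * q 0 y v <= q k y v) ->
  forall x v, th * F x * q 0 x v <= q N x v ->
    2 * th * F (iter k f x) * q k x v <= q (k + N) x v /\ c * q 0 x v <= q k x v.
Proof.
move=> H x v hv.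
have [->|v0] := eqVneq v 0.
  have q00 n : q n x 0 = 0 by exact: qf0.
  by split; rewrite (q00 k) ?(q00 (k + N)%N) ?(q00 0%N) mulr0 lexx.
have aa := chart_at_atlas x; have ax := chart_at_dom x.
have fr : chart_frame (chart_at x) x = 1%:M by exact: tderiv_id.
have qc n : (fun y => q n y (v *m chart_frame (chart_at x) y)) @ x --> q n x v.
  by have := @q_cont n x v; rewrite fr mulmx1.
have h1 : F @ x --> F x by exact: (expansion_cont (C1_iter N Cf)).
have ck : iter k f @ x --> iter k f x by exact: (C1_cont (C1_iter k Cf)).
have h1' : F @ iter k f x --> F (iter k f x) by exact: (expansion_cont (C1_iter N Cf)).
have h2 : (fun y => F (iter k f y)) @ x --> F (iter k f x).
  exact: (@cvg_comp _ _ _ (iter k f) F (nbhs x) _ _ ck h1').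
have cc (C : R) : (cst C : M -> R) @ x --> C by exact: (@cvg_cst _ C _ (nbhs x) _).
have q0 : 0 < q 0 x v by rewrite /q pull_id; exact: metric_qf_gt0.
have near1 : \forall y \near x, th / 2 * F y * q 0 y (v *m chart_frame (chart_at x) y) <
    q N y (v *m chart_frame (chart_at x) y).
  apply: (near_ltr (cvgM (cvgM (cc (th / 2)) h1) (qc 0)) (qc N)).
  apply: lt_le_trans hv; have := mulr_gt0 (mulr_gt0 th0 (F0 x)) q0; lra.
split; rewrite leNgt; apply/negP => lt.
  have near2 : \forall y \near x, q (k + N)%N y (v *m chart_frame (chart_at x) y) <
      2 * th * F (iter k f y) * q k y (v *m chart_frame (chart_at x) y).
    exact: (near_ltr (qc (k + N)%N) (cvgM (cvgM (cc (2 * th)) h2) (qc k)) lt).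
  have [y Dy [l1 l2]] := near_dense dD (filterI near1 near2).
  have [+ _] := H y Dy _ (ltW l1).
  by rewrite leNgt l2.
have near2 : \forall y \near x, q k y (v *m chart_frame (chart_at x) y) <
    c * q 0%N y (v *m chart_frame (chart_at x) y).
  exact: (near_ltr (qc k) (cvgM (cc c) (qc 0%N)) lt).
have [y Dy [l1 l2]] := near_dense dD (filterI near1 near2).
have [_ +] := H y Dy _ (ltW l1).
by rewrite leNgt l2.
Qed.

End Limits.

(** * The principal axis of a quadratic form *)

Section Axis.
Context {R : realType}.
Implicit Types (u v w z : 'rV[R]_2).

Lemma wedge_colinear v w : v != 0 -> v 0 0 * w 0 1 = v 0 1 * w 0 0 -> exists k, w = k *: v.
Proof.
move=> v0 h; have [v00|v00] := eqVneq (v 0 0) 0.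
  have v01 : v 0 1 != 0.
    by apply: contra v0 => /eqP v01; apply/eqP/rv2P; rewrite ?v00 ?v01 mxE.
  exists (w 0 1 / v 0 1); apply/rv2P; rewrite !mxE ?v00 ?divfK // mulr0.
  by apply/eqP; move/eqP: h; rewrite v00 mul0r eq_sym mulf_eq0 (negPf v01).
exists (w 0 0 / v 0 0); apply/rv2P; rewrite !mxE ?divfK //.
by rewrite mulrAC -[w 0 1](mulKf v00) h; field.
Qed.

Definition nonzero_row (B : 'M[R]_2) : 'rV[R]_2 :=
  if row 0 B != 0 then row 0 B else row 1 B.

(** The row space of a matrix of rank one. *)
Definition row_line (B : 'M[R]_2) : {vspace 'rV[R]_2} := <[nonzero_row B]>%VS.

Section RowLine.
Variable B : 'M[R]_2.
Hypotheses (B0 : B != 0) (detB : \det B = 0).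

Let v := nonzero_row B.

Let v0 : v != 0.
Proof.
rewrite /v /nonzero_row; case: ifPn => // /negPn/eqP r0; apply: contra B0 => /eqP r1.
apply/eqP/row_matrixP => i.
by case: (ord2P i) => ->; rewrite ?r0 ?r1 row0.
Qed.

Let vE : exists z, v = z *m B.
Proof. by rewrite /v /nonzero_row; case: ifP => _; rewrite rowE; eexists. Qed.

Lemma row_line_dim : \dim (row_line B) = 1%N.
Proof. by rewrite /row_line dim_vline -/v v0. Qed.

Lemma row_line_mul z : z *m B \in row_line B.
Proof.
apply/vlineP; apply: (wedge_colinear v0); have [z' ->] := vE.
rewrite !mulmx2E; apply/eqP; rewrite -subr_eq0; apply/eqP.
transitivity ((z' 0 0 * z 0 1 - z' 0 1 * z 0 0) * \det B); last by rewrite detB mulr0.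
by rewrite det2; ring.
Qed.

Lemma row_lineP u : u \in row_line B -> exists z, u = z *m B.
Proof.
case/vlineP => k ->; have [z hz] := vE; exists (k *: z).
by rewrite -scalemxAl -hz.
Qed.

Lemma row_line_span z : z *m B != 0 -> row_line B = <[z *m B]>%VS.
Proof.
move=> zB; have /vlineP[k hk] := row_line_mul z.
have k0 : k != 0 by apply: contra zB => /eqP k0; rewrite hk k0 scale0r.
apply/eqP; rewrite eqEsubv -!memvE row_line_mul andbT.
apply/vlineP; exists k^-1.
by rewrite hk scalerA mulVf // scale1r.
Qed.

End RowLine.

(** The difference of the eigenvalues of a matrix of trace [1] and
    determinant [x]. *)
Definition gap (x : R) : R := Num.sqrt (1 - 4 * x).

Lemma gapP (th x : R) : 0 < th -> th <= 1 / 8 -> x <= (th - th ^+ 2) / 2 ->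
  [/\ 0 < gap x, gap x ^+ 2 = 1 - 4 * x, 0 < (1 + gap x) / 2 - th &
     0 < th - (1 - gap x) / 2].
Proof.
move=> th0 th8 hx.
have th2 : th ^+ 2 <= th / 8 by have := ler_wpM2l (ltW th0) th8; rewrite expr2; lra.
have p : 0 < 1 - 4 * x by have := sqr_ge0 th; lra.
have g0 : 0 < gap x by rewrite sqrtr_gt0.
suff g1 : 1 - 2 * th < gap x.
  by split; [by []|by rewrite sqr_sqrtr ?(ltW p)|lra|lra].
rewrite -(@ltr_pXn2r _ 2%N) ?nnegrE ?sqrtr_ge0 //; last by lra.
rewrite sqr_sqrtr ?(ltW p) //.
have -> : (1 - 2 * th) ^+ 2 = 1 - 4 * th + 4 * th ^+ 2 by ring.
lra.
Qed.

Section Spectral.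
Variables (G P : 'M[R]_2) (th : R).
Hypotheses (Gs : G^T = G) (Gu : G \in unitmx) (Ps : P^T = P).
Hypotheses (Gp : forall v, 0 <= qf G v).
Let t : R := \tr (P *m invmx G).
Let Dl : R := \det P / \det G / t ^+ 2.
Hypotheses (t0 : 0 < t) (th0 : 0 < th) (th8 : th <= 1 / 8) (hD : Dl <= (th - th ^+ 2) / 2).

Let S : 'M[R]_2 := t^-1 *: (P *m invmx G).
(** [S] is the operator of the form [P] with respect to [G], scaled to trace [1].
    Subtracting its smaller eigenvalue leaves, by Cayley-Hamilton, a matrix
    whose rows span the other eigenline. *)
Definition axis_mx : 'M[R]_2 := S - ((1 - gap Dl) / 2)%:M.
Let B := axis_mx.

Let trS : \tr S = 1.
Proof. by rewrite /S mxtraceZ mulVf ?gt_eqF. Qed.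

Let detS : \det S = Dl.
Proof.
rewrite /S detZ det_mulmx det_inv /Dl; rewrite exprVn; ring.
Qed.

Let B00 : B 0 0 = S 0 0 - (1 - gap Dl) / 2. Proof. by rewrite mxE [X in _ + X]mxE [X in _ - X]mxE eqxx mulr1n. Qed.
Let B11 : B 1 1 = S 1 1 - (1 - gap Dl) / 2. Proof. by rewrite mxE [X in _ + X]mxE [X in _ - X]mxE eqxx mulr1n. Qed.
Let B01 : B 0 1 = S 0 1. Proof. by rewrite mxE [X in _ + X]mxE [X in _ - X]mxE /= mulr0n subr0. Qed.
Let B10 : B 1 0 = S 1 0. Proof. by rewrite mxE [X in _ + X]mxE [X in _ - X]mxE /= mulr0n subr0. Qed.

Let gap0 : 0 < gap Dl. Proof. by case: (gapP th0 th8 hD). Qed.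
Let num0 : 0 < (1 + gap Dl) / 2 - th. Proof. by case: (gapP th0 th8 hD). Qed.
Let den0 : 0 < th - (1 - gap Dl) / 2. Proof. by case: (gapP th0 th8 hD). Qed.
Let gap2 : gap Dl ^+ 2 = 1 - 4 * Dl. Proof. by case: (gapP th0 th8 hD). Qed.

Let S11 : S 1 1 = 1 - S 0 0.
Proof. by rewrite -trS trace2; ring. Qed.

Let S01 : S 0 1 * S 1 0 = S 0 0 * (1 - S 0 0) - Dl.
Proof. by rewrite -detS det2 S11; ring. Qed.

Lemma axis_det : \det B = 0.
Proof. rewrite det2 B00 B11 B01 B10 S01 S11; move: gap2; rewrite expr2 => h; lra. Qed.

Lemma axis_neq0 : B != 0.
Proof.
apply/eqP => h; have : \tr B = gap Dl by rewrite trace2 B00 B11 S11; lra.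
rewrite h mxtrace0 => h'.
by have := gap0; rewrite -h' ltxx.
Qed.

Lemma axis_sqr : B *m B = gap Dl *: B.
Proof.
have d := axis_det; rewrite det2 in d.
have tr : B 0 0 + B 1 1 = gap Dl by rewrite B00 B11 S11; lra.
apply/mx2P => i; case: (ord2P i) => ->; rewrite mulmx2E [RHS]mxE -tr; lra.
Qed.

Lemma axis_sym : B *m G = G *m B^T.
Proof.
have SG : S *m G = t^-1 *: P by rewrite /S -scalemxAl mulmxKV.
rewrite /B /axis_mx mulmxBl SG raddfB /= mulmxBr tr_scalar_mx mul_scalar_mx mul_mx_scalar.
congr (_ - _).
by rewrite -[X in _ *: X]Ps -linearZ /= -SG trmx_mul Gs.
Qed.

Let PE : P = t *: ((B + ((1 - gap Dl) / 2)%:M) *m G).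
Proof.
by rewrite /B /axis_mx subrK /S -scalemxAl mulmxKV // scalerA mulfV ?scale1r // gt_eqF.
Qed.

Definition gperp u w := (u *m G *m w^T) 0 0 = 0.

Let gsym u w : (u *m G *m w^T) 0 0 = (w *m G *m u^T) 0 0.
Proof.
transitivity ((u *m G *m w^T)^T 0 0); first by rewrite [RHS]mxE.
by rewrite trmx_mul trmx_mul trmxK Gs mulmxA.
Qed.

(** [S] is self-adjoint, so that its eigenlines are orthogonal and [P] is
    diagonal in the decomposition [u + w]. *)
Lemma axis_form u w : u \in row_line B -> (forall u', u' \in row_line B -> gperp u' w) ->
  qf G (u + w) = qf G u + qf G w /\
  qf P (u + w) = t * ((1 + gap Dl) / 2 * qf G u + (1 - gap Dl) / 2 * qf G w).
Proof.
move=> uL hw; have uw := hw u uL; rewrite /gperp in uw.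
have wu := gsym w u; rewrite uw in wu.
have qG (v1 v2 : 'rV[R]_2) (A : 'M[R]_2) : qf A (v1 + v2) =
    qf A v1 + (v1 *m A *m v2^T) 0 0 + ((v2 *m A *m v1^T) 0 0 + qf A v2).
  by rewrite /qf mulmxDl linearD /= mulmxDr !mulmxDl !mxE; ring.
have eG : qf G (u + w) = qf G u + qf G w by rewrite qG uw wu; ring.
split => //.
have [z uz] := row_lineP uL.
have uB : u *m B = gap Dl *: u by rewrite uz -mulmxA axis_sqr -scalemxAr.
have wB := hw _ (row_line_mul axis_neq0 axis_det w); rewrite /gperp in wB.
have BG v1 v2 : (v1 *m (B *m G) *m v2^T) 0 0 = (v1 *m B *m G *m v2^T) 0 0.
  by rewrite !mulmxA.
have e1 : qf (B *m G) u = gap Dl * qf G u.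
  by rewrite /qf BG uB -!scalemxAl mxE.
have e2 : (u *m (B *m G) *m w^T) 0 0 = 0.
  by rewrite BG uB -!scalemxAl mxE uw mulr0.
have e3 : (w *m (B *m G) *m u^T) 0 0 = 0.
  rewrite axis_sym mulmxA -mulmxA -trmx_mul uB linearZ /= -scalemxAr mxE.
  by rewrite wu mulr0.
have e4 : qf (B *m G) w = 0 by rewrite /qf BG wB.
have eB : qf (B *m G) (u + w) = gap Dl * qf G u.
  by rewrite qG e1 e2 e3 e4; ring.
have -> : qf P (u + w) = t * (qf (B *m G) (u + w) + (1 - gap Dl) / 2 * qf G (u + w)).
  rewrite {1}PE mulmxDl mul_scalar_mx /qf -scalemxAr -scalemxAl mxE.
  by rewrite mulmxDr mulmxDl mxE -scalemxAr -scalemxAl [X in _ + X]mxE.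
by rewrite eB eG; field.
Qed.

Lemma axis_decomp v : exists u w, [/\ v = u + w, u \in row_line B &
  forall u', u' \in row_line B -> gperp u' w].
Proof.
have r0 : gap Dl != 0 by rewrite gt_eqF // gap0.
pose u := ((gap Dl)^-1 *: v) *m B.
exists u, (v - u); split; first by rewrite addrC subrK.
  exact: row_line_mul axis_neq0 axis_det _.
move=> u' /row_lineP[z ->]; rewrite /gperp -mulmxA -mulmxA [B *m _]mulmxA axis_sym.
have -> : G *m B^T *m (v - u)^T = G *m ((v - u) *m B)^T.
  by rewrite trmx_mul mulmxA.
have -> : (v - u) *m B = 0.
  rewrite mulmxBl /u -mulmxA axis_sqr -scalemxAr -scalemxAl scalerA mulfV //.
  by rewrite scale1r subrr.
by rewrite trmx0 !mulmx0 mxE.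
Qed.

(** In the decomposition of [axis_form] the condition [P >= th * t * G] reads
    [(th - mu2) |w|^2 <= (mu1 - th) |u|^2], where [mu1] and [mu2] are the
    eigenvalues of [S]. *)
Definition aperture (x : R) : R :=
  Num.sqrt (((1 + gap x) / 2 - th) / (th - (1 - gap x) / 2)).

Lemma aperture_gt0 : 0 < aperture Dl.
Proof.
by rewrite sqrtr_gt0 divr_gt0.
Qed.

Lemma axis_cone v u w : v = u + w -> u \in row_line B ->
  (forall u', u' \in row_line B -> gperp u' w) ->
  Num.sqrt (qf G w) <= aperture Dl * Num.sqrt (qf G u) -> th * t * qf G v <= qf P v.
Proof.
move=> -> uL hw hc; have [e1 e2] := axis_form uL hw.
have hc2 : qf G w <= ((1 + gap Dl) / 2 - th) / (th - (1 - gap Dl) / 2) * qf G u.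
  move: hc; rewrite -(@ler_pXn2r _ 2%N) ?nnegrE ?mulr_ge0 ?sqrtr_ge0 //.
  by rewrite exprMn !sqr_sqrtr ?Gp // divr_ge0 // ltW.
rewrite mulrAC ler_pdivlMr // in hc2.
rewrite e1 e2 -subr_ge0.
have -> : t * ((1 + gap Dl) / 2 * qf G u + (1 - gap Dl) / 2 * qf G w) -
    th * t * (qf G u + qf G w) =
  t * (((1 + gap Dl) / 2 - th) * qf G u - qf G w * (th - (1 - gap Dl) / 2)) by ring.
by rewrite mulr_ge0 ?subr_ge0 // ltW.
Qed.

Lemma axis_cone_int v : th * t * qf G v < qf P v -> exists u w,
  [/\ v = u + w, u \in row_line B, (forall u', u' \in row_line B -> gperp u' w) &
    Num.sqrt (qf G w) < aperture Dl * Num.sqrt (qf G u)].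
Proof.
have [u [w [-> uL hw]]] := axis_decomp v => hv; exists u, w; split => //.
have [e1 e2] := axis_form uL hw; rewrite -(@ltr_pXn2r _ 2%N) ?nnegrE ?mulr_ge0 ?sqrtr_ge0 //.
have q0 : 0 <= ((1 + gap Dl) / 2 - th) / (th - (1 - gap Dl) / 2).
  by rewrite divr_ge0 // ltW.
rewrite exprMn !sqr_sqrtr ?Gp // mulrAC ltr_pdivlMr //.
rewrite -subr_gt0 -(pmulr_rgt0 _ t0).
move: hv; rewrite e1 e2 -subr_gt0; congr (is_true (0 < _)); ring.
Qed.

End Spectral.
End Axis.

(** * The cone field of expanded vectors *)

Section AxisContinuity.
Context {R : realType}.

(** The axis is intrinsic: it follows the changes of coordinates. *)
Lemma axis_mx_congr (X G P : 'M[R]_2) : X \in unitmx -> G \in unitmx ->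
  X *m axis_mx G P = axis_mx (X *m G *m X^T) (X *m P *m X^T) *m X.
Proof.
move=> Xu Gu; rewrite /axis_mx trace_congr // det_congr //.
set t := \tr _; set s := (_ / 2).
have Xtu : X^T \in unitmx by rewrite unitmx_tr.
have u : (X *m G *m X^T) \in unitmx by rewrite !unitmx_mul Xu Gu Xtu.
have e : X *m P *m X^T *m invmx (X *m G *m X^T) *m X = X *m (P *m invmx G).
  have -> : X *m P *m X^T = X *m (P *m invmx G) *m invmx X *m (X *m G *m X^T).
    by rewrite !mulmxA mulmxKV // mulmxKV.
  by rewrite mulmxK // mulmxKV.
rewrite mulmxBr mulmxBl -scalemxAr -scalemxAl e.
by rewrite mul_scalar_mx mul_mx_scalar.
Qed.

Section Cvg.
Context (T : Type) (F : set_system T) {FF : Filter F}.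

Lemma cvg_gap (f : T -> R) (x : R) : f @ F --> x -> (fun t => gap (f t)) @ F --> gap x.
Proof.
move=> fx.
have cc (y : R) : (fun _ : T => y) @ F --> y by exact: (@cvg_cst _ y _ F _).
have h : (fun t => 1 - 4 * f t) @ F --> 1 - 4 * x.
  by apply: cvgB => //; apply: cvgM.
exact: (@cvg_comp _ _ _ (fun t => 1 - 4 * f t) (@Num.sqrt R) F _ _ h (@sqrt_continuous R _)).
Qed.

Lemma cvg_sqr (f : T -> R) (x : R) : f @ F --> x -> (fun t => f t ^+ 2) @ F --> x ^+ 2.
Proof.
move=> fx; have -> : (fun t => f t ^+ 2) = f \* f by apply/funext => t; rewrite expr2.
by rewrite expr2; exact: cvgM.
Qed.

Lemma cvg_axis_mx (G P : T -> 'M[R]_2) (G0 P0 : 'M[R]_2) :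
  (\forall t \near F, G t \in unitmx) -> G0 \in unitmx ->
  \tr (P0 *m invmx G0) != 0 -> G @ F --> G0 -> P @ F --> P0 ->
  (fun t => axis_mx (G t) (P t)) @ F --> axis_mx G0 P0.
Proof.
move=> Gu G0u tr0 cG cP.
have ci : (fun t => invmx (G t)) @ F --> invmx G0 by exact: cvg_invmx2.
have cPi : (fun t => P t *m invmx (G t)) @ F --> P0 *m invmx G0 by exact: (cvg_mulmx cP ci).
have ct : (fun t => \tr (P t *m invmx (G t))) @ F --> \tr (P0 *m invmx G0).
  exact: (cvg_trace2 cPi).
have d0 : \det G0 != 0 by move: G0u; rewrite unitmxE unitfE.
have cD : (fun t => \det (P t) / \det (G t) / \tr (P t *m invmx (G t)) ^+ 2) @ F -->
    \det P0 / \det G0 / \tr (P0 *m invmx G0) ^+ 2.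
  have cP' : (fun t => \det (P t)) @ F --> \det P0 by exact: cvg_det2.
  have cG0 : (fun t => \det (G t)) @ F --> \det G0 by exact: cvg_det2.
  have cG' : (fun t => (\det (G t))^-1) @ F --> (\det G0)^-1 by exact: cvgV.
  have ct2 : (fun t => \tr (P t *m invmx (G t)) ^+ 2) @ F --> \tr (P0 *m invmx G0) ^+ 2.
    exact: (cvg_sqr ct).
  have tr2 : \tr (P0 *m invmx G0) ^+ 2 != 0 by rewrite expf_neq0.
  exact: (cvgM (cvgM cP' cG') (cvgV tr2 ct2)).
have cg : (fun t => gap (\det (P t) / \det (G t) / \tr (P t *m invmx (G t)) ^+ 2)) @ F -->
    gap (\det P0 / \det G0 / \tr (P0 *m invmx G0) ^+ 2).
  exact: (cvg_gap cD).
have cc (y : R) : (fun _ : T => y) @ F --> y by exact: (@cvg_cst _ y _ F _).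
have cs : (fun t => (1 - gap (\det (P t) / \det (G t) / \tr (P t *m invmx (G t)) ^+ 2)) / 2) @ F -->
  (1 - gap (\det P0 / \det G0 / \tr (P0 *m invmx G0) ^+ 2)) / 2.
  by apply: cvgM => //; apply: cvgB.
have cti : (fun t => (\tr (P t *m invmx (G t)))^-1) @ F --> (\tr (P0 *m invmx G0))^-1.
  exact: cvgV.
apply/cvg_mxP => i j.
move: cPi => /cvg_mxP/(_ i j) cPij.
have E (A B : 'M[R]_2) : axis_mx A B i j = (\tr (B *m invmx A))^-1 * (B *m invmx A) i j -
   ((1 - gap (\det B / \det A / \tr (B *m invmx A) ^+ 2)) / 2) *+ (i == j).
  by rewrite /axis_mx mxE [X in X + _]mxE [X in _ + X]mxE [X in _ - X]mxE.
rewrite E; under eq_fun do rewrite E.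
apply: cvgB; first exact: (cvgM cti cPij).
case: (i == j); first exact: cs.
exact: (cc 0).
Qed.

End Cvg.
End AxisContinuity.

Section ConeField.
Context {R : realType} {M : closed_surface R} (g : riemannian_metric M).
Variables (f : M -> M) (Cf : C1_map f) (N k : nat) (th c : R).
Hypotheses (k1 : (1 <= k)%N) (th0 : 0 < th) (th8 : th <= 1 / 8) (c0 : 0 < c).
Let hN := iter N f.
Let CN : C1_map hN := C1_iter N Cf.
Hypothesis F0 : forall x, 0 < expansion g hN x.
Hypothesis areaH : forall x, area g hN x <= (th - th ^+ 2) / 2 * expansion g hN x ^+ 2.
Hypothesis coneH : forall x (v : 'rV[R]_2),
  th * expansion g hN x * qf (g x) v <= qf (pull g hN x) v ->
  2 * th * expansion g hN (iter k f x) * qf (pull g (iter k f) x) v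
    <= qf (pull g (iter (k + N) f) x) v /\
  c * qf (g x) v <= qf (pull g (iter k f) x) v.

Let ratio x : R := area g hN x / expansion g hN x ^+ 2.
Let ratioH x : ratio x <= (th - th ^+ 2) / 2.
Proof. by rewrite /ratio ler_pdivrMr ?areaH // exprn_gt0. Qed.

Let gs x : (g x)^T = g x. Proof. exact: Defs.metric_sym. Qed.
Let ps x : (pull g hN x)^T = pull g hN x.
Proof. by rewrite /pull !trmx_mul trmxK gs mulmxA. Qed.

Definition field_axis x : {vspace 'rV[R]_2} := row_line (axis_mx (g x) (pull g hN x)).

Let axis0 x : axis_mx (g x) (pull g hN x) != 0.
Proof. exact: (axis_neq0 (F0 x) th0 th8 (ratioH x)). Qed.

Let axisdet x : \det (axis_mx (g x) (pull g hN x)) = 0.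
Proof. exact: (axis_det (F0 x) th0 th8 (ratioH x)). Qed.

Lemma field_axis_dim x : \dim (field_axis x) = 1%N.
Proof. exact: row_line_dim (axis0 x). Qed.

(** Near [x], a fixed combination [e] of the rows of the axis matrix, written in
    a chart, does not vanish and spans the axis. *)
Lemma field_axis_continuous : continuous_line_field field_axis.
Proof.
move=> x; pose a := chart_at x.
have aa : atlas a by exact: chart_at_atlas.
have ax : chart_dom a x by exact: chart_at_dom.
pose BB y := axis_mx (in_frame a g y) (in_frame a (pull g hN) y).
have cB y : chart_dom a y -> BB @ y --> BB y.
  move=> ay; apply: cvg_axis_mx.
  - by apply: filterS (near_dom ay) => z az; exact: in_frame_unit.
  - exact: in_frame_unit.
  - by rewrite -(expansion_in_frame g hN aa ay) gt_eqF.
  - exact: gram_cont.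
  - exact: pull_cont.
have EB y : chart_dom a y -> chart_frame a y *m axis_mx (g y) (pull g hN y) =
    BB y *m chart_frame a y.
  move=> ay; exact: (axis_mx_congr _ (frame_unit aa ay) (metric_unit g y)).
have BB0 : BB x != 0.
  apply: contra (axis0 x) => /eqP e; have := EB x ax; rewrite e mul0mx => h.
  by rewrite -(mulKmx (frame_unit aa ax) (axis_mx _ _)) h mulmx0.
have [e he] : exists e : 'rV[R]_2, e *m BB x != 0.
  apply: contrapT => h; move/eqP: BB0; apply; apply/row_matrixP => i.
  rewrite row0 rowE; apply: contrapT => h'; apply: h.
  by exists (delta_mx 0 i); apply/eqP.
exists a, (fun y => e *m BB y); split; first exact: aa.
have cu y : chart_dom a y -> (fun y => e *m BB y) @ y --> e *m BB y.
  move=> ay.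
  have ce : (fun _ : M => e) @ y --> e by exact: (@cvg_cst _ e _ (nbhs y) _).
  exact: (cvg_mulmx ce (cB y ay)).
have nz : \forall y \near x, e *m BB y != 0.
  exact: (cvgr_neq0 _ (cu x ax) he).
apply: filterS2 (near_dom ax) nz => y ay ny; split; [exact: ay|exact: (cu y ay)|].
have E : e *m BB y *m chart_frame a y =
   (e *m chart_frame a y) *m axis_mx (g y) (pull g hN y).
  rewrite -[RHS]mulmxA (EB y ay) mulmxA.
  by [].
rewrite E; apply: (row_line_span (axis0 y) (axisdet y)).
rewrite -E; apply: contra ny => /eqP e0.
by rewrite -(mulmxK (frame_unit aa ay) (e *m BB y)) e0 mul0mx.
Qed.

Lemma field_aperture_continuous : continuous (fun x => aperture th (ratio x)).
Proof.
move=> x.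
have cc (y : R) : (fun _ : M => y) @ x --> y by exact: (@cvg_cst _ y _ (nbhs x) _).
have ce : expansion g hN @ x --> expansion g hN x by exact: (expansion_cont CN).
have ca : area g hN @ x --> area g hN x by exact: (area_cont CN).
have ce2 : (fun y => expansion g hN y ^+ 2) @ x --> expansion g hN x ^+ 2 by exact: cvg_sqr.
have e0 : expansion g hN x ^+ 2 != 0 by rewrite expf_neq0 // gt_eqF.
have cr : ratio @ x --> ratio x by exact: (cvgM ca (cvgV e0 ce2)).
have cg : (fun y => gap (ratio y)) @ x --> gap (ratio x) by exact: cvg_gap.
have [_ _ num0 den0] := gapP th0 th8 (ratioH x).
have den1 : th - (1 - gap (ratio x)) / 2 != 0 by rewrite gt_eqF.
have cn : (fun y => (1 + gap (ratio y)) / 2 - th) @ x --> (1 + gap (ratio x)) / 2 - th.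
  exact: (cvgB (cvgM (cvgD (cc 1) cg) (cc 2^-1)) (cc th)).
have cd : (fun y => th - (1 - gap (ratio y)) / 2) @ x --> th - (1 - gap (ratio x)) / 2.
  exact: (cvgB (cc th) (cvgM (cvgB (cc 1) cg) (cc 2^-1))).
exact: (@cvg_comp _ _ _ _ (@Num.sqrt R) (nbhs x) _ _ (cvgM cn (cvgV den1 cd)) (@sqrt_continuous R _)).
Qed.

Lemma field_aperture_gt0 x : 0 < aperture th (ratio x).
Proof. exact: (aperture_gt0 th0 th8 (ratioH x)). Qed.

Definition expanded_cones : cone_field M :=
  ConeField field_axis_dim field_aperture_gt0 field_axis_continuous
    field_aperture_continuous.

(** The vectors stretched by [f^N] at least like [th]. *)
Let good x (v : 'rV[R]_2) := th * expansion g hN x * qf (g x) v <= qf (pull g hN x) v.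

Lemma cone_good x v : @cone R M g expanded_cones x v -> good x v.
Proof.
move=> [u [w [e uL hw hc]]].
exact: (axis_cone (gs x) (metric_unit g x) (ps x) (metric_qf_ge0 g x) (F0 x) th0 th8 (ratioH x) e uL hw hc).
Qed.

Lemma good_cone_int x v : th * expansion g hN x * qf (g x) v < qf (pull g hN x) v ->
  @cone_int R M g expanded_cones x v.
Proof.
move=> h; left.
exact: (axis_cone_int (gs x) (metric_unit g x) (ps x) (metric_qf_ge0 g x) (F0 x) th0 th8 (ratioH x) h).
Qed.

Lemma good_step x v : good x v -> v != 0 ->
  let v' := v *m tderiv (iter k f) x in
  v' != 0 /\ th * expansion g hN (iter k f x) * qf (g (iter k f x)) v' <
     qf (pull g hN (iter k f x)) v'.
Proof.
move=> hv v0 v'; have [h1 h2] := coneH hv.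
have qk : qf (pull g (iter k f) x) v = qf (g (iter k f x)) v' by exact: pull_qf.
have qkN : qf (pull g (iter (k + N) f) x) v = qf (pull g hN (iter k f x)) v'.
  apply: (etrans (pull_qf g (iter (k + N) f) x v)).
  have e2 : iter (k + N) f x = hN (iter k f x) by rewrite addnC iterD.
  rewrite (tderiv_iterD k N x Cf) e2 mulmxA.
  exact: (esym (pull_qf g hN (iter k f x) v')).
have q0 : 0 < qf (g (iter k f x)) v'.
  by rewrite -qk; apply: lt_le_trans h2; rewrite mulr_gt0 // metric_qf_gt0.
split; first by apply/eqP => e; rewrite e qf0 ltxx in q0.
rewrite -qkN; apply: lt_le_trans h1; rewrite qk.
rewrite (ltr_pM2r q0) (ltr_pM2r (F0 _)).
by rewrite -[ltLHS]mul1r (ltr_pM2r th0) ltr1n.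
Qed.

(** Stretched vectors stay stretched and non-zero under [f^k], hence under all
    iterates; a vector of a cone killed by [f^n] would be killed by
    [f^(n k)]. *)
Lemma dominated_splitting_from_cones : dominated_splitting g f.
Proof.
exists expanded_cones; split.
  exists k; split => // x _ [v hv <-].
  have [->|v0] := eqVneq v 0; first by rewrite mul0mx; right.
  by apply: good_cone_int; case: (good_step (cone_good hv) v0).
move=> x n n1; apply/seteqP; split => [v [vk hv]|v ->]; last first.
  split; first exact: mul0mx.
  exists 0, 0; split; [by rewrite addr0|exact: mem0v| |].
    by move=> u _; rewrite /inner trmx0 mulmx0 mxE.
  by rewrite /tnorm /inner mul0mx mul0mx mxE sqrtr0 mulr0.
apply: contrapT => /eqP v0.
have iterk m : good (iter (m * k) f x) (v *m tderiv (iter (m * k) f) x) /\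
    v *m tderiv (iter (m * k) f) x != 0.
  elim: m => [|m [IH1 IH2]].
    by rewrite mul0n /= tderiv_id mulmx1; split => //; exact: cone_good.
  have [h1 h2] := good_step IH1 IH2.
  have e : (m.+1 * k = m * k + k)%N by rewrite mulSn addnC.
  have e2 : iter (m * k + k) f x = iter k f (iter (m * k) f x) by rewrite addnC iterD.
  rewrite e e2 (tderiv_iterD (m * k) k x Cf) mulmxA.
  exact: (conj (ltW h2) h1).
have [_ /negP] := iterk n; case.
have -> : (n * k = n + n * k.-1)%N by rewrite -mulnS prednK.
rewrite (tderiv_iterD n (n * k.-1) x Cf) mulmxA.
have -> : v *m tderiv (iter n f) x = 0 by exact: vk.
by rewrite mul0mx.
Qed.

End ConeField.

(** * A compactly supported perturbation with prescribed derivative *)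

Section Kick.
Context {R : realType}.
Implicit Types (q w v : 'rV[R]_2) (D : 'M[R]_2).

(** The positive part, whose square is of class C^1 with a Lipschitz
    derivative. *)
Definition pos (t : R) : R := (t + `|t|) / 2.

Lemma posE t : pos t = if 0 <= t then t else 0.
Proof.
rewrite /pos; case: ifP => h; first by rewrite ger0_norm //; field.
by rewrite ltr0_norm ?subrr ?mul0r // ltNge h.
Qed.

Lemma pos_ge0 t : 0 <= pos t.
Proof. by rewrite posE; case: ifP. Qed.

Lemma pos_le1 t : t <= 1 -> pos t <= 1.
Proof. by rewrite posE; case: ifP. Qed.

Lemma pos_eq0 t : t <= 0 -> pos t = 0.
Proof. by move=> h; rewrite /pos ler0_norm // subrr mul0r. Qed.

Lemma pos_sqr_err a b : `|pos b ^+ 2 - pos a ^+ 2 - 2 * pos a * (b - a)| <= (b - a) ^+ 2.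
Proof.
rewrite !posE !expr2; case: (leP 0 a) => ha; case: (leP 0 b) => hb.
- have -> : b * b - a * a - 2 * a * (b - a) = (b - a) * (b - a) by ring.
  by rewrite ger0_norm // -expr2 sqr_ge0.
- rewrite ler_norml; apply/andP; split; nra.
- rewrite ler_norml; apply/andP; split; nra.
- by rewrite !mulr0 mul0r subr0 subrr normr0 -expr2 sqr_ge0.
Qed.

Lemma pos_sqr_lip a b : a <= 1 -> b <= 1 -> `|pos b ^+ 2 - pos a ^+ 2| <= 2 * `|b - a|.
Proof.
move=> a1 b1.
have pa := pos_le1 a1; have pb := pos_le1 b1.
have lip : `|pos b - pos a| <= `|b - a|.
  rewrite !posE; case: (leP 0 a) => ha; case: (leP 0 b) => hb //.
  - by rewrite sub0r normrN [leRHS]distrC !ger0_norm //; lra.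
  - by rewrite subr0 !ger0_norm //; lra.
  - by rewrite subrr normr0.
rewrite subr_sqr normrM mulrC ler_pM //.
rewrite ger0_norm ?addr_ge0 ?pos_ge0 //; lra.
Qed.

Lemma dot_le q w : `|dot q w| <= 2 * (`|q| * `|w|).
Proof.
rewrite dotE; apply: le_trans (ler_normD _ _) _; rewrite !normrM.
have h i : `|q 0 i| * `|w 0 i| <= `|q| * `|w|.
  by rewrite ler_pM // mx_entry_le.
by have := h 0; have := h 1; lra.
Qed.

Lemma norm_mulmx_le m (A : 'M[R]_(m.+1, 2)) D : `|A *m D| <= 2 * (`|A| * `|D|).
Proof.
apply: mx_norm_le => [|i j]; first by rewrite mulr_ge0 // mulr_ge0.
rewrite mulmx2E; apply: le_trans (ler_normD _ _) _; rewrite !normrM.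
have h l : `|A i l| * `|D l j| <= `|A| * `|D|.
  by rewrite ler_pM // mx_entry_le.
by have := h 0; have := h 1; lra.
Qed.

Lemma norm_outer_le q w : `|q^T *m w| <= `|q| * `|w|.
Proof.
apply: mx_norm_le => [|i j]; first by rewrite mulr_ge0.
by rewrite mxE big_ord1 mxE normrM ler_pM // mx_entry_le.
Qed.

Lemma sqr_norm_le_dot q : `|q| ^+ 2 <= dot q q.
Proof.
have h i : `|q 0 i| ^+ 2 <= dot q q.
  rewrite real_normK ?num_real // dotE.
  have := sqr_ge0 (q 0 0); have := sqr_ge0 (q 0 1).
  by case: (ord2P i) => -> h1 h2; rewrite expr2 in h1 h2 *; lra.
have d0 := dot_ge0 q.
have : `|q| <= Num.sqrt (dot q q).
  apply: mx_norm_le => [|i j]; first exact: sqrtr_ge0.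
  rewrite (ord1 i) -(@ler_pXn2r _ 2%N) ?nnegrE ?sqrtr_ge0 //.
  by rewrite [leRHS]sqr_sqrtr // h.
by rewrite -(@ler_pXn2r _ 2%N) ?nnegrE ?sqrtr_ge0 // sqr_sqrtr.
Qed.

Variables (r : R) (D : 'M[R]_2).
Hypothesis r0 : 0 < r.

Let s q := 1 - dot q q / r ^+ 2.

Definition bump q : R := pos (1 - dot q q / r ^+ 2) ^+ 2.
(** The map [q |-> q *m D] cut off outside of the disc of radius [r]. The size of
    its derivative does not depend on [r]: on the support, the derivative of
    [bump], of order [1 / r], multiplies [q *m D], of order [r]. *)
Definition kick q : 'rV[R]_2 := bump q *: (q *m D).
Definition kickJ q : 'M[R]_2 := bump q *: D +
  (- 4 * pos (1 - dot q q / r ^+ 2) / r ^+ 2) *: (q^T *m (q *m D)).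

Let r2 : 0 < r ^+ 2. Proof. by rewrite exprn_gt0. Qed.

Let s_le1 q : s q <= 1.
Proof. by rewrite /s gerBl divr_ge0 ?dot_ge0 // ltW. Qed.

(** The error of the first order expansion is quadratic in [w]. *)
Lemma kick_diff q : differentiable kick q /\ 'J kick q = kickJ q.
Proof.
apply: diffJP => e e0.
pose K1 := (4 * `|q| + 2) / r ^+ 2.
have q0 : 0 <= `|q| by [].
have D0 : 0 <= `|D| by [].
have K10 : 0 <= K1 by rewrite divr_ge0 ?ltW //; lra.
have ir : 0 <= (r ^+ 2)^-1 by rewrite invr_ge0 ltW.
pose K := (K1 ^+ 2 + 4 / r ^+ 2) * (2 * (`|q| * `|D|)) + 2 * K1 * (2 * `|D|) + 1.
have K0 : 0 < K.
  by rewrite ltr_wpDl // addr_ge0 // !mulr_ge0 ?addr_ge0 ?sqr_ge0 // ?mulr_ge0 // divr_ge0 // ltW.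
have near_w : \forall w \near (0 : 'rV[R]_2), `|w| < Num.min 1 (e / K).
  have m0 : 0 < Num.min 1 (e / K) by rewrite lt_min ltr01 divr_gt0.
  by have := @nbhs0_lt R 'rV[R]_2 _ m0.
apply: filterS near_w => w; rewrite lt_min => /andP[w1 we].
have n0 : 0 <= `|w| by [].
pose tau := s (w + q) - s q.
have tauE : tau = - (2 * dot q w + dot w w) / r ^+ 2.
  by rewrite /tau /s !dotE !mxE; field; rewrite gt_eqF.
have tau_le : `|tau| <= K1 * `|w|.
  rewrite tauE normrM normrN [`|_^-1|]ger0_norm // /K1 mulrAC ler_wpM2r //.
  apply: le_trans (ler_normD _ _) _; rewrite normrM ger0_norm //.
  have := dot_le q w; have := dot_le w w; nra.
have main : kick (w + q) - kick q - w *m kickJ q =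
   (bump (w + q) - bump q - (2 * pos (s q) * (- (2 * dot q w) / r ^+ 2))) *: (q *m D) +
   (bump (w + q) - bump q) *: (w *m D).
  rewrite /kick /kickJ mulmxDr -!scalemxAr mul_outer mulmxDl.
  rewrite [dot w q](_ : _ = dot q w); last by rewrite dotC.
  rewrite -/(s q).
  move: (bump (w + q)) (bump q) (pos (s q)) (dot q w) (q *m D) (w *m D) => *.
  by apply/rv2P; rewrite !mxE; ring.
rewrite main.
have h1 : `|bump (w + q) - bump q - (2 * pos (s q) * (- (2 * dot q w) / r ^+ 2))| <=
   (K1 ^+ 2 + 4 / r ^+ 2) * `|w| ^+ 2.
  have -> : bump (w + q) - bump q - (2 * pos (s q) * (- (2 * dot q w) / r ^+ 2)) =
     (pos (s (w + q)) ^+ 2 - pos (s q) ^+ 2 - 2 * pos (s q) * tau) -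
       2 * pos (s q) * (dot w w / r ^+ 2).
    by rewrite tauE /bump -/(s q) -/(s (w + q)); ring.
  apply: le_trans (ler_normB _ _) _.
  have e1 := pos_sqr_err (s q) (s (w + q)).
  have e2 : tau ^+ 2 <= K1 ^+ 2 * `|w| ^+ 2.
    by rewrite -exprMn -[leLHS]real_normK ?num_real // ler_pXn2r ?nnegrE // mulr_ge0.
  have e3 : `|2 * pos (s q) * (dot w w / r ^+ 2)| <= 4 / r ^+ 2 * `|w| ^+ 2.
    rewrite mulrA normrM [`|_^-1|]ger0_norm // [4 / _ * _]mulrAC ler_wpM2r //.
    have p1 := pos_le1 (s_le1 q); have p0 := pos_ge0 (s q).
    have d1 := dot_le w w; move: (pos (s q)) p0 p1 => t p0 p1.
    rewrite !normrM (ger0_norm p0) ger0_norm // -mulrA.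
    have : t * `|dot w w| <= 1 * (2 * (`|w| * `|w|)) by rewrite ler_pM.
    by rewrite expr2; lra.
  by have := le_trans e1 e2; lra.
have h2 : `|bump (w + q) - bump q| <= 2 * (K1 * `|w|).
  apply: le_trans (pos_sqr_lip (s_le1 q) (s_le1 (w + q))) _.
  by rewrite ler_wpM2l.
apply: le_trans (ler_normD _ _) _; rewrite !normrZ.
have h3 := norm_mulmx_le q D; have h4 := norm_mulmx_le w D.
have h5 := ler_pM (normr_ge0 _) (normr_ge0 _) h1 h3.
have h6 := ler_pM (normr_ge0 _) (normr_ge0 _) h2 h4.
apply: (@le_trans _ _ (K * `|w| * `|w|)).
  apply: le_trans (lerD h5 h6) _.
  have -> : (K1 ^+ 2 + 4 / r ^+ 2) * `|w| ^+ 2 * (2 * (`|q| * `|D|)) +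
     2 * (K1 * `|w|) * (2 * (`|w| * `|D|)) = (K - 1) * `|w| * `|w|.
    by rewrite /K; ring.
  by rewrite ler_wpM2r // ler_wpM2r // gerBl.
by rewrite ler_wpM2r // mulrC -ler_pdivlMr // ltW.
Qed.

Lemma kickJ_cont : continuous kickJ.
Proof.
move=> q.
have cc (x : R) : (fun _ : 'rV[R]_2 => x) @ q --> x by exact: (@cvg_cst _ x _ (nbhs q) _).
have ci : (id : 'rV[R]_2 -> 'rV[R]_2) @ q --> q by exact: cvg_id.
have cD : (fun _ : 'rV[R]_2 => D) @ q --> D by exact: (@cvg_cst _ D _ (nbhs q) _).
have cx (i : 'I_2) : (fun v : 'rV[R]_2 => v 0 i) @ q --> q 0 i by exact: coord_continuous.
have cd : (fun v => dot v v) @ q --> dot q q.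
  rewrite dotE; under eq_fun do rewrite dotE.
  exact: (cvgD (cvgM (cx 0) (cx 0)) (cvgM (cx 1) (cx 1))).
have cs : s @ q --> s q by exact: (cvgB (cc 1) (cvgM cd (cc _))).
have cp : (fun v => pos (s v)) @ q --> pos (s q).
  exact: (cvgM (cvgD cs (cvg_norm cs)) (cc _)).
have cb : bump @ q --> bump q.
  rewrite /bump expr2; under eq_fun do rewrite expr2.
  exact: (cvgM cp cp).
have cqD : (fun v : 'rV[R]_2 => v *m D) @ q --> q *m D by exact: (cvg_mulmx ci cD).
have cqt : (fun v : 'rV[R]_2 => v^T) @ q --> q^T by exact: (cvg_trmx ci).
have co : (fun v : 'rV[R]_2 => v^T *m (v *m D)) @ q --> q^T *m (q *m D).
  apply/(@cvg_mxP _ _ (nbhs q) _) => i j.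
  have E v : (v^T *m (v *m D)) i j = v 0 i * (v *m D) 0 j by rewrite mxE big_ord1 mxE.
  rewrite E; under eq_fun do rewrite E.
  by move/(@cvg_mxP _ _ (nbhs q) _)/(_ 0 j): cqD => h; exact: (cvgM (cx i) h).
exact: (cvgD (cvgZ cb cD) (cvgZ (cvgM (cvgM (cc _) cp) (cc _)) co)).
Qed.

Lemma kick_outside q : r <= `|q| -> kick q = 0.
Proof.
move=> rq; rewrite /kick /bump pos_eq0 ?expr0n ?scale0r //.
rewrite subr_le0 ler_pdivlMr // mul1r.
by apply: le_trans (sqr_norm_le_dot q); rewrite ler_pXn2r ?nnegrE // ltW.
Qed.

Let bump_bounds q : 0 <= bump q <= 1.
Proof.
rewrite /bump sqr_ge0 /= expr_le1 ?pos_ge0 //.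
exact: pos_le1 (s_le1 q).
Qed.

Lemma kick_le q : `|kick q| <= 2 * r * `|D|.
Proof.
case: (leP r `|q|) => rq.
  by rewrite kick_outside // normr0 !mulr_ge0 // ltW.
have /andP[b0 b1] := bump_bounds q.
rewrite /kick normrZ ger0_norm //.
apply: (@le_trans _ _ (1 * (2 * (`|q| * `|D|)))).
  by rewrite ler_pM // norm_mulmx_le.
by rewrite mul1r -mulrA ler_wpM2l // ler_wpM2r // ltW.
Qed.

Lemma kickJ_le q : `|kickJ q| <= 9 * `|D|.
Proof.
have /andP[b0 b1] := bump_bounds q.
have p1 := pos_le1 (s_le1 q); have p0 := pos_ge0 (s q).
apply: le_trans (ler_normD _ _) _.
rewrite (normrZ (bump q) D) (normrZ _ (q^T *m (q *m D))) (ger0_norm b0).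
have h1 : bump q * `|D| <= `|D| by rewrite ler_piMl.
suff h2 : `|- 4 * pos (s q) / r ^+ 2| * `|q^T *m (q *m D)| <= 8 * `|D|.
  by rewrite /s in h2; lra.
case: (leP r `|q|) => rq.
  have -> : pos (s q) = 0.
    apply: pos_eq0; rewrite subr_le0 ler_pdivlMr // mul1r.
    by apply: le_trans (sqr_norm_le_dot q); rewrite ler_pXn2r ?nnegrE // ltW.
  by rewrite mulr0 mul0r normr0 mul0r mulr_ge0.
have ir : 0 <= (r ^+ 2)^-1 by rewrite invr_ge0 ltW.
have -> : `|- 4 * pos (s q) / r ^+ 2| = 4 * pos (s q) / r ^+ 2.
  rewrite !mulNr normrN ger0_norm //.
  by apply: mulr_ge0 => //; apply: mulr_ge0.
have h3 : `|q^T *m (q *m D)| <= `|q| * (2 * (`|q| * `|D|)).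
  apply: le_trans (norm_outer_le _ _) _.
  by rewrite ler_wpM2l // norm_mulmx_le.
have h4 : `|q| * (2 * (`|q| * `|D|)) <= r * (2 * (r * `|D|)).
  have rq' := ltW rq.
  by rewrite ler_pM ?mulr_ge0 // ler_wpM2l // ler_wpM2r.
apply: (@le_trans _ _ (4 * 1 / r ^+ 2 * (r * (2 * (r * `|D|))))).
  apply: ler_pM => //; last exact: le_trans h3 h4.
    by apply: mulr_ge0 => //; apply: mulr_ge0.
  by rewrite ler_wpM2r // ler_wpM2l.
by have -> : 4 * 1 / r ^+ 2 * (r * (2 * (r * `|D|))) = 8 * `|D|; [field; rewrite gt_eqF|exact: lexx].
Qed.

Lemma kick0 : kick 0 = 0. Proof. by rewrite /kick mul0mx scaler0. Qed.

Lemma kickJ0 : kickJ 0 = D.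
Proof.
rewrite /kickJ mul0mx mulmx0 scaler0 addr0 /bump.
by rewrite dotE !mxE !mul0r addr0 mul0r subr0 posE ler01 expr1n scale1r.
Qed.

End Kick.

(** * The C^1 topology through germs *)

Section C1Topology.
Context {R : realType} {M : closed_surface R}.
Implicit Types (a b : chart R M) (f h : End1 M) (x y : M).

Lemma nbhs_End1 f (U : set (End1 M)) :
  nbhs f U -> exists D : seq (set (End1 M)), [/\ forall B, B \in D -> C1_subbasic B,
    (forall B, B \in D -> B f) & forall h, (forall B, B \in D -> B h) -> U h].
Proof.
rewrite nbhsE => -[B [Bo Bf] BU].
have : exists2 A, finI_from (@C1_subbasic R M) id A & A f /\ A `<=` B.
  move: Bo => [D' HD' E].
  rewrite -E in Bf; case: Bf => A DA Af; exists A; first exact: HD'.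
  by split => // h Ah; rewrite -E; exists A.
move=> [A [D HD AE] [Af AB]]; exists (finmap.enum_fset D); split.
- by move=> C /HD /set_mem.
- by move=> C CD; rewrite -AE in Af; exact: Af.
- by move=> h Hh; apply: BU; apply: AB; rewrite -AE => C; exact: Hh.
Qed.

Lemma Jc_germ a b (f h : M -> M) x : chart_dom a x ->
  (\forall y \near x, f y = h y) ->
  differentiable (in_charts a b f) (chart_fun a x) -> Jc a b h x = Jc a b f x.
Proof.
move=> ax fh df.
have E : \forall p \near chart_fun a x, in_charts a b f p = in_charts a b h p.
  by apply: filterS (near_chart ax fh) => p fp; rewrite /in_charts fp.
exact: (diffJ_near E df).2.
Qed.

(** A condition [W h y] on the germ of [h] at [y] that holds, uniformly for [y]
    near any given point, for the maps whose 1-jet at [y] is close to that of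
    [f]. Unlike membership in a neighbourhood of [f], it can be checked point by
    point on a map glued from several others. *)
Definition germ_condition (f : End1 M) (W : End1 M -> M -> Prop) :=
  (forall h h' y, (\forall z \near y, h z = h' z) -> W h y -> W h' y) /\
  (forall x a b, atlas a -> atlas b -> chart_dom a x -> chart_dom b (f x) ->
     exists2 e : R, 0 < e & \forall y \near x, forall h : End1 M,
       chart_dom b (h y) -> `|chart_fun b (h y) - chart_fun b (f y)| < e ->
       `|Jc a b h y - Jc a b f y| < e -> W h y).

(** A subbasic set is defined by a condition on the 1-jet at the points of a
    compact set [K]. Near a point outside of [K] there is nothing to check; near
    a point of [K] the condition is open in the point, in the value of the map
    and in its derivative, all read in the charts [a] and [b]. *)
Lemma subbasic_germ f B : C1_subbasic B -> B f -> exists W,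
  germ_condition f W /\ forall h, (forall y, W h y) -> B h.
Proof.
move=> [f0 [a0 [b0 [K [e [[aa0 ab0] cK [Ka Kb] e0 BE]]]]]] Bf.
pose W (h : End1 M) (y : M) := K y -> [/\ chart_dom b0 (h y),
   `|chart_fun b0 (h y) - chart_fun b0 (f0 y)| < e &
   `|Jc a0 b0 h y - Jc a0 b0 f0 y| < e].
have Bh h : (forall y, W h y) -> B h by move=> Wh; rewrite BE => x Kx; exact: Wh.
have Wf y : W f y by move: Bf; rewrite BE => H; exact: H.
exists W; split; last exact: Bh.
split.
  move=> h h' y hh' Wh Ky; have [w1 w2 w3] := Wh Ky.
  have e1 : h y = h' y by exact: (nbhs_singleton hh').
  have [dh _] := C1_diff (endoP h) aa0 ab0 (Ka _ Ky) w1.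
  have e2 := Jc_germ (Ka _ Ky) hh' dh.
  split.
  - exact: (eq_ind _ (fun z => chart_dom b0 z) w1 _ e1).
  - exact: (eq_ind _ (fun z => `|chart_fun b0 z - chart_fun b0 (f0 y)| < e) w2 _ e1).
  - exact: (eq_ind _ (fun J => `|J - Jc a0 b0 f0 y| < e) w3 _ (esym e2)).
move=> x a b aa ab ax bx.
have [Kx|nKx] := pselect (K x); last first.
  exists 1 => //.
  have : \forall y \near x, ~ K y.
    apply: open_nbhs_nbhs; split => //; apply: closed_openC.
    exact: (compact_closed (@surface_hausdorff R M) cK).
  by apply: filterS => y nKy h _ _ _ Ky.
have [d1 n1 j1] := Wf x Kx.
have d0 : chart_dom b0 (f0 x) by apply: Kb; exists x.
have a0x := Ka _ Kx.
pose q0 := chart_fun b (f x).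
have bq0 : chart_img b q0 by exact: chart_funP.
have q0K : chart_inv b q0 = f x by exact: chart_funK.
pose A0 := Jc a b f x.
pose F := filter_prod (filter_prod (nbhs x) (nbhs q0)) (nbhs A0).
have c1 : (fun z : M * 'rV[R]_2 * 'M[R]_2 => z.1.1) @ F --> x.
  exact: (@cvg_comp _ _ _ fst fst F _ _ cvg_fst cvg_fst).
have c2 : (fun z : M * 'rV[R]_2 * 'M[R]_2 => z.1.2) @ F --> q0.
  exact: (@cvg_comp _ _ _ fst snd F _ _ cvg_fst cvg_snd).
have c3 : (fun z : M * 'rV[R]_2 * 'M[R]_2 => z.2) @ F --> A0 by exact: cvg_snd.
have ci : (fun z : M * 'rV[R]_2 * 'M[R]_2 => chart_inv b z.1.2) @ F --> f x.
  rewrite -q0K; apply: (@cvg_comp _ _ _ _ (chart_inv b) F _ _ c2).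
  exact: (chart_inv_continuous bq0).
have cb : (fun z : M * 'rV[R]_2 * 'M[R]_2 => chart_fun b0 (chart_inv b z.1.2)) @ F
    --> chart_fun b0 (f x).
  exact: (@cvg_comp _ _ _ _ (chart_fun b0) F _ _ ci (chart_fun_continuous d1)).
have cf0 : f0 @ x --> f0 x by exact: (C1_cont (endoP f0)).
have cf0' : (fun z : M * 'rV[R]_2 * 'M[R]_2 => chart_fun b0 (f0 z.1.1)) @ F
    --> chart_fun b0 (f0 x).
  apply: (@cvg_comp _ _ _ (fun z : M * 'rV[R]_2 * 'M[R]_2 => f0 z.1.1) (chart_fun b0) F _ _).
    exact: (@cvg_comp _ _ _ _ f0 F _ _ c1 cf0).
  exact: (chart_fun_continuous d0).
have cJ1 : (fun z : M * 'rV[R]_2 * 'M[R]_2 => Jc a0 a id z.1.1) @ F --> Jc a0 a id x.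
  exact: (@cvg_comp _ _ _ _ (Jc a0 a id) F _ _ c1 (Jc_cont C1_id aa0 aa a0x ax)).
have cJ2 : (fun z : M * 'rV[R]_2 * 'M[R]_2 => Jc b b0 id (chart_inv b z.1.2)) @ F
    --> Jc b b0 id (f x).
  exact: (@cvg_comp _ _ _ _ (Jc b b0 id) F _ _ ci (Jc_cont C1_id ab ab0 bx d1)).
have cJ0 : (fun z : M * 'rV[R]_2 * 'M[R]_2 => Jc a0 b0 f0 z.1.1) @ F --> Jc a0 b0 f0 x.
  exact: (@cvg_comp _ _ _ _ (Jc a0 b0 f0) F _ _ c1 (Jc_cont (endoP f0) aa0 ab0 a0x d0)).
have JE : Jc a0 b0 f x = Jc a0 a id x *m A0 *m Jc b b0 id (f x).
  have [df _] := C1_diff (endoP f) aa ab ax bx.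
  exact: (Jc_change (C1_cont (endoP f)) aa ab aa0 ab0 ax bx a0x d1 df).2.
have ce : (fun _ : M * 'rV[R]_2 * 'M[R]_2 => e) @ F --> e by exact: (@cvg_cst _ e _ F _).
have near1 : \forall z \near F, chart_dom b0 (chart_inv b z.1.2) by exact: (ci _ (near_dom d1)).
have near2 : \forall z \near F,
    `|chart_fun b0 (chart_inv b z.1.2) - chart_fun b0 (f0 z.1.1)| < e.
  exact: (near_ltr (cvg_norm (cvgB cb cf0')) ce n1).
have near3 : \forall z \near F,
    `|Jc a0 a id z.1.1 *m z.2 *m Jc b b0 id (chart_inv b z.1.2) - Jc a0 b0 f0 z.1.1| < e.
  rewrite JE in j1.
  exact: (near_ltr (cvg_norm (cvgB (cvg_mulmx (cvg_mulmx cJ1 c3) cJ2) cJ0)) ce j1).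
have [[U12 U3] /= [[[U1 U2] /= [nU1 nU2] U12E] nU3] HU] := filterI near1 (filterI near2 near3).
have /nbhs_ballP[r2 r20 B2] := nU2.
have /nbhs_ballP[r3 r30 B3] := nU3.
pose r := Num.min r2 r3 / 2.
have r0 : 0 < r by rewrite divr_gt0 // lt_min; apply/andP.
exists r => //.
have cfx : f @ x --> f x by exact: (C1_cont (endoP f)).
have cq : (fun y => chart_fun b (f y)) @ x --> q0.
  exact: (@cvg_comp _ _ _ f (chart_fun b) (nbhs x) _ _ cfx (chart_fun_continuous bx)).
have cA : Jc a b f @ x --> A0 by exact: (Jc_cont (endoP f)).
have n2 : \forall y \near x, `|q0 - chart_fun b (f y)| < r by move/cvgrPdist_lt: cq; exact.
have n3 : \forall y \near x, `|A0 - Jc a b f y| < r by move/cvgrPdist_lt: cA; exact.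
have n4 := near_dom ax.
have n5 : \forall y \near x, chart_dom b (f y) by exact: (cfx _ (near_dom bx)).
near=> y => h by_ hq hA Ky.
have ay : chart_dom a y by near: y.
have y2 : `|q0 - chart_fun b (f y)| < r by near: y.
have y3 : `|A0 - Jc a b f y| < r by near: y.
have y1 : U1 y by near: y.
have rr : r + r <= Num.min r2 r3 by rewrite /r -splitr.
have z2 : U2 (chart_fun b (h y)).
  apply: B2; rewrite -ball_normE /=.
  have -> : q0 - chart_fun b (h y) = (q0 - chart_fun b (f y)) - (chart_fun b (h y) - chart_fun b (f y)).
    by rewrite opprB addrA subrK.
  apply: le_lt_trans (ler_normB _ _) _.
  apply: (@lt_le_trans _ _ (r + r)); first exact: (ltrD y2 hq).
  by apply: le_trans rr _; rewrite ge_min lexx.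
have z3 : U3 (Jc a b h y).
  apply: B3; rewrite -ball_normE /=.
  have -> : A0 - Jc a b h y = (A0 - Jc a b f y) - (Jc a b h y - Jc a b f y).
    by rewrite opprB addrA subrK.
  apply: le_lt_trans (ler_normB _ _) _.
  apply: (@lt_le_trans _ _ (r + r)); first exact: (ltrD y3 hA).
  by apply: le_trans rr _; rewrite ge_min lexx orbT.
have z12 : U12 (y, chart_fun b (h y)) by apply: U12E; split.
have /= [w1 [w2 w3]] := HU (y, chart_fun b (h y), Jc a b h y) (conj z12 z3).
rewrite (chart_funK by_) in w1 w2 w3.
split; [exact: w1|exact: w2|].
have [dh _] := C1_diff (endoP h) aa ab ay by_.
have a0y := Ka _ Ky.
have -> : Jc a0 b0 h y = Jc a0 a id y *m Jc a b h y *m Jc b b0 id (h y).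
  exact: (Jc_change (C1_cont (endoP h)) aa ab aa0 ab0 ay by_ a0y w1 dh).2.
exact: w3.
Unshelve. all: by end_near. Qed.

Lemma nbhs_germ f (U : set (End1 M)) : nbhs f U -> exists W,
  germ_condition f W /\ forall h, (forall y, W h y) -> U h.
Proof.
move=> /nbhs_End1[D [D1 D2 D3]].
suff [W [gW HW]] : exists W, germ_condition f W /\
    forall h, (forall y, W h y) -> forall B, B \in D -> B h.
  by exists W; split => // h Wh; apply: D3; exact: HW.
elim: D D1 D2 {D3} => [|B D IH] D1 D2.
  exists (fun _ _ => True); split => //; split => // x a b *.
  by exists 1 => //; near=> y.
have [W1 [[g1 l1] H1]] := subbasic_germ (D1 B (mem_head _ _)) (D2 B (mem_head _ _)).
have [|C CD|W2 [[g2 l2] H2]] := IH.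
- by move=> C CD; apply: D1; rewrite inE CD orbT.
- by apply: D2; rewrite inE CD orbT.
exists (fun h y => W1 h y /\ W2 h y); split; last first.
  move=> h Wh C; rewrite inE => /orP[/eqP ->|CD].
    by apply: H1 => y; case: (Wh y).
  by apply: H2 => // y; case: (Wh y).
split.
  by move=> h h' y hh' [w1 w2]; split; [exact: (g1 h)|exact: (g2 h)].
move=> x a b aa ab ax bx.
have [e1 e10 n1] := l1 x a b aa ab ax bx; have [e2 e20 n2] := l2 x a b aa ab ax bx.
exists (Num.min e1 e2); first by rewrite lt_min e10.
apply: filterS2 n1 n2 => y h1 h2 h bh; rewrite !lt_min => /andP[q1 q2] /andP[j1 j2].
by split; [exact: h1|exact: h2].
Unshelve. all: by end_near. Qed.

End C1Topology.

(** * Perturbation near one point *)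

Section KickMap.
Context {R : realType}.

Lemma diffJ_kicked (F : 'rV[R]_2 -> 'rV[R]_2) (r : R) (D : 'M[R]_2) (p0 p : 'rV[R]_2) :
  0 < r -> differentiable F p ->
  differentiable (fun q => F q + kick r D (q - p0)) p /\
  'J (fun q => F q + kick r D (q - p0)) p = 'J F p + kickJ r D (p - p0).
Proof.
move=> r0 dF; apply: diffJP => e e0.
have e2 : 0 < e / 2 by rewrite divr_gt0.
have [dk kE] := kick_diff D r0 (p - p0).
apply: filterS2 (diffJ dF e2) (diffJ dk e2) => h h1 h2.
rewrite kE in h2.
have -> : F (h + p) + kick r D (h + p - p0) - (F p + kick r D (p - p0)) -
    h *m ('J F p + kickJ r D (p - p0)) =
  (F (h + p) - F p - h *m 'J F p) +
  (kick r D (h + (p - p0)) - kick r D (p - p0) - h *m kickJ r D (p - p0)).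
  rewrite mulmxDr [h + (p - p0)]addrA.
  move: (h *m 'J F p) (h *m kickJ _ _ _) => u v.
  by apply/rv2P; rewrite !mxE; ring.
apply: le_trans (ler_normD _ _) _.
by rewrite [e]splitr mulrDl lerD.
Qed.

Lemma compact_ball (p0 : 'rV[R]_2) (r : R) : compact [set p : 'rV[R]_2 | `|p0 - p| <= r].
Proof.
apply: bounded_closed_compact.
  exists (`|p0| + r); split; first exact: num_real.
  move=> t ht p /= hp; apply: le_trans (ltW ht).
  have -> : p = p0 - (p0 - p) by rewrite opprB addrC subrK.
  by apply: le_trans (ler_normB _ _) _; rewrite lerD2l.
have -> : [set p : 'rV[R]_2 | `|p0 - p| <= r] = (fun p => `|p0 - p|) @^-1` [set t | t <= r] by [].
apply: closed_comp; last exact: closed_le.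
move=> p _.
have c1 : (fun _ : 'rV[R]_2 => p0) @ p --> p0 by exact: (@cvg_cst _ p0 _ (nbhs p) _).
have c2 : (id : 'rV[R]_2 -> 'rV[R]_2) @ p --> p by exact: cvg_id.
exact: (cvg_norm (cvgB c1 c2)).
Qed.

End KickMap.

Section LocalPerturbation.
Context {R : realType} {M : closed_surface R}.
Implicit Types (a b : chart R M) (x y : M).

(** Gluing: regularity passes to a map with the same germ. *)
Lemma C1_at_germ (f f' : M -> M) x : C1_map f -> (\forall z \near x, f z = f' z) ->
  {for x, continuous f'} /\ C1_at f' x.
Proof.
move=> Cf ff'.
have fx : f x = f' x by exact: (nbhs_singleton ff').
have cf : f @ x --> f x by exact: (C1_cont Cf).
split.
  suff : f' @ x --> f' x by [].
  by rewrite -fx; apply: (@cvg_near_eq _ _ (nbhs x) _ _ _ _ ff' cf).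
pose a := chart_at x; pose b := chart_at (f x).
have aa : atlas a by exact: chart_at_atlas.
have ab : atlas b by exact: chart_at_atlas.
have ax : chart_dom a x by exact: chart_at_dom.
have bx : chart_dom b (f x) by exact: chart_at_dom.
have ff2 : \forall y \near x, \forall z \near y, f z = f' z by exact: nbhs_interior ff'.
have nb : \forall y \near x, chart_dom b (f y) by exact: (cf _ (near_dom bx)).
have E y : chart_dom a y -> chart_dom b (f y) -> (\forall z \near y, f z = f' z) ->
    differentiable (in_charts a b f') (chart_fun a y) /\ Jc a b f' y = Jc a b f y.
  move=> ay by_ hy; have [df _] := C1_diff Cf aa ab ay by_.
  have E : \forall p \near chart_fun a y, in_charts a b f p = in_charts a b f' p.
    by apply: filterS (near_chart ay hy) => p fp; rewrite /in_charts fp.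
  exact: (diffJ_near E df).
have near_all : \forall y \near x, [/\ chart_dom a y, chart_dom b (f y) & \forall z \near y, f z = f' z].
  by near=> y; split; near: y => //; exact: near_dom.
exists a, b; split.
- by split.
- by split => //; rewrite -fx.
- by apply: filterS near_all => y [h1 h2 h3]; exact: (E y h1 h2 h3).1.
have hx := nbhs_singleton near_all.
have [x1 x2 x3] := hx.
rewrite (E x x1 x2 x3).2.
apply: (@cvg_near_eq _ _ (nbhs x) _ (Jc a b f)).
  by apply: filterS near_all => y [h1 h2 h3]; rewrite (E y h1 h2 h3).2.
exact: (Jc_cont Cf aa ab ax bx).
Unshelve. all: by end_near. Qed.

Lemma chart_ball_closed a (p0 : 'rV[R]_2) (r : R) :
  (forall p, `|p0 - p| <= r -> chart_img a p) ->
  closed (chart_inv a @` [set p : 'rV[R]_2 | `|p0 - p| <= r]).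
Proof.
move=> h; apply: (compact_closed (@surface_hausdorff R M)).
apply: continuous_compact; last exact: compact_ball.
apply: continuous_in_subspaceT => p; rewrite inE /= => hp.
exact: (chart_inv_continuous (h p hp)).
Qed.

(** In the charts, add the kick with derivative [D] at [x], cut off at a radius
    [r] so small that the support lies in [V] and that the values stay in the
    chart [b]. By [kickJ_le] the derivative changes by [9 |D|] at most, however
    small [r] is; so the germ condition holds for small [D], uniformly in [x]
    near [x0]. *)
Lemma local_perturbation (f : End1 M) (W : End1 M -> M -> Prop) (x0 : M) a b :
  germ_condition f W -> atlas a -> atlas b -> chart_dom a x0 -> chart_dom b (f x0) ->
  exists2 e : R, 0 < e & \forall x \near x0, forall (D : 'M[R]_2) (V : set M),
    `|D| <= e -> nbhs x V -> exists (f' : End1 M) (Z : set M),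
    [/\ closed Z, Z `<=` V /\ (forall y, ~ Z y -> f' y = f y),
        f' x = f x, Jc a b f' x = Jc a b f x + D & forall y, Z y -> W f' y].
Proof.
move=> [_ gW] aa ab ax0 bx0.
have [e e0 nW] := gW x0 a b aa ab ax0 bx0.
exists (e / 10); first by rewrite divr_gt0.
have cf0 : f @ x0 --> f x0 by exact: (C1_cont (endoP f)).
have nW2 : \forall x \near x0, \forall y \near x, forall h : End1 M,
       chart_dom b (h y) -> `|chart_fun b (h y) - chart_fun b (f y)| < e ->
       `|Jc a b h y - Jc a b f y| < e -> W h y by exact: nbhs_interior nW.
have nbf : \forall x \near x0, chart_dom b (f x) by exact: (cf0 _ (near_dom bx0)).
apply: filterS3 (near_dom ax0) nbf nW2 => x ax bx Wx D V De Vx.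
pose F := in_charts a b f; pose p0 := chart_fun a x.
have ap0 : chart_img a p0 by exact: chart_funP.
have p0K : chart_inv a p0 = x by exact: chart_funK.
have F0 : F p0 = chart_fun b (f x) by rewrite /F /in_charts p0K.
have bF0 : chart_img b (F p0) by rewrite F0; exact: chart_funP.
have cf : f @ x --> f x by exact: (C1_cont (endoP f)).
have /nbhs_ballP[rho rho0 Brho] : nbhs (F p0) (chart_img b).
  by apply: open_nbhs_nbhs; split => //; exact: chart_img_open.
have cF : F @ p0 --> F p0.
  have [dF _] := C1_diff (endoP f) aa ab ax bx.
  exact: differentiable_continuous dF.
have rho2 : 0 < rho / 2 by rewrite divr_gt0.
have nF : \forall p \near p0, `|F p0 - F p| < rho / 2 by move/cvgrPdist_lt: cF; exact.
have nbx : \forall y \near x, chart_dom b (f y) by exact: (cf _ (near_dom bx)).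
pose U (p : 'rV[R]_2) := [/\ chart_img a p, V (chart_inv a p),
   chart_dom b (f (chart_inv a p)), `|F p0 - F p| < rho / 2 &
   forall h : End1 M, chart_dom b (h (chart_inv a p)) ->
       `|chart_fun b (h (chart_inv a p)) - chart_fun b (f (chart_inv a p))| < e ->
       `|Jc a b h (chart_inv a p) - Jc a b f (chart_inv a p)| < e -> W h (chart_inv a p)].
have nU : \forall p \near p0, U p.
  have n1 := near_img ax; have n2 := near_chart ax Vx.
  have n3 := near_chart ax nbx; have n4 := near_chart ax Wx.
  by near=> p; split; near: p.
have /nbhs_ballP[r1 r10 BU] := nU.
(* [r] makes the values of the kick smaller than [mu], and [D1] avoids a
   division by zero *)
pose D1 := `|D| + 1.
have D10 : 0 < D1 by rewrite ltr_wpDl.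
pose mu := Num.min (rho / 2) e.
have mu0 : 0 < mu by rewrite lt_min rho2.
pose r := Num.min r1 (mu / (2 * D1)) / 2.
have mD : 0 < mu / (2 * D1) by rewrite divr_gt0 // mulr_gt0.
have r0 : 0 < r by rewrite divr_gt0 // lt_min mD andbT.
have rr1 : r < r1.
  have : r + r <= r1 by rewrite /r -splitr ge_min lexx.
  by apply: lt_le_trans; rewrite ltrDl.
have rD : 2 * r * `|D| < mu.
  apply: (@lt_le_trans _ _ ((r + r) * D1)).
    have -> : 2 * r * `|D| = (r + r) * `|D| by ring.
    by rewrite ltr_pM2l ?addr_gt0 // /D1 ltrDl.
  have : r + r <= mu / (2 * D1) by rewrite /r -splitr ge_min lexx orbT.
  rewrite ler_pdivlMr ?mulr_gt0 // => h.
  have : 0 <= (r + r) * D1 by rewrite mulr_ge0 ?addr_ge0 // ltW.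
  by move: h; rewrite mulrCA; lra.
have BU' p : `|p0 - p| < r1 -> U p by move=> hp; apply: BU; rewrite -ball_normE.
pose psi (p : 'rV[R]_2) := F p + kick r D (p - p0).
have kmu q : `|kick r D q| < mu by exact: (le_lt_trans (kick_le D r0 q) rD).
have psi_img p : U p -> chart_img b (psi p).
  move=> [_ _ _ hF _]; apply: Brho; rewrite -ball_normE /=.
  have -> : F p0 - psi p = (F p0 - F p) - kick r D (p - p0) by rewrite /psi opprD addrA.
  apply: le_lt_trans (ler_normB _ _) _; rewrite [ltRHS]splitr.
  by apply: ltrD => //; apply: lt_le_trans (kmu _) _; rewrite ge_min lexx.
pose T y := chart_dom a y /\ `|p0 - chart_fun a y| < r.
pose f1 (y : M) : M := if pselect (T y) then chart_inv b (psi (chart_fun a y)) else f y.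
pose Z := chart_inv a @` [set p : 'rV[R]_2 | `|p0 - p| <= r].
have rU p : `|p0 - p| <= r -> U p by move=> hp; apply: BU'; exact: le_lt_trans hp rr1.
have Zc : closed Z by apply: chart_ball_closed => p /rU[].
have f1Z y : ~ Z y -> f1 y = f y.
  move=> nZ; rewrite /f1; case: pselect => // -[ay hy]; exfalso; apply: nZ.
  by exists (chart_fun a y); [exact: ltW|exact: chart_funK].
have f1E y : chart_dom a y -> U (chart_fun a y) ->
    f1 y = chart_inv b (psi (chart_fun a y)).
  move=> ay Uy; rewrite /f1; case: pselect => // nT.
  have ry : r <= `|chart_fun a y - p0|.
    by rewrite distrC leNgt; apply/negP => h; apply: nT.
  have bfy : chart_dom b (f y) by case: Uy => _ _; rewrite (chart_funK ay).
  rewrite /psi (kick_outside D r0 ry) addr0 /F /in_charts (chart_funK ay).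
  exact: (esym (chart_funK bfy)).
have f1b y : chart_dom a y -> U (chart_fun a y) ->
    chart_dom b (f1 y) /\ chart_fun b (f1 y) = psi (chart_fun a y).
  move=> ay Uy; rewrite (f1E y ay Uy).
  split; first exact: chart_invP (psi_img _ Uy).
  exact: chart_invK (psi_img _ Uy).
have psiE p : U p -> in_charts a b f1 p = psi p.
  move=> Up; have [ap _ _ _ _] := Up; rewrite /in_charts.
  have [_ h] := f1b (chart_inv a p) (chart_invP ap) ltac:(by rewrite chart_invK).
  by rewrite h chart_invK.
have dF p : U p -> differentiable F p.
  move=> [ap _ bp _ _]; have [h _] := C1_diff (endoP f) aa ab (chart_invP ap) bp.
  by move: h; rewrite chart_invK.
have Uball p : `|p0 - p| < r1 -> \forall q \near p, U q.
  move=> hp.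
  have : \forall q \near p, `|p0 - q| < r1.
    have c1 : (fun _ : 'rV[R]_2 => p0) @ p --> p0 by exact: (@cvg_cst _ p0 _ (nbhs p) _).
    have c2 : (id : 'rV[R]_2 -> 'rV[R]_2) @ p --> p by exact: cvg_id.
    have c3 : (fun _ : 'rV[R]_2 => r1) @ p --> r1 by exact: (@cvg_cst _ r1 _ (nbhs p) _).
    exact: (near_ltr (cvg_norm (cvgB c1 c2)) c3 hp).
  by apply: filterS => q /BU'.
have jet y : chart_dom a y -> `|p0 - chart_fun a y| < r1 ->
    differentiable (in_charts a b f1) (chart_fun a y) /\
    Jc a b f1 y = Jc a b f y + kickJ r D (chart_fun a y - p0).
  move=> ay hy; have Uy := BU' _ hy.
  have [d1 j1] := @diffJ_kicked _ F r D p0 (chart_fun a y) r0 (dF _ Uy).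
  have E : \forall p \near chart_fun a y, psi p = in_charts a b f1 p.
    by apply: filterS (Uball _ hy) => p Up; rewrite psiE.
  have [d2 j2] := diffJ_near E d1.
  by split; [exact: d2|exact: (etrans j2 j1)].
have near_r1 y : chart_dom a y -> `|p0 - chart_fun a y| < r1 ->
    \forall z \near y, chart_dom a z /\ `|p0 - chart_fun a z| < r1.
  move=> ay hy.
  have ca : chart_fun a @ y --> chart_fun a y by exact: chart_fun_continuous.
  have c1 : (fun _ : M => p0) @ y --> p0 by exact: (@cvg_cst _ p0 _ (nbhs y) _).
  have c3 : (fun _ : M => r1) @ y --> r1 by exact: (@cvg_cst _ r1 _ (nbhs y) _).
  have n1 : \forall z \near y, `|p0 - chart_fun a z| < r1.
    exact: (near_ltr (cvg_norm (cvgB c1 ca)) c3 hy).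
  exact: (filterI (near_dom ay) n1).
have regular y : {for y, continuous f1} /\ C1_at f1 y.
  have [Zy|nZy] := pselect (Z y); last first.
    apply: (C1_at_germ (endoP f)).
    have : \forall z \near y, ~ Z z.
      by apply: open_nbhs_nbhs; split => //; exact: closed_openC.
    by apply: filterS => z nZ; rewrite f1Z.
  have [p hp py] := Zy; have [ap _ bp _ _] := rU p hp.
  have ay : chart_dom a y by rewrite -py; exact: chart_invP.
  have yp : chart_fun a y = p by rewrite -py chart_invK.
  have hy : `|p0 - chart_fun a y| < r1 by rewrite yp; exact: le_lt_trans hp rr1.
  have Uy := BU' _ hy.
  have [by1 by2] := f1b y ay Uy.
  have ny := near_r1 y ay hy.
  have ca : chart_fun a @ y --> chart_fun a y by exact: chart_fun_continuous.
  split.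
    suff : f1 @ y --> f1 y by [].
    rewrite (f1E y ay Uy).
    apply: (@cvg_near_eq _ _ (nbhs y) _ (fun z => chart_inv b (psi (chart_fun a z)))).
      by apply: filterS ny => z [az hz]; rewrite (f1E z az (BU' _ hz)).
    have cpsi : psi @ (chart_fun a y) --> psi (chart_fun a y).
      have [d1 _] := @diffJ_kicked _ F r D p0 (chart_fun a y) r0 (dF _ Uy).
      exact: differentiable_continuous d1.
    apply: (@cvg_comp _ _ _ (fun z => psi (chart_fun a z)) (chart_inv b) (nbhs y) _ _).
      exact: (@cvg_comp _ _ _ (chart_fun a) psi (nbhs y) _ _ ca cpsi).
    exact: (chart_inv_continuous (psi_img _ Uy)).
  exists a, b; split.
  - by split.
  - by split.
  - by apply: filterS ny => z [az hz]; case: (jet z az hz).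
  rewrite (jet y ay hy).2.
  apply: (@cvg_near_eq _ _ (nbhs y) _ (fun z => Jc a b f z + kickJ r D (chart_fun a z - p0))).
    by apply: filterS ny => z [az hz]; rewrite (jet z az hz).2.
  have bfy : chart_dom b (f y) by case: Uy => _ _; rewrite (chart_funK ay).
  have c1 := Jc_cont (endoP f) aa ab ay bfy.
  have cp : (fun _ : M => p0) @ y --> p0 by exact: (@cvg_cst _ p0 _ (nbhs y) _).
  have cs : (fun z => chart_fun a z - p0) @ y --> chart_fun a y - p0 by exact: (cvgB ca cp).
  have c2 : (fun z => kickJ r D (chart_fun a z - p0)) @ y --> kickJ r D (chart_fun a y - p0).
    have ck : kickJ r D @ (chart_fun a y - p0) --> kickJ r D (chart_fun a y - p0).
      exact: kickJ_cont.
    exact: (@cvg_comp _ _ _ _ (kickJ r D) (nbhs y) _ _ cs ck).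
  exact: (cvgD c1 c2).
have C1f1 : C1_map f1.
  by apply: C1_from_local => y; case: (regular y).
have hx : `|p0 - chart_fun a x| < r1 by rewrite subrr normr0.
exists (MkEnd1 C1f1), Z; split.
- exact: Zc.
- split; last exact: f1Z.
  by move=> _ [p hp <-]; case: (rU p hp).
- have E := f1E x ax (BU' _ hx); apply: (etrans E).
  by rewrite /psi subrr kick0 addr0 F0 chart_funK.
- have [_ j] := jet x ax hx; apply: (etrans j).
  by rewrite subrr kickJ0.
move=> y [p hp py]; have [ap _ bp _ Wp] := rU p hp.
have ay : chart_dom a y by rewrite -py; exact: chart_invP.
have yp : chart_fun a y = p by rewrite -py chart_invK.
have hy : `|p0 - chart_fun a y| < r1 by rewrite yp; exact: le_lt_trans hp rr1.
have Uy := BU' _ hy.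
have [by1 by2] := f1b y ay Uy.
rewrite py in Wp; apply: Wp; first exact: by1.
  rewrite [X in `|X - _|]by2 /psi /F /in_charts chart_funK // addrAC subrr add0r.
  by apply: lt_le_trans (kmu _) _; rewrite ge_min lexx orbT.
have [_ j] := jet y ay hy.
have -> : Jc a b (MkEnd1 C1f1) y - Jc a b f y = kickJ r D (chart_fun a y - p0).
  by apply: (etrans (congr1 (fun J => J - Jc a b f y) j)); rewrite addrAC subrr add0r.
apply: le_lt_trans (kickJ_le D r0 _) _.
by move: De; lra.
Unshelve. all: by end_near. Qed.

End LocalPerturbation.

(** * Franks' lemma *)

Section Franks.
Context {R : realType} {M : closed_surface R} (g : riemannian_metric M).
Implicit Types (a b : chart R M) (x y : M).

(** A local positive constant can be chosen uniform on a compact space. *)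
Lemma compact_uniform (P : R -> M -> Prop) :
  (forall e e' x, e' <= e -> P e x -> P e' x) ->
  (forall x, exists2 e, 0 < e & \forall y \near x, P e y) ->
  exists2 e, 0 < e & forall x, P e x.
Proof.
move=> mono loc.
have cov := (compact_near_coveringP _).1 (@surface_compact R M).
have : \forall e \near (0 : R)^'+, [set: M] `<=` P e.
  apply: cov => x _; have [e0 e00 He] := loc x.
  near=> y e => /=.
  apply: (mono e0); last by near: y.
  by apply: ltW; near: e; exact: nbhs_right_lt.
move=> H; have pos0 : \forall e \near (0 : R)^'+, 0 < e by exact: nbhs_right_gt.
have [e [e1 e2]] := @filter_ex _ _ (at_right_proper_filter (0 : R)) _ (filterI H pos0).
by exists e => // x; exact: e1.
Unshelve. all: by end_near. Qed.

Lemma sqr_norm_le_frob (P : 'M[R]_2) : `|P| ^+ 2 <= frob P.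
Proof.
have f0 : 0 <= frob P by rewrite frobE !addr_ge0 ?sqr_ge0.
have : `|P| <= Num.sqrt (frob P).
  apply: mx_norm_le => [|i j]; first exact: sqrtr_ge0.
  rewrite -(@ler_pXn2r _ 2%N) ?nnegrE ?sqrtr_ge0 // sqr_sqrtr // real_normK ?num_real //.
  have := sqr_ge0 (P 0 0); have := sqr_ge0 (P 0 1).
  have := sqr_ge0 (P 1 0); have := sqr_ge0 (P 1 1).
  by rewrite frobE; case: (ord2P i) => ->; case: (ord2P j) => -> *; lra.
by rewrite -(@ler_pXn2r _ 2%N) ?nnegrE ?sqrtr_ge0 // sqr_sqrtr.
Qed.

Lemma norm_le_frob (P : 'M[R]_2) c : frob P <= c -> `|P| <= 1 + c.
Proof.
move=> h; have h2 := le_trans (sqr_norm_le_frob P) h.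
by have := sqr_ge0 (`|P| - 1); rewrite expr2 in h2 *; have := normr_ge0 P; nra.
Qed.

Lemma tderiv_germ (f h : End1 M) x : (\forall y \near x, f y = h y) ->
  h x = f x /\ tderiv h x = tderiv f x.
Proof.
move=> fh; have fx : f x = h x by exact: (nbhs_singleton fh).
split; first by [].
have [df _] := C1_diff (endoP f) (chart_at_atlas x) (chart_at_atlas (f x))
  (chart_at_dom x) (chart_at_dom (f x)).
have e := Jc_germ (chart_at_dom x) fh df.
rewrite tderivE; apply: etrans e.
exact: (congr1 (fun z => Jc (chart_at x) (chart_at z) h x) (esym fx)).
Qed.

Lemma frame_algebra (X Y T J S S' B : 'M[R]_2) :
  X \in unitmx -> Y \in unitmx -> S \in unitmx -> S' \in unitmx -> X *m T = J *m Y ->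
  (J + X *m invmx S *m (B - S *m T *m invmx S') *m (S' *m invmx Y)) *m Y =
  X *m (invmx S *m B *m S').
Proof.
move=> Xu Yu Su Su' e.
rewrite mulmxDl -e mulmxA mulmxKV // mulmxBr mulmxBl !mulmxA.
by rewrite !mulmxKV // addrC subrK.
Qed.

Variable Q : M -> 'M[R]_2.
Hypothesis HQ : forall x, Q x *m g x *m (Q x)^T = 1%:M.

(** The derivative of [f] at [x] in the orthonormal frames [Q]. *)
Definition frame_deriv (f : M -> M) x : 'M[R]_2 := Q x *m tderiv f x *m invmx (Q (f x)).

Let Qu x : Q x \in unitmx. Proof. exact: orth_unit (HQ x). Qed.

(** The change from the frame [Q x], which need not depend continuously on [x],
    to the frame of a chart has its norm controlled by the metric. *)
Lemma frame_bound a x : atlas a -> chart_dom a x ->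
  frob (chart_frame a x *m invmx (Q x)) = \tr (in_frame a g x) /\
  frob (Q x *m invmx (chart_frame a x)) = \tr (invmx (in_frame a g x)).
Proof.
move=> aa ax; have Xu := frame_unit aa ax.
have E : in_frame a g x =
    (chart_frame a x *m invmx (Q x)) *m (chart_frame a x *m invmx (Q x))^T.
  by rewrite /in_frame (orth_inv (HQ x)) trmx_mul !mulmxA.
have Su := Qu x.
split; first by rewrite E.
set Y := chart_frame a x *m invmx (Q x) in E.
have Yu : Y \in unitmx by rewrite unitmx_mul Xu unitmx_inv.
have -> : Q x *m invmx (chart_frame a x) = invmx Y.
  apply: (can_inj (mulmxK Yu)).
  by rewrite mulVmx // /Y mulmxA mulmxKV // mulmxV.
rewrite E /frob mxtrace_mulC; congr (\tr _).
have Ytu : Y^T \in unitmx by rewrite unitmx_tr.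
have u : (Y *m Y^T) \in unitmx by rewrite unitmx_mul Yu.
apply: (can_inj (mulKmx u)).
by rewrite mulmxV // trmx_inv mulmxA mulmxK // mulmxV.
Qed.

(** The perturbation of [local_perturbation] in orthonormal frames, with a size
    that does not depend on the point. *)
Lemma uniform_perturbation (f : End1 M) (W : End1 M -> M -> Prop) :
  germ_condition f W ->
  exists2 e : R, 0 < e & forall x (B : 'M[R]_2) (V : set M),
    `|B - frame_deriv f x| <= e -> nbhs x V -> exists (f' : End1 M) (Z : set M),
    [/\ closed Z, Z `<=` V /\ (forall y, ~ Z y -> f' y = f y),
        f' x = f x, tderiv f' x = invmx (Q x) *m B *m Q (f x) & forall y, Z y -> W f' y].
Proof.
move=> gW.
apply: (@compact_uniform (fun e x => forall (B : 'M[R]_2) (V : set M),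
    `|B - frame_deriv f x| <= e -> nbhs x V -> exists (f' : End1 M) (Z : set M),
    [/\ closed Z, Z `<=` V /\ (forall y, ~ Z y -> f' y = f y),
        f' x = f x, tderiv f' x = invmx (Q x) *m B *m Q (f x) & forall y, Z y -> W f' y])).
  by move=> e e' x ee' H B V hB; apply: H; exact: le_trans hB ee'.
move=> x0; pose a := chart_at x0; pose b := chart_at (f x0).
have aa : atlas a by exact: chart_at_atlas.
have ab : atlas b by exact: chart_at_atlas.
have ax0 : chart_dom a x0 by exact: chart_at_dom.
have bx0 : chart_dom b (f x0) by exact: chart_at_dom.
have [e1 e10 n1] := local_perturbation gW aa ab ax0 bx0.
have cf : f @ x0 --> f x0 by exact: (C1_cont (endoP f)).
have c1 : (fun x => \tr (in_frame a g x)) @ x0 --> \tr (in_frame a g x0).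
  exact: (cvg_trace2 (gram_cont aa ax0)).
have c2 : (fun x => \tr (invmx (in_frame b g x))) @ f x0 --> \tr (invmx (in_frame b g (f x0))).
  apply: cvg_trace2; apply: cvg_invmx2; [|exact: in_frame_unit|exact: gram_cont].
  by apply: filterS (near_dom bx0) => y; exact: in_frame_unit.
have c2' : (fun x => \tr (invmx (in_frame b g (f x)))) @ x0 --> \tr (invmx (in_frame b g (f x0))).
  exact: (@cvg_comp _ _ _ f _ (nbhs x0) _ _ cf c2).
pose C1 := \tr (in_frame a g x0) + 1; pose C2 := \tr (invmx (in_frame b g (f x0))) + 1.
have cc (x : R) : (fun _ : M => x) @ x0 --> x by exact: (@cvg_cst _ x _ (nbhs x0) _).
have n2 : \forall x \near x0, \tr (in_frame a g x) < C1.
  by apply: (near_ltr c1 (cc C1)); rewrite /C1 ltrDl.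
have n3 : \forall x \near x0, \tr (invmx (in_frame b g (f x))) < C2.
  by apply: (near_ltr c2' (cc C2)); rewrite /C2 ltrDl.
pose K := 4 * ((1 + C1) * (1 + C2)) + 1.
have frob_ge0 (P : 'M[R]_2) : 0 <= frob P by rewrite frobE !addr_ge0 ?sqr_ge0.
have C10 : 0 <= C1.
  rewrite /C1 -(frame_bound aa ax0).1; have := frob_ge0 (chart_frame a x0 *m invmx (Q x0)).
  by lra.
have C20 : 0 <= C2.
  rewrite /C2 -(frame_bound ab bx0).2.
  by have := frob_ge0 (Q (f x0) *m invmx (chart_frame b (f x0))); lra.
have K0 : 0 < K by rewrite ltr_wpDl // mulr_ge0 // mulr_ge0 //; lra.
exists (e1 / K); first by rewrite divr_gt0.
have nbf : \forall x \near x0, chart_dom b (f x) by exact: (cf _ (near_dom bx0)).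
near=> x => B V hB Vx.
have ax : chart_dom a x by near: x; exact: near_dom.
have bx : chart_dom b (f x) by near: x.
pose Y := chart_frame a x *m invmx (Q x).
pose Z := Q (f x) *m invmx (chart_frame b (f x)).
have hY : `|Y| <= 1 + C1.
  by apply: norm_le_frob; rewrite (frame_bound aa ax).1 ltW //; near: x.
have hZ : `|Z| <= 1 + C2.
  by apply: norm_le_frob; rewrite (frame_bound ab bx).2 ltW //; near: x.
pose D := Y *m (B - frame_deriv f x) *m Z.
have hD : `|D| <= e1.
  apply: le_trans (norm_mulmx_le _ _) _.
  have h1 := norm_mulmx_le Y (B - frame_deriv f x).
  have h2 : `|Y| * `|B - frame_deriv f x| <= (1 + C1) * (e1 / K) by rewrite ler_pM.
  have h3 : `|Y *m (B - frame_deriv f x)| * `|Z| <= 2 * ((1 + C1) * (e1 / K)) * (1 + C2).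
    by rewrite ler_pM //; lra.
  have h4 : e1 = K * (e1 / K) by rewrite mulrC divfK // gt_eqF.
  have h5 : 0 < e1 / K by rewrite divr_gt0.
  apply: (@le_trans _ _ ((K - 1) * (e1 / K))); last by rewrite [leRHS]h4 ler_pM2r // gerBl.
  by rewrite /K in h3 *; lra.
have nx : forall (D : 'M[R]_2) (V : set M),
    `|D| <= e1 -> nbhs x V -> exists (f' : End1 M) (Z : set M),
    [/\ closed Z, Z `<=` V /\ (forall y, ~ Z y -> f' y = f y),
        f' x = f x, Jc a b f' x = Jc a b f x + D & forall y, Z y -> W f' y] by near: x.
have [f' [S [S1 S2 S3 S4 S5]]] := nx D V hD Vx.
exists f', S; split; [exact: S1|exact: S2|exact: S3| |exact: S5].
have Xu := frame_unit aa ax; have Xbu := frame_unit ab bx.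
have bx' : chart_dom b (f' x) by rewrite S3.
have E1 := frame_tderiv (endoP f) aa ab ax bx.
have E2 := frame_tderiv (endoP f') aa ab ax bx'.
apply: (can_inj (mulKmx Xu)).
apply: (etrans E2); apply: (etrans (congr2 mulmx S4 (congr1 (chart_frame b) S3))).
exact: (frame_algebra _ Xu Xbu (Qu x) (Qu (f x)) E1).
Unshelve. all: by end_near. Qed.

(** Perturb at the points [pt j] one after the other. The supports can be taken
    disjoint, so that at each point of [M] at most one perturbation acts and the
    germ condition does not deteriorate with the number of points. *)
Lemma franks (f : End1 M) (U : set (End1 M)) : nbhs f U ->
  exists2 e : R, 0 < e & forall (pt : nat -> M) (B : nat -> 'M[R]_2) (L : nat),
    injective pt -> (forall j, `|B j - frame_deriv f (pt j)| <= e) ->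
    exists2 h : End1 M, U h & forall j, (j < L)%N -> h (pt j) = f (pt j) /\
      tderiv h (pt j) = invmx (Q (pt j)) *m B j *m Q (f (pt j)).
Proof.
move=> /nbhs_germ[W [gW HW]]; have [e e0 He] := uniform_perturbation gW.
have Wf y : W f y.
  have [e' e'0 n] := gW.2 y _ _ (chart_at_atlas y) (chart_at_atlas (f y)) (chart_at_dom y) (chart_at_dom (f y)).
  have hy := nbhs_singleton n; apply: (hy f (chart_at_dom (f y))).
    by rewrite subrr normr0.
  by rewrite subrr normr0.
exists e => // pt B L inj hB.
suff H m : (m <= L)%N -> exists h : End1 M, [/\ forall y, W h y,
    forall j, (j < m)%N -> h (pt j) = f (pt j) /\
      tderiv h (pt j) = invmx (Q (pt j)) *m B j *m Q (f (pt j)) &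
    forall j, (m <= j < L)%N -> \forall y \near pt j, h y = f y].
  have [h [h1 h2 _]] := H L (leqnn L).
  by exists h; [exact: HW|exact: h2].
elim: m => [|m IH] mL.
  by exists f; split => // j _; near=> y.
have [h [h1 h2 h3]] := IH (ltnW mL).
have hm : \forall y \near pt m, h y = f y by apply: h3; rewrite leqnn.
have hm2 : \forall y \near pt m, \forall z \near y, h z = f z by exact: nbhs_interior hm.
have hm3 : \forall y \near pt m, forall j : 'I_L, nat_of_ord j != m -> y <> pt j.
  apply: filter_forall => j.
  have [->|jm] := eqVneq (nat_of_ord j) m; first by near=> y.
  have : \forall y \near pt m, ~ [set pt j] y.
    apply: open_nbhs_nbhs; split.
      apply: closed_openC; apply: accessible_closed_set1.
      exact: hausdorff_accessible (@surface_hausdorff R M).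
    by move=> /inj mj; rewrite mj eqxx in jm.
  by apply: filterS => y.
have [f' [Z [Zc [ZV f'Z] f'm f'T f'W]]] := He (pt m) (B m) _ (hB m) (filterI hm2 hm3).
pose h' y := if pselect (Z y) then f' y else h y.
have eqf' y : h y = f y -> f' y = h' y.
  by move=> hf; rewrite /h'; case: pselect => // nZ; rewrite f'Z // hf.
have nearZ y : Z y -> \forall z \near y, f' z = h' z.
  by move=> /ZV[hz _]; apply: filterS hz => z; exact: eqf'.
have nearnZ y : ~ Z y -> \forall z \near y, h z = h' z.
  move=> nZ; have : \forall z \near y, ~ Z z.
    by apply: open_nbhs_nbhs; split => //; exact: closed_openC.
  by apply: filterS => z nZz; rewrite /h'; case: pselect.
have Ch' : C1_map h'.
  have reg y : {for y, continuous h'} /\ C1_at h' y.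
    have [Zy|nZy] := pselect (Z y).
      exact: (C1_at_germ (endoP f') (nearZ y Zy)).
    exact: (C1_at_germ (endoP h) (nearnZ y nZy)).
  by apply: C1_from_local => y; case: (reg y).
exists (MkEnd1 Ch'); split.
- move=> y; have [Zy|nZy] := pselect (Z y).
    exact: (gW.1 f' (MkEnd1 Ch') y (nearZ y Zy) (f'W y Zy)).
  exact: (gW.1 h (MkEnd1 Ch') y (nearnZ y nZy) (h1 y)).
- move=> j; rewrite ltnS leq_eqVlt => /orP[/eqP ->|jm].
    have n : \forall z \near pt m, f' z = h' z by apply: filterS hm => z; exact: eqf'.
    have [t1 t2] := @tderiv_germ f' (MkEnd1 Ch') (pt m) n.
    by split; [exact: (etrans t1 f'm)|exact: (etrans t2 f'T)].
  have nZ : ~ Z (pt j).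
    move=> /ZV[_ /(_ (Ordinal (ltn_trans jm mL)))]; apply => //.
    by rewrite /= ltn_eqF.
  have [t1 t2] := @tderiv_germ h (MkEnd1 Ch') (pt j) (nearnZ _ nZ).
  have [u1 u2] := h2 j jm.
  by split; [exact: (etrans t1 u1)|exact: (etrans t2 u2)].
move=> j /andP[mj jL].
have nZ : ~ Z (pt j).
  move=> /ZV[_ /(_ (Ordinal jL))]; apply => //.
  by rewrite /= gtn_eqF.
have hj : \forall y \near pt j, h y = f y by apply: h3; rewrite jL (ltnW mj).
by apply: filterS2 (nearnZ _ nZ) hj => z e1 e2; exact: (etrans (esym e1) e2).
Unshelve. all: by end_near. Qed.

End Franks.

(** * Dense orbits *)

Section Orbits.
Context {R : realType} {M : closed_surface R}.
Implicit Types (f : M -> M) (x y : M).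

Lemma no_isolated_point x : ~ open [set x].
Proof.
move=> ox; pose a := chart_at x.
have ax : chart_dom a x by exact: chart_at_dom.
have nx : \forall y \near x, [set x] y by apply: open_nbhs_nbhs; split.
have np : \forall p \near chart_fun a x, p = chart_fun a x.
  apply: filterS2 (near_img ax) (near_chart ax nx) => p ap px.
  by rewrite -(chart_invK ap) (px : _ = x).
have /nbhs_ballP[r r0 Br] := np.
pose d : 'rV[R]_2 := const_mx (r / 2).
have dr : `|d| < r.
  apply: (@le_lt_trans _ _ (r / 2)); last by rewrite ltr_pdivrMr // mulr_natr mulr2n ltrDl.
  apply: mx_norm_le => [|i j]; first by rewrite divr_ge0 // ltW.
  by rewrite mxE ger0_norm // divr_ge0 // ltW.
have : chart_fun a x - d = chart_fun a x.
  by apply: Br; rewrite -ball_normE /= opprB addrC subrK.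
move=> /eqP; rewrite subr_eq addrC -subr_eq subrr eq_sym => /eqP d0.
have := congr1 (fun v : 'rV[R]_2 => v 0 0) d0; rewrite !mxE => /eqP.
by rewrite mulf_eq0 invr_eq0 pnatr_eq0 orbF gt_eqF.
Qed.

(** An open set minus a point is still open and non-empty. *)
Lemma open_avoid (s : nat -> M) n (U : set M) : open U -> U !=set0 ->
  exists U', [/\ open U', U' !=set0, U' `<=` U & forall y i, U' y -> (i < n)%N -> y <> s i].
Proof.
elim: n U => [|n IH] U Uo U0; first by exists U; split.
have closed1 y : closed [set y].
  by apply: accessible_closed_set1; exact: hausdorff_accessible (@surface_hausdorff R M).
have V0 : (U `&` ~` [set s n]) !=set0.
  apply: contrapT => h; apply: (@no_isolated_point (s n)).
  suff -> : [set s n] = U by [].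
  have Us y : U y -> y = s n.
    by move=> Uy; apply: contrapT => ys; apply: h; exists y.
  by apply/seteqP; split => [y ->|y /Us //]; case: U0 => z Uz; rewrite -(Us z Uz).
have [U' [h1 h2 h3 h4]] := IH _ (openI Uo (closed_openC (closed1 (s n)))) V0.
exists U'; split => //; first by move=> y /h3[].
move=> y i U'y; rewrite ltnS leq_eqVlt => /orP[/eqP ->|]; last exact: h4.
by case: (h3 y U'y).
Qed.

(** The tail of a dense orbit is dense by [open_avoid]; a repetition would make
    the orbit finite. *)
Lemma transitive_orbit f : [set: M] !=set0 -> transitive_map f -> exists x,
  injective (fun n => iter n f x) /\
  forall m (U : set M), open U -> U !=set0 -> exists2 n, (m <= n)%N & U (iter n f x).
Proof.
move=> M0 [x dx]; exists x.
have tail m (U : set M) : open U -> U !=set0 -> exists2 n, (m <= n)%N & U (iter n f x).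
  move=> Uo U0; have [U' [h1 h2 h3 h4]] := open_avoid (fun n => iter n f x) m Uo U0.
  have [y [U'y [n _ ny]]] := dx U' h2 h1.
  exists n; last by rewrite ny; exact: h3.
  by rewrite leqNgt; apply/negP => nm; exact: (h4 y n U'y nm).
split; last exact: tail.
suff inj i j : (i < j)%N -> iter i f x <> iter j f x.
  move=> i j ij; case: (ltngtP i j) => // lt; exfalso; exact: (inj _ _ lt).
move=> ij eij.
have per n : exists2 l, (l < j)%N & iter n f x = iter l f x.
  have [m] := ubnP n; elim: m n => // m IH n; rewrite ltnS => nm.
  have [nj|jn] := ltnP n j; first by exists n.
  have -> : iter n f x = iter (n - j + i) f x.
    by rewrite -{1}(subnK jn) iterD -eij -iterD.
  apply: IH; apply: leq_trans nm.
  by rewrite -{2}(subnK jn) ltn_add2l.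
have [U' [h1 h2 _ h4]] := open_avoid (fun n => iter n f x) j openT M0.
have [n _ Un] := tail 0%N U' h1 h2.
by have [l lj e] := per n; exact: (h4 _ l Un lj).
Qed.

End Orbits.

Section Main.
Context {R : realType} {M : closed_surface R} (g : riemannian_metric M).
Variable f : End1 M.

(** A vanishing derivative has a kernel of dimension two. *)
Lemma tderiv_neq0 : (forall n, (1 <= n)%N -> max_dim_ker f n = 1%N) ->
  forall n x, tderiv (iter n f) x != 0.
Proof.
move=> H [|n] x.
  rewrite (tderiv_id x); apply/eqP => /matrixP/(_ 0 0); rewrite !mxE => /eqP.
  by rewrite oner_eq0.
apply/eqP => e.
have d2 : dim_ker f n.+1 x = 2%N by rewrite /dim_ker e kermx0 mxrank1.
have := H n.+1 isT; rewrite /max_dim_ker => m1.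
have : (2 <= \max_(d < 3 | `[< exists x : M, dim_ker f n.+1 x = d >]) d)%N.
  apply: (@leq_bigmax_cond _ (fun d : 'I_3 => `[< exists x : M, dim_ker f n.+1 x = d >])
     (fun d : 'I_3 => d : nat) (Ordinal (isT : (2 < 3)%N))).
  by apply/asboolP; exists x.
by rewrite m1.
Qed.

Variable Q : M -> 'M[R]_2.
Hypothesis HQ : forall x, Q x *m g x *m (Q x)^T = 1%:M.

Let Qu x : Q x \in unitmx. Proof. exact: orth_unit (HQ x). Qed.

Lemma frame_deriv_singular (h : M -> M) x : Cr h x -> frame_deriv Q h x \notin unitmx.
Proof.
move=> Cx; apply: contra (Cx : is_true (_ \notin _)) => /=.
by rewrite !unitmx_mul => /andP[/andP[_ ->]].
Qed.

(** Chain rule: the products of the derivatives in orthonormal frames are the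
    derivatives of the iterates. *)
Lemma mprod_frames (h : End1 M) (pt : nat -> M) (A : nat -> 'M[R]_2) n l :
  (forall j, (n <= j < n + l)%N -> h (pt j) = pt j.+1 /\
     tderiv h (pt j) = invmx (Q (pt j)) *m A j *m Q (pt j.+1)) ->
  iter l h (pt n) = pt (n + l)%N /\
  mprod A n l = Q (pt n) *m tderiv (iter l h) (pt n) *m invmx (Q (pt (n + l)%N)).
Proof.
elim: l => [|l IH] H.
  by rewrite addn0 /= tderiv_id mulmx1 mulmxV.
have [|IH1 IH2] := IH.
  by move=> j /andP[nj jl]; apply: H; rewrite nj addnS ltnS ltnW.
have [H1 H2] := H (n + l)%N ltac:(by rewrite leq_addr addnS ltnS leqnn).
split; first by rewrite iterS IH1 H1 addnS.
have e := tderiv_iterS l (pt n) (endoP h).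
rewrite /= addnS IH2.
transitivity (Q (pt n) *m (tderiv (iter l h) (pt n) *m tderiv h (iter l h (pt n))) *m
   invmx (Q (pt (n + l).+1))); last by congr (_ *m _ *m _); exact: (esym e).
rewrite IH1 H2 !mulmxA mulmxK //.
Qed.

Lemma frame_derivK (h : M -> M) x :
  tderiv h x = invmx (Q x) *m frame_deriv Q h x *m Q (h x).
Proof. by rewrite /frame_deriv !mulmxA mulVmx // mul1mx mulmxKV. Qed.

End Main.

(** * Proof of the theorem *)

Section Domination.
Context {R : realType} {M : closed_surface R} (g : riemannian_metric M).
Variables (f : End1 M) (U : set (End1 M)).
Hypotheses (fU : nbhs f U) (noU : forall h, U h -> ~ full_dim_kernel h).
Variable Q : M -> 'M[R]_2.
Hypothesis HQ : forall x, Q x *m g x *m (Q x)^T = 1%:M.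
Variable pt : nat -> M.
Hypotheses (ptS : forall j, f (pt j) = pt j.+1) (pt_inj : injective pt).
Hypothesis sing0 : Cr f (pt 0%N).
Hypothesis sing : forall n, exists j, (n <= j)%N /\ Cr f (pt j).
Hypothesis tder0 : forall n x, tderiv (iter n f) x != 0.

Let Qu x : Q x \in unitmx. Proof. exact: orth_unit (HQ x). Qed.
Let A j := frame_deriv Q f (pt j).

(** The image of [A 0] is spanned by [w0]. If a perturbation of the next
    derivatives sends [w0] to [0], the map given by [franks] has an iterate with
    vanishing derivative at the critical point [pt 0]. *)
Lemma orbit_robust : exists2 e : R, 0 < e & exists2 w0 : 'rV[R]_2, w0 != 0 &
  forall B : nat -> 'M[R]_2, (forall j, `|B j - A j.+1| <= e) ->
    forall m, w0 *m mprod B 0 m != 0.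
Proof.
have [e e0 He] := franks HQ fU.
exists e => //.
have A00 : A 0%N != 0.
  apply/eqP => h; have := tder0 1 (pt 0%N); apply/negP; rewrite negbK.
  have -> : tderiv (iter 1 f) (pt 0%N) = invmx (Q (pt 0%N)) *m A 0%N *m Q (f (pt 0%N)).
    exact: frame_derivK.
  by rewrite h mulmx0 mul0mx.
have A0s : A 0%N \notin unitmx by exact: frame_deriv_singular.
have A0d : \det (A 0%N) = 0.
  by move: A0s; rewrite unitmxE unitfE negbK => /eqP.
have [z hz] : exists z : 'rV[R]_2, z *m A 0%N != 0.
  apply: contrapT => h; move/eqP: A00; apply; apply/row_matrixP => i.
  rewrite row0 rowE; apply: contrapT => h'; apply: h.
  by exists (delta_mx 0 i); apply/eqP.
exists (z *m A 0%N); first exact: hz.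
move=> B hB m; apply/eqP => wB.
pose B' j := if j is i.+1 then B i else A 0%N.
have hB' j : `|B' j - frame_deriv Q f (pt j)| <= e.
  by case: j => [|j]; [rewrite subrr normr0 ltW|exact: hB].
have [h Uh Hh] := He pt B' m.+1 pt_inj hB'.
have [] // := @mprod_frames _ _ g Q HQ h pt B' 0 m.+1.
  by move=> j jm; have [h1 h2] := Hh j jm; rewrite ptS in h1 h2.
rewrite add0n => _ E.
have BS : mprod B' 0 m.+1 = A 0%N *m mprod B 0 m.
  rewrite mprodS; congr (_ *m _); exact: (esym (mprod_shift B' 0 m)).
have B0 : mprod B' 0 m.+1 = 0.
  rewrite BS; apply/row_matrixP => i; rewrite row0 rowE mulmxA.
  have := row_line_mul A00 A0d (delta_mx 0 i : 'rV[R]_2).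
  rewrite (row_line_span A00 A0d hz) => /vlineP[k ->].
  by rewrite -scalemxAl wB scaler0.
apply: (noU Uh); exists m.+1; split => //; exists (pt 0%N); split.
  have [_ h2] := Hh 0%N isT; rewrite ptS in h2.
  suff e2 : tderiv h (pt 0%N) \notin unitmx by exact: e2.
  rewrite h2; apply: contra A0s.
  by rewrite !unitmx_mul => /andP[/andP[_ ->]].
suff e2 : tderiv (iter m.+1 h) (pt 0%N) = 0 by rewrite /dim_ker e2 kermx0 mxrank1.
have -> : tderiv (iter m.+1 h) (pt 0%N) =
    invmx (Q (pt 0%N)) *m mprod B' 0 m.+1 *m Q (pt m.+1).
  by rewrite E !mulmxA mulVmx // mul1mx mulmxKV.
by rewrite B0 mulmx0 mul0mx.
Qed.

Lemma deriv_bounded : exists L : R, forall x, `|frame_deriv Q f x| <= L.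
Proof.
have ce : continuous (expansion g f) by exact: (expansion_cont (endoP f)).
have [||m _ Hm] := @compact_EVT_max M R (expansion g f) setT _ (@surface_compact R M).
- by exists (pt 0%N).
- exact: continuous_subspaceT.
exists (1 + expansion g f m) => x; apply: norm_le_frob.
rewrite -(expansion_frob (HQ x) (HQ (f x))); apply: Hm.
by rewrite inE.
Qed.

Hypothesis dense_pt : forall m (V : set M), open V -> V !=set0 ->
  exists2 n, (m <= n)%N & V (pt n).

(** [dominated_sequence] applies to the derivatives at [pt 1], [pt 2], and so on;
    its conclusion holds on a dense set and extends to [M]. *)
Lemma orbit_dominated : dominated_splitting g f.
Proof.
have [e e0 [w0 w00 Hrob]] := orbit_robust.
have [L HL] := deriv_bounded.
have As n : exists j, (n <= j)%N /\ A j.+1 \notin unitmx.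
  have [j [nj Cj]] := sing n.+1; exists j.-1.
  case: j nj Cj => // j nj Cj; split; first exact: nj.
  exact: frame_deriv_singular Cj.
have [th [c [N [k [/andP[th0 th8] c0 k1 _ Hdom]]]]] :=
  @dominated_sequence _ (fun j => A j.+1) w0 e L e0 (fun j => HL _) As Hrob.
have itS l n : iter l f (pt n) = pt (n + l)%N.
  by elim: l => [|l IH]; rewrite ?addn0 // iterS IH ptS addnS.
have mpE n l : mprod (fun j => A j.+1) n l =
    Q (pt n.+1) *m tderiv (iter l f) (pt n.+1) *m invmx (Q (iter l f (pt n.+1))).
  rewrite mprod_shift.
  have [] // := @mprod_frames _ _ g Q HQ f pt A n.+1 l.
    by move=> j _; rewrite -ptS; split => //; exact: frame_derivK.
  by move=> e1 e2; rewrite e2 -e1.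
pose D := [set pt n.+1 | n in [set n | (1 <= n)%N]].
have Dd : dense D.
  move=> V V0 Vo; have [n n2 Vn] := dense_pt 2 Vo V0.
  exists (pt n); split => //; exists n.-1; last by rewrite prednK // ltnW.
  by rewrite /= -ltnS prednK // ltnW.
have CN := C1_iter N (endoP f).
have F0 x : 0 < expansion g (iter N f) x by exact: expansion_gt0.
have qfE n v : qf (g (pt n.+1)) v = dot (v *m invmx (Q (pt n.+1))) (v *m invmx (Q (pt n.+1))).
  by rewrite (orth_inv (HQ (pt n.+1))) qf_mulT.
have qnE n l v : qf (pull g (iter l f) (pt n.+1)) v =
   dot (v *m invmx (Q (pt n.+1)) *m mprod (fun j => A j.+1) n l)
       (v *m invmx (Q (pt n.+1)) *m mprod (fun j => A j.+1) n l).
  rewrite mpE; exact: (pull_qf_frames (HQ _) (HQ _)).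
have exE n : expansion g (iter N f) (pt n.+1) = frob (mprod (fun j => A j.+1) n N).
  by rewrite mpE; exact: (expansion_frob (HQ _) (HQ _)).
have areaH x : area g (iter N f) x <= (th - th ^+ 2) / 2 * expansion g (iter N f) x ^+ 2.
  apply: (area_limit (endoP f) Dd); move=> _ [n n1 <-].
  rewrite exE (area_det (HQ _) (HQ _)) -mpE.
  by case: (Hdom n n1).
have transport (F1 F2 q0 qN qk qkN G1 G2 r0 rN rk rkN : R) :
    F1 = G1 -> F2 = G2 -> q0 = r0 -> qN = rN -> qk = rk -> qkN = rkN ->
    (th / 2 * G1 * r0 <= rN -> 2 * th * G2 * rk <= rkN /\ c * r0 <= rk) ->
    th / 2 * F1 * q0 <= qN -> 2 * th * F2 * qk <= qkN /\ c * q0 <= qk.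
  by move=> -> -> -> -> -> ->; exact.
have coneD y : D y -> forall v, th / 2 * expansion g (iter N f) y * qf (pull g (iter 0 f) y) v
      <= qf (pull g (iter N f) y) v ->
    2 * th * expansion g (iter N f) (iter k f y) * qf (pull g (iter k f) y) v
      <= qf (pull g (iter (k + N) f) y) v /\
    c * qf (pull g (iter 0 f) y) v <= qf (pull g (iter k f) y) v.
  move=> [n n1 <-] v.
  have p0 : qf (pull g (iter 0 f) (pt n.+1)) v = qf (g (pt n.+1)) v.
    by have -> : pull g (iter 0 f) (pt n.+1) = g (pt n.+1) by exact: pull_id.
  have ek : iter k f (pt n.+1) = pt (n + k).+1 by rewrite itS addSn.
  have Ex : expansion g (iter N f) (iter k f (pt n.+1)) =
      frob (mprod (fun j => A j.+1) (n + k) N).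
    exact: (etrans (congr1 (expansion g (iter N f)) ek) (exE (n + k)%N)).
  have [_ H] := Hdom n n1.
  exact: (transport _ _ _ _ _ _ _ _ _ _ _ _ (exE n) Ex (etrans p0 (qfE n v))
    (qnE n N v) (qnE n k v) (qnE n (k + N)%N v) (H (v *m invmx (Q (pt n.+1))))).
have coneH := cone_limit (endoP f) Dd th0 F0 coneD.
apply: (dominated_splitting_from_cones (endoP f) k1 th0 th8 c0 F0 areaH) => x v hv.
have e0' : qf (g x) v = qf (pull g (iter 0 f) x) v.
  exact: (esym (congr1 (fun P => qf P v) (pull_id g x))).
have hv' : th * expansion g (iter N f) x * qf (pull g (iter 0 f) x) v
    <= qf (pull g (iter N f) x) v.
  exact: (eq_ind _ (fun t => th * expansion g (iter N f) x * t <= _) hv _ e0').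
have [h1 h2] := coneH x v hv'; split; first exact: h1.
exact: (eq_ind_r (fun t => c * t <= _) h2 e0').
Qed.

End Domination.

Theorem mainTheorem9 (R : realType) (M : closed_surface R)
    (g : riemannian_metric M) (f : End1 M) :
  transitive_map f ->
  (Cr f)° !=set0 ->
  (forall n : nat, (1 <= n)%N -> max_dim_ker f n = 1%N) ->
  dominated_splitting g f \/
  closure [set h : End1 M | full_dim_kernel h] f.
Proof.
move=> ftr [x1 Cx1] fker.
have [cl|ncl] := pselect (closure [set h : End1 M | full_dim_kernel h] f); [by right|left].
have [U fU noU] : exists2 U, nbhs f U & forall h, U h -> ~ full_dim_kernel h.
  apply: contrapT => H; apply: ncl => B Bf; apply: contrapT => nB; apply: H.
  by exists B => // h Bh hf; apply: nB; exists h.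
have M0 : [set: M] !=set0 by exists x1.
have [x [xinj xd]] := transitive_orbit M0 ftr.
have Co : open (Cr f)° by exact: open_interior.
have [n0 _ Cn0] := xd 0%N _ Co (ex_intro _ x1 Cx1).
have [Q HQ] := choice (metric_frame g).
pose pt j := iter (j + n0) f x.
apply: (@orbit_dominated _ _ g f U fU noU Q HQ pt).
- by move=> j; rewrite /pt addSn iterS.
- by move=> i j /xinj /addIn.
- exact: interior_subset Cn0.
- move=> n; have [j nj Cj] := xd (n + n0)%N _ Co (ex_intro _ x1 Cx1).
  have n0j : (n0 <= j)%N by rewrite (leq_trans _ nj) // leq_addl.
  exists (j - n0)%N; split; first by rewrite leq_subRL // addnC.
  by rewrite /pt subnK //; exact: interior_subset Cj.
- exact: tderiv_neq0.
move=> m V Vo V0; have [n mn Vn] := xd (m + n0)%N V Vo V0.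
have n0n : (n0 <= n)%N by rewrite (leq_trans _ mn) // leq_addl.
exists (n - n0)%N; first by rewrite leq_subRL // addnC.
by rewrite /pt subnK.
Qed.
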